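(* Consider Smoluchowski's discrete model with $N\ge 2$ particles and threshold $\alpha(N)$ (defined in the context), started with no links. For every $t\ge 0$ and every integer $k$ with $\mathbb{P}(N n^{(N)}_t=k)>0$, conditionally on $\{N n^{(N)}_t = k\}$, the configuration in solution $C(t)$, considered up to graph isomorphism, has the law of an Erdős–Rényi random graph $ER(k,p^{(N)}_t)$ conditioned on having no connected component with at least $\alpha(N)$ vertices. Moreover, if there exists $\gamma>1/3$ such that $\alpha(N)/(N^{2/3}\log^{\gamma} N)\to\infty$ and $\alpha(N)/N\to 0$ as $N\to\infty$, then the process $(n^{(N)}_t)_{t\ge 0}$ converges in distribution in the Skorokhod space $\mathbb{D}(\mathbb{R}^+,\mathbb{R})$ to the deterministic function \[ n_t=\begin{cases}1, & t\le 1,\\ 1/t, & t\ge 1.\end{cases} \]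
   Context: Smoluchowski's discrete model: fix $N\ge 2$ and a sequence $(\alpha(N))$ with $\alpha(N)\to\infty$ and $\alpha(N)/N\to 0$. Particles are $[N]=\{1,\dots,N\}$. To each unordered pair $\{i,j\}$ of particles attach an independent exponential clock $e_{ij}$ with parameter $1/N$. Initially no links exist. When a clock $e_{ij}$ rings (the link is then called activated), the link between $i$ and $j$ is created, except if $i$ or $j$ belongs at that moment to a cluster (connected component of the graph of created links) of size at least $\alpha(N)$; in that case the link is never created. Clusters of size $\ge\alpha(N)$ are called large, the others small; particles in small clusters are in solution. $S(t)$ is the set of particles in solution at time $t$, $n^{(N)}_t=\#S(t)/N$, $p^{(N)}_t=1-e^{-t/N}$, and the configuration in solution $C(t)$ is the graph with vertex set $S(t)$ and edge set $\{\{i,j\}\subset S(t): e_{ij}\le t\}$. All processes are càdlàg. $ER(n,p)$ denotes the Erdős–Rényi graph on $n$ vertices where each edge is present independently with probability $p$. *)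

(* Defs.v *)
From HB Require Import structures.
From mathcomp Require Import all_boot all_order all_algebra.
From mathcomp Require Import all_classical all_reals all_analysis.
Set Implicit Arguments. Unset Strict Implicit. Unset Printing Implicit Defensive.
Import Order.TTheory GRing.Theory Num.Theory.
Import numFieldNormedType.Exports.
Local Open Scope ring_scope.

(** Unordered pairs {i,j} of distinct particles of [n] = 'I_n, encoded as i < j. *)
Notation pair n := {p : 'I_n * 'I_n | (nat_of_ord p.1 < nat_of_ord p.2)%N}.

Definition adjL (n : nat) (L : {set pair n}) : rel 'I_n :=
  [rel x y | [exists p in L, (val p == (x, y)) || (val p == (y, x))]].

Definition csize (n : nat) (L : {set pair n}) (x : 'I_n) : nat :=
  #|[set y | connect (adjL L) x y]|.

Definition graph_iso (T1 T2 : finType) (V1 : {set T1}) (r1 : rel T1)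
    (V2 : {set T2}) (r2 : rel T2) : Prop :=
  exists f : T1 -> T2, [/\ {in V1 &, injective f}, f @: V1 = V2 &
      {in V1 &, forall a b, r1 a b = r2 (f a) (f b)}].

Section Model.
Variables (R : realType) (N : nat) (alpha : R).

Definition small (L : {set pair N}) (x : 'I_N) : bool := ((csize L x)%:R < alpha).

(** Given the clock values [e], process the clocks in increasing order:
    the link of the pair rings and is created iff both endpoints are in small
    clusters of the graph of links created before.  (Ties, a null event, are
    broken by the enumeration order of the pairs.) *)
Definition step (L : {set pair N}) (p : pair N) : {set pair N} :=
  if small L (val p).1 && small L (val p).2 then p |: L else L.

Definition created (e : pair N -> R) : {set pair N} :=
  foldl step finset.set0 (sort (fun p q => e p <= e q) (enum {: pair N})).

Definition links (e : pair N -> R) (t : R) : {set pair N} :=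
  [set p in created e | e p <= t].

Definition Ssol (e : pair N -> R) (t : R) : {set 'I_N} :=
  [set i | small (links e t) i].

Definition nproc (e : pair N -> R) (t : R) : R := #|Ssol e t|%:R / N%:R.

Definition Cadj (e : pair N -> R) (t : R) : rel 'I_N :=
  [rel i j | [&& i \in Ssol e t, j \in Ssol e t &
     [exists p : pair N, ((val p == (i, j)) || (val p == (j, i))) && (e p <= t)]]].
End Model.

Definition er_weight (R : realType) (k : nat) (p : R) (G : {set pair k}) : R :=
  p ^+ #|G| * (1 - p) ^+ (#|{: pair k}| - #|G|).

Definition no_large (R : realType) (k : nat) (alpha : R) (G : {set pair k}) : bool :=
  [forall x, (csize G x)%:R < alpha].

Definition er_cond_iso (R : realType) (k : nat) (p alpha : R) (H : {set pair k}) : R :=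
  (\sum_(G : {set pair k} | no_large alpha G &&
        `[< graph_iso [set: 'I_k] (adjL H) [set: 'I_k] (adjL G) >]) er_weight p G)
  / (\sum_(G : {set pair k} | no_large alpha G) er_weight p G).

Definition mutually_independent (d : measure_display) (R : realType)
    (T : measurableType d) (P : probability T R) (I : finType) (X : T -> I -> R) :=
  forall B : I -> set R, (forall i, measurable (B i)) ->
    P (\bigcap_(i in [set: I]%classic) ((fun w => X w i) @^-1` B i))%classic =
    (\prod_(i : I) P ((fun w => X w i) @^-1` B i)%classic)%E.

Definition clock_model (d : measure_display) (R : realType) (N : nat)
    (T : measurableType d) (P : probability T R) (e : T -> pair N -> R) : Prop :=
  [/\ forall p, measurable_fun [set: T]%classic (fun w => e w p),
      mutually_independent P e &
      forall p (B : set R), measurable B ->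
        P ((fun w => e w p) @^-1` B)%classic = exponential_prob (N%:R^-1) B].

Local Open Scope classical_set_scope.

Definition cadlag (R : realType) (x : R -> R) : Prop :=
  (forall t, 0 <= t -> x @ t^'+ --> x t) /\ (forall t, 0 < t -> cvg (x @ t^'-)).

Definition time_change (R : realType) (l : R -> R) : Prop :=
  [/\ l 0 = 0, {in `[0, +oo[ &, {mono l : s t / s < t}},
      {within `[0, +oo[, continuous l} &
      forall s, 0 <= s -> exists2 t, 0 <= t & l t = s].

(** Convergence x_n --> x in the Skorokhod J1 topology of D(R+, R)
    (Billingsley, Convergence of Probability Measures, Thm 16.2). *)
Definition skorokhod_cvg (R : realType) (xn : nat -> R -> R) (x : R -> R) : Prop :=
  exists ln : nat -> R -> R, [/\ forall n, time_change (ln n),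
    (forall eps : R, 0 < eps -> \forall n \near \oo,
       forall t, 0 <= t -> `|ln n t - t| <= eps) &
    (forall T eps : R, 0 < eps -> \forall n \near \oo,
       forall t, 0 <= t <= T -> `|xn n (ln n t) - x t| <= eps)].

(** (Sequentially) continuous functionals on the metrizable space D(R+, R). *)
Definition skorokhod_continuous (R : realType) (f : (R -> R) -> R) : Prop :=
  forall xn x, (forall n, cadlag (xn n)) -> cadlag x ->
    skorokhod_cvg xn x -> f \o xn @ \oo --> f x.

Definition cvg_dist_skorokhod (d : measure_display) (R : realType)
    (Om : nat -> measurableType d) (P : forall N, probability (Om N) R)
    (X : forall N, Om N -> R -> R) (x : R -> R) : Prop :=
  forall f : (R -> R) -> R, (exists M : R, forall y, `|f y| <= M) ->
    skorokhod_continuous f ->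
    (fun N => (\int[P N]_w (f (X N w))%:E)%E) @ \oo --> (f x)%:E.

Definition nlim (R : realType) (t : R) : R := if t <= 1 then 1 else t^-1.

(* Main.v *)
Require Import Defs.
From HB Require Import structures.
From mathcomp Require Import all_boot all_order all_algebra.
From mathcomp Require Import all_classical all_reals all_analysis.
From mathcomp Require Import ring lra measurable_realfun.
Set Implicit Arguments. Unset Strict Implicit. Unset Printing Implicit Defensive.
Import Order.TTheory GRing.Theory Num.Theory.
Import numFieldNormedType.Exports.
Local Open Scope ring_scope.

(** Conditional law.  If S is the set of particles in solution at time t, no
    link between S and its complement has been created, so the dynamics on the
    complement of S is the same as if the clocks inside S never rang, while
    inside S every link that has rung is created.  Hence {S(t) = S} and
    {the configuration inside S is G} factorize, for G without large component,
    into an event on the clocks outside S and the Erdos-Renyi weight of G.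

    Limit.  Let u_z be 1/N times the sum of z ^ |C(x)| over the particles x
    in solution, so that u_1 = n.  Up to errors O(1/N + 1/alpha) for z bounded
    away from 1, d(u_z)/dt = (u_z - n) z (u_z)'.  Hence u is conserved along the
    characteristic z_t = v exp(Phi_t - t v), Phi_t being the integral of n: one
    has u_(z_t) ~ v, hence n_t >= v, as long as z_t stays below 1.  The same
    normalized sum of (1 - z ^ |C(x)|) / |C(x)| is at most 1 - z at time 0 and has
    drift at most - (n - u_z)^2 / 2 + alpha / (2N), so n is close
    to u_z in time average for z close to 1.  For v > 1/t the map v |-> z_t
    is decreasing whereas z |-> u_z is nondecreasing, so two such characteristics
    cannot both stay below 1; at the largest v whose
    characteristic does, either n_t <= v or z_t ~ 1 and n_t ~ u_(z_t) ~ v, which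
    gives n_t <= max(1, t)^-1 + o(1) in time average.  Integrating bounds Phi,
    hence keeps z_t < 1 for every v < max(1, t)^-1: this is the lower bound.

    All this is done for a lazy discrete-time chain (one uniformly chosen pair
    rings with probability O(h) in each step of length h), whose expectations
    are finite sums; a one-step comparison and h -> 0 transfer it to the clocks.
    Since n is nonincreasing and its limit continuous, convergence at each time
    gives uniform convergence on compact intervals. *)

(** * Components of link graphs *)

Section Graph.
Variables (N : nat).
Implicit Types (L : {set pair N}) (p : pair N) (x y u : 'I_N).

(** The obstacle is that every estimate on u_z degenerates at z = 1: the constant sup_m m^2 z^m
    blows up. A characteristic is therefore killed as soon as it exceeds a fixed rho < 1, and only
    the error before killing is estimated, by a Gronwall iteration of second moments. This is what
    avoids circularity: the upper bound on n makes no assumption on which characteristics survive,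
    since it compares a surviving one with a killed neighbour; it then bounds Phi, and this shows
    that the characteristics needed for the lower bound do survive. The Gronwall argument closes
    because n cancels: moving z by the factor exp (h (n - v)) changes u_z by h w (n - v), with w = z
    (u_z)', the dynamics changes it by h w (u_z - n), and the sum h w (u_z - v) involves only the
    error itself. Fluctuations are small since a merger moves u_z by O(1/N) and about N^2 pairs ring
    at rate 1/N, which leaves a variance of order 1/N. Finitely many v suffice, taken on a grid of
    mesh d. The limits are nested: h = t/m tends to 0 with N fixed, then N tends to infinity with d
    and rho fixed. Hence discretisation errors may carry any power of N. *)

Lemma adjLP L x y : reflect (exists2 p, p \in L & val p = (x, y) \/ val p = (y, x))
  (adjL L x y).
Proof.
apply: (iffP existsP) => [[p /andP[pL /orP[]/eqP e]]|[p pL [e|e]]].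
- by exists p => //; left.
- by exists p => //; right.
- by exists p; rewrite pL e eqxx.
- by exists p; rewrite pL e eqxx orbT.
Qed.

Lemma adjL_sym L : symmetric (adjL L).
Proof. by move=> x y; apply: eq_existsb => p; rewrite orbC. Qed.

Lemma connectL_sym L : connect_sym (adjL L).
Proof. exact/sym_connect_sym/adjL_sym. Qed.

Lemma adjL_in L p : p \in L -> adjL L (val p).1 (val p).2.
Proof. by move=> pL; apply/adjLP; exists p => //; left; case: (val p). Qed.

Lemma connect_subL L L' : L \subset L' -> subrel (connect (adjL L)) (connect (adjL L')).
Proof.
move=> LL'; apply: connect_sub => x y /adjLP[p pL e].
by apply: connect1; apply/adjLP; exists p => //; apply: (fintype.subsetP LL').
Qed.

Lemma csize_subL L L' x : L \subset L' -> (csize L x <= csize L' x)%N.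
Proof.
by move=> LL'; apply: subset_leq_card; apply/fintype.subsetP => y; rewrite !inE; apply: connect_subL.
Qed.

Lemma csize_connect L x y : connect (adjL L) x y -> csize L x = csize L y.
Proof.
move=> xy; apply: eq_card => z; rewrite !inE.
exact: (same_connect (@connectL_sym L)).
Qed.

Lemma csize_gt0 L x : (0 < csize L x)%N.
Proof. by apply/card_gt0P; exists x; rewrite inE connect0. Qed.

Lemma csize_le L x : (csize L x <= N)%N.
Proof. by apply: leq_trans (max_card _) _; rewrite card_ord. Qed.

Lemma csize0 x : csize finset.set0 x = 1%N.
Proof.
rewrite /csize (_ : [set y | _] = [set x]) ?cards1 //.
apply/setP => y; rewrite !inE eq_sym; apply/idP/eqP => [|->]; last exact: connect0.
by case/connectP => -[|z q] //= /andP[/adjLP[p]]; rewrite inE.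
Qed.

(** A path needs the new link at most once, in one of its two directions: crossing it back only
    returns to the cluster already left. *)
Lemma connect_add L p u z :
  connect (adjL (p |: L)) u z =
  [|| connect (adjL L) u z,
      connect (adjL L) u (val p).1 && connect (adjL L) (val p).2 z |
      connect (adjL L) u (val p).2 && connect (adjL L) (val p).1 z].
Proof.
set x := (val p).1; set y := (val p).2.
have sub : subrel (connect (adjL L)) (connect (adjL (p |: L))).
  exact/connect_subL/finset.subsetUr.
have xy : connect (adjL (p |: L)) x y by apply/connect1/adjL_in; rewrite !inE eqxx.
have yx : connect (adjL (p |: L)) y x by rewrite connectL_sym.
apply/idP/idP; last first.
  case/or3P => [/sub //|/andP[/sub a /sub b]|/andP[/sub a /sub b]].
    exact: connect_trans a (connect_trans xy b).
  exact: connect_trans a (connect_trans yx b).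
case/connectP => q; elim: q u => [|s q IH] u /= => [_ -> |/andP[us sq] zl].
  by rewrite connect0.
have {}IH := IH s sq zl.
case/adjLP: us => r; rewrite !inE => /orP[/eqP->|rL] e.
  have {e} [[eu es]|[eu es]] : (u = x /\ s = y) \/ (u = y /\ s = x).
    by rewrite /x /y; case: e => ->; [left|right].
  - subst u s; rewrite connect0 /=; case/or3P: IH => [->|/andP[_ ->]|/andP[_ ->]] //.
    + by rewrite orbT.
    + by rewrite orbT.
  - subst u s; rewrite connect0 /=; case/or3P: IH => [->|/andP[_ ->]|/andP[_ ->]] //.
    + by rewrite !orbT.
    + by rewrite !orbT.
have us : connect (adjL L) u s by apply/connect1/adjLP; exists r.
have E := same_connect (@connectL_sym L) us.
by rewrite !E.
Qed.

Lemma connect_add_same L p : connect (adjL L) (val p).1 (val p).2 ->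
  connect (adjL (p |: L)) =2 connect (adjL L).
Proof.
move=> xy u z; rewrite connect_add; apply/idP/idP => [|->] //.
case/or3P => // /andP[a b].
  exact: connect_trans a (connect_trans xy b).
by rewrite connectL_sym in xy; exact: connect_trans a (connect_trans xy b).
Qed.

Lemma csize_add_same L p u : connect (adjL L) (val p).1 (val p).2 ->
  csize (p |: L) u = csize L u.
Proof. by move=> xy; apply: eq_card => z; rewrite !inE connect_add_same. Qed.

Lemma csize_add_out L p u : ~~ connect (adjL L) (val p).1 u ->
  ~~ connect (adjL L) (val p).2 u -> csize (p |: L) u = csize L u.
Proof.
move=> /negbTE xu /negbTE yu; apply: eq_card => z; rewrite !inE connect_add.
by rewrite (connectL_sym L u (val p).1) (connectL_sym L u (val p).2) xu yu /= orbF.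
Qed.

Lemma csize_add_in L p u : ~~ connect (adjL L) (val p).1 (val p).2 ->
  connect (adjL L) (val p).1 u || connect (adjL L) (val p).2 u ->
  csize (p |: L) u = (csize L (val p).1 + csize L (val p).2)%N.
Proof.
set x := (val p).1; set y := (val p).2 => xy xyu.
have dis : [disjoint [set z | connect (adjL L) x z] & [set z | connect (adjL L) y z]].
  apply/pred0P => z /=; rewrite !inE; apply/negbTE; apply: contra xy => /andP[a b].
  by apply: connect_trans a _; rewrite connectL_sym.
rewrite /csize -cardsUI.
move/pred0P: dis => dis.
have -> : #|[set z | connect (adjL L) x z] :&: [set z | connect (adjL L) y z]| = 0%N.
  by apply/eqP; rewrite cards_eq0; apply/eqP/setP => z; rewrite !inE; have := dis z; rewrite /= !inE => ->.
rewrite addn0; apply: eq_card => z; rewrite !inE connect_add -/x -/y.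
rewrite ![connect (adjL L) u _]connectL_sym.
case/orP: xyu => xu.
  have E := same_connect (@connectL_sym L) xu.
  have nyu : connect (adjL L) y u = false.
    apply/negbTE; apply: contra xy => yu; apply: connect_trans xu _.
    by rewrite connectL_sym.
  by rewrite xu nyu /= orbF [connect _ z u]connectL_sym -E.
have E := same_connect (@connectL_sym L) xu.
have nyu : connect (adjL L) x u = false.
  apply/negbTE; apply: contra xy => yu; apply: connect_trans yu _.
  by rewrite connectL_sym.
by rewrite xu nyu /= [connect _ z u]connectL_sym -E orbC.
Qed.

End Graph.

(** * Effect of one link on sums over particles *)

Section Step.
Variables (R : realType) (N : nat) (alpha : R).
Implicit Types (L : {set pair N}) (p : pair N) (x y u : 'I_N).

Lemma small_subL L L' x : L \subset L' -> small alpha L' x -> small alpha L x.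
Proof.
by move=> LL'; rewrite /small; apply: le_lt_trans; rewrite ler_nat csize_subL.
Qed.

Lemma small_connect L x y : connect (adjL L) x y -> small alpha L x = small alpha L y.
Proof. by move=> xy; rewrite /small (csize_connect xy). Qed.

Lemma sub_step L p : L \subset step alpha L p.
Proof. by rewrite /step; case: ifP => _ //; exact: finset.subsetUr. Qed.

Lemma step_small L p : small alpha L (val p).1 -> small alpha L (val p).2 ->
  step alpha L p = p |: L.
Proof. by rewrite /step => -> ->. Qed.

Definition Vsum (g : nat -> R) L : R := \sum_u g (csize L u).

(** A cluster of size a contributes a * g a to [Vsum], because the sum runs over particles. A link
    that is refused, or that joins two particles of one cluster, changes no size. *)
Definition dV (g : nat -> R) L x y : R :=
  if [&& small alpha L x, small alpha L y & ~~ connect (adjL L) x y] then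
    let a := csize L x in let b := csize L y in
    (a + b)%:R * g (a + b)%N - a%:R * g a - b%:R * g b
  else 0.

Lemma Vsum_step g L p :
  Vsum g (step alpha L p) - Vsum g L = dV g L (val p).1 (val p).2.
Proof.
rewrite /dV /step.
have [sx|_] := boolP (small alpha L (val p).1); last by rewrite subrr.
have [sy|_] := boolP (small alpha L (val p).2); last by rewrite subrr.
rewrite /=; set x := (val p).1; set y := (val p).2.
have [xy|xy] := boolP (connect (adjL L) x y).
  by apply/eqP; rewrite subr_eq0; apply/eqP/eq_bigr => u _; rewrite csize_add_same.
rewrite /= -sumrB.
set a := csize L x; set b := csize L y.
transitivity (\sum_(u | connect (adjL L) x u) (g (a + b)%N - g a)
  + \sum_(u | connect (adjL L) y u) (g (a + b)%N - g b)).
  rewrite (big_mkcond (fun u => connect (adjL L) x u)).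
  rewrite (big_mkcond (fun u => connect (adjL L) y u)) -big_split /=.
  apply: eq_bigr => u _.
  have [xu|xu] := boolP (connect (adjL L) x u).
    have /negbTE-> : ~~ connect (adjL L) y u.
      apply: contra xy => yu; apply: connect_trans xu _; by rewrite connectL_sym.
    by rewrite csize_add_in -/x -/y ?xu // addr0 -(csize_connect xu).
  have [yu|yu] := boolP (connect (adjL L) y u).
    by rewrite csize_add_in -/x -/y ?yu ?orbT // add0r -(csize_connect yu).
  by rewrite csize_add_out // subrr addr0.
have card z : \sum_(u | connect (adjL L) z u) (1 : R) = (csize L z)%:R.
  by rewrite sumr_const /csize cardsE.
have cst z (c : R) : \sum_(u | connect (adjL L) z u) c = (csize L z)%:R * c.
  by rewrite -card mulr_suml; apply: eq_bigr => u _; rewrite mul1r.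
rewrite !cst natrD -/a -/b; ring.
Qed.

Lemma dV_sym g L x y : dV g L x y = dV g L y x.
Proof.
rewrite /dV connectL_sym andbCA; case: ifP => // _ /=.
by rewrite addnC addrAC.
Qed.

Lemma dV_xx g L x : dV g L x x = 0.
Proof. by rewrite /dV connect0 !andbF. Qed.

End Step.

(** Sums over ordered pairs factor into products of one-particle sums, which is how the quadratic
    right-hand side of Smoluchowski's equation appears. *)
Lemma sum_pair_sym (R : realType) (N : nat) (D : 'I_N -> 'I_N -> R) :
  (forall x y, D x y = D y x) -> (forall x, D x x = 0) ->
  \sum_(p : pair N) D (val p).1 (val p).2 = 2^-1 * \sum_x \sum_y D x y.
Proof.
move=> Dsym D0.
have E : \sum_(p : pair N) D (val p).1 (val p).2 =
    \sum_(q : 'I_N * 'I_N | (q.1 < q.2)%N) D q.1 q.2.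
  rewrite [RHS](reindex_omap (val : pair N -> _) insub) /=; last first.
    by move=> q qq; rewrite insubT.
  apply: eq_big => [p|p _] //=; by rewrite (valP p) valK eqxx.
rewrite {}E pair_bigA /=.
rewrite [in RHS](bigID (fun q : 'I_N * 'I_N => (q.1 < q.2)%N)) /=.
rewrite [X in _ * (_ + X)](bigID (fun q : 'I_N * 'I_N => (q.2 < q.1)%N)) /=.
rewrite [X in _ * (_ + (_ + X))]big1 ?addr0; last first.
  move=> [x y] /=; rewrite -!leqNgt => /andP[a b].
  have -> : x = y by apply/val_inj/eqP; rewrite eqn_leq b a.
  exact: D0.
have -> : \sum_(i : 'I_N * 'I_N | ~~ (i.1 < i.2)%N && (i.2 < i.1)%N) D i.1 i.2 =
  \sum_(q : 'I_N * 'I_N | (q.1 < q.2)%N) D q.1 q.2.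
  rewrite (reindex_inj (h := fun q : 'I_N * 'I_N => (q.2, q.1))) /=; last first.
    by move=> [? ?] [? ?] /= [-> ->].
  apply: eq_big => [[x y]|[x y] _] /=; last exact: Dsym.
  by rewrite -leqNgt andb_idl // => /ltnW.
lra.
Qed.

(** * Generating function of the cluster sizes *)

(** With x = m lam / 2 this is x <= exp x, squared. For z = exp (- lam) it supplies the constant [C]
    of all later estimates. *)
Lemma sqr_expR_bound (R : realType) (lam : R) (m : nat) : 0 < lam ->
  m%:R ^+ 2 * expR (- lam) ^+ m <= 4 / lam ^+ 2.
Proof.
move=> l0; rewrite -expRM_natl mulrN expRN ler_pdivrMr ?expR_gt0 //.
have -> : expR (m%:R * lam) = expR (m%:R * lam / 2) ^+ 2 by rewrite -expRM_natl; congr expR; field.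
have p0 : 0 <= m%:R * lam / 2 by rewrite divr_ge0 // mulr_ge0 // ltW.
have -> : m%:R ^+ 2 = 4 / lam ^+ 2 * (m%:R * lam / 2) ^+ 2 :> R by field; rewrite gt_eqF.
rewrite ler_pM2l; last by rewrite divr_gt0 // exprn_gt0.
apply: lerXn2r; rewrite ?nnegrE ?expR_ge0 //.
by have := expR_ge1Dx (m%:R * lam / 2); lra.
Qed.

Lemma expR_sub1_bound (R : realType) (x : R) : `|x| <= 2^-1 ->
  `|expR x - 1 - x| <= 2 * x ^+ 2 /\ `|expR x - 1| <= 2 * `|x|.
Proof.
move=> x2; have [x21 x22] : - 2^-1 <= x /\ x <= 2^-1 by move/ler_normlP: x2 => [? ?]; split; lra.
have l1 := expR_ge1Dx x; have l2 := expR_ge1Dx (- x).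
have l3 : expR x <= 1 + x + 2 * x ^+ 2.
  rewrite -[x in expR x]opprK expRN -[leRHS]invrK lef_pV2 ?posrE ?expR_gt0 //; last by rewrite invr_gt0; nra.
  apply: le_trans l2; rewrite -[leLHS]div1r ler_pdivrMr; nra.
split; first by rewrite ger0_norm; lra.
have [x0|x0] := lerP 0 x.
  by rewrite !ger0_norm ?mulr_ge0 //; nra.
by rewrite (ltr0_norm x0) ler0_norm; nra.
Qed.

Section Generator.
Variables (R : realType) (N : nat) (alpha : R).
Hypothesis N0 : (0 < N)%N.
Implicit Types (L : {set pair N}) (p : pair N) (x y : 'I_N) (z : R).

Let Np : 0 < N%:R :> R. Proof. by rewrite ltr0n. Qed.

Definition cutoff (f : nat -> R) (m : nat) : R := (m%:R < alpha)%R%:R * f m.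

Definition gfun z L : R := N%:R^-1 * Vsum (cutoff (fun m => z ^+ m)) L.
Definition gfun_deriv z L : R := N%:R^-1 * Vsum (cutoff (fun m => m%:R * z ^+ m)) L.
Definition mass L : R := N%:R^-1 * Vsum (cutoff (fun=> 1)) L.
(** Dividing by the size counts each small cluster once, with weight 1 - z ^ m. This weight is
    subadditive in m, so that mergers can only lower the sum. *)
Definition recip z L : R := N%:R^-1 * Vsum (cutoff (fun m => (1 - z ^+ m) / m%:R)) L.

(* Generator of the created-links process, every pair ringing at rate 1/N. *)
Definition gen (F : {set pair N} -> R) L : R :=
  N%:R^-1 * \sum_p (F (step alpha L p) - F L).

Definition small_ind L x : R := (small alpha L x)%:R.

Lemma Vsum_cutoffE f L : Vsum (cutoff f) L = \sum_x small_ind L x * f (csize L x).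
Proof. by []. Qed.

Lemma small_ind_ge0 L x : 0 <= small_ind L x. Proof. exact: ler0n. Qed.
Lemma small_ind_le1 L x : small_ind L x <= 1. Proof. by rewrite /small_ind; case: small. Qed.

Lemma avg_le (F : 'I_N -> R) c : (forall x, F x <= c) -> N%:R^-1 * \sum_x F x <= c.
Proof.
move=> Fc; rewrite ler_pdivrMl //.
apply: (@le_trans _ _ (\sum_(x < N) c)); first exact: ler_sum.
by rewrite sumr_const card_ord mulr_natl.
Qed.

Lemma avg_ge0 (F : 'I_N -> R) : (forall x, 0 <= F x) -> 0 <= N%:R^-1 * \sum_x F x.
Proof. by move=> F0; rewrite mulr_ge0 ?invr_ge0 // sumr_ge0. Qed.

Lemma gen_Vsum g L : gen (fun L => N%:R^-1 * Vsum g L) L =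
  2^-1 * N%:R^-1 ^+ 2 * \sum_x \sum_y dV alpha g L x y.
Proof.
rewrite /gen.
under eq_bigr do rewrite -mulrBr Vsum_step.
rewrite -mulr_sumr (@sum_pair_sym R N (dV alpha g L)); last 2 first.
- by move=> x y; exact: dV_sym.
- by move=> x; exact: dV_xx.
ring.
Qed.

Lemma dV_cut f L x y : dV alpha (cutoff f) L x y =
  small_ind L x * small_ind L y * (~~ connect (adjL L) x y)%:R *
  (cutoff (fun m => m%:R * f m) (csize L x + csize L y)%N
   - (csize L x)%:R * f (csize L x) - (csize L y)%:R * f (csize L y)).
Proof.
rewrite /dV /cutoff /small_ind /small.
case: (boolP (_ < alpha)) => sx /=; last by rewrite !mul0r.
case: (boolP (_ < alpha)) => sy /=; last by rewrite mulr0 !mul0r.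
case: connect => /=; first by rewrite mulr0 mul0r.
rewrite !mul1r; ring.
Qed.

Lemma gfun_ge0 z L : 0 <= z -> 0 <= gfun z L.
Proof. by move=> z0; apply: avg_ge0 => x; rewrite mulr_ge0 // exprn_ge0. Qed.
Lemma gfun_le1 z L : 0 <= z -> z <= 1 -> gfun z L <= 1.
Proof.
move=> z0 z1; apply: avg_le => x.
by rewrite -[leRHS]mulr1 ler_pM // ?exprn_ge0 // ?small_ind_le1 // exprn_ile1.
Qed.
Lemma mass_ge0 L : 0 <= mass L.
Proof. by apply: avg_ge0 => x; rewrite mulr_ge0. Qed.
Lemma mass_le1 L : mass L <= 1.
Proof. by apply: avg_le => x; rewrite /cutoff mulr1 (small_ind_le1 L). Qed.

Lemma gfun_mono z z' L : 0 <= z -> z <= z' -> gfun z L <= gfun z' L.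
Proof.
move=> z0 zz'; rewrite ler_pM2l ?invr_gt0 //; apply: ler_sum => x _.
by rewrite ler_wpM2l // lerXn2r // nnegrE (le_trans z0).
Qed.

Lemma gfun_mass z L : 0 <= z -> z <= 1 -> gfun z L <= mass L.
Proof.
move=> z0 z1; rewrite ler_pM2l ?invr_gt0 //; apply: ler_sum => x _.
by rewrite ler_wpM2l // exprn_ile1.
Qed.

Lemma mass_step L p : mass (step alpha L p) <= mass L.
Proof.
rewrite ler_pM2l ?invr_gt0 //; apply: ler_sum => x _.
rewrite /cutoff !mulr1 ler_nat.
case: (boolP ((csize (step alpha L p) x)%:R < alpha)) => // h.
by have := @small_subL _ _ alpha _ _ x (sub_step alpha L p) h; rewrite /small => ->.
Qed.

Lemma massE L : mass L = #|[set x | small alpha L x]|%:R / N%:R.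
Proof.
rewrite mulrC -sum1_card natr_sum big_mkcond /=; congr (_ * _).
by apply: eq_bigr => x _; rewrite inE /cutoff mulr1 /small; case: ifP.
Qed.

Lemma sum_dprod (f g : 'I_N -> R) : \sum_x \sum_y f x * g y = (\sum_x f x) * (\sum_y g y).
Proof. by rewrite big_distrlr. Qed.

Lemma sum_connect L x : \sum_y (connect (adjL L) x y)%:R = (csize L x)%:R :> R.
Proof.
rewrite -natr_sum; congr (_ %:R).
by rewrite /csize -sum1dep_card [RHS]big_mkcond; apply: eq_bigr => y _; case: connect.
Qed.

(* Smoluchowski's equation for the generating function: [gfun_deriv z] is z d/dz of
   [gfun z]; the error comes from merging two clusters whose sizes add up to at
   least [alpha], and from pairs inside one cluster. *)
Lemma gen_gfun z C L : 0 <= z -> z <= 1 -> (forall m : nat, m%:R ^+ 2 * z ^+ m <= C) ->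
  0 < alpha ->
  `|gen (gfun z) L - gfun_deriv z L * (gfun z L - mass L)| <= C * (N%:R^-1 + alpha^-1).
Proof.
move=> z0 z1 HC a0.
have zX m : 0 <= z ^+ m by exact: exprn_ge0.
have C0 : 0 <= C by have := HC 0%N; rewrite expr0n mul0r.
(* [T] ignores both the cut at [alpha] and the exclusion of pairs inside one cluster; its double sum
   then factors exactly. *)
pose T x y := small_ind L x * small_ind L y * ((csize L x + csize L y)%:R * z ^+ (csize L x + csize L y)
  - (csize L x)%:R * z ^+ csize L x - (csize L y)%:R * z ^+ csize L y).
have Tsum : gfun_deriv z L * (gfun z L - mass L) = 2^-1 * N%:R^-1 ^+ 2 * \sum_x \sum_y T x y.
  pose A x := small_ind L x * ((csize L x)%:R * z ^+ csize L x).
  pose U x := small_ind L x * z ^+ csize L x.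
  have -> : \sum_x \sum_y T x y = \sum_x \sum_y A x * U y + \sum_x \sum_y U x * A y
    - \sum_x \sum_y A x * small_ind L y - \sum_x \sum_y small_ind L x * A y.
    rewrite -big_split -!sumrB; apply: eq_bigr => x _ /=.
    rewrite -big_split -!sumrB; apply: eq_bigr => y _ /=.
    rewrite /T /A /U natrD exprD.
    move: (small_ind L x) (small_ind L y) (z ^+ _) (z ^+ _) (_%:R) (_%:R) => s1 s2 t1 t2 n1 n2; ring.
  rewrite !sum_dprod /gfun_deriv /gfun /mass !Vsum_cutoffE.
  under [\sum_x small_ind L x * 1]eq_bigr do rewrite mulr1.
  rewrite -/(A _); set a := \sum_x A x; set b := \sum_x U x; set c := \sum_x small_ind L x.
  rewrite -/a -/b; field; by rewrite gt_eqF.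
rewrite Tsum gen_Vsum -mulrBr -sumrB.
under eq_bigr do rewrite -sumrB.
rewrite normrM ger0_norm ?mulr_ge0 ?exprn_ge0 ?invr_ge0 //.
(* For a connected pair the exact term is 0 and [T] is at most 2 a z^a in size, a being the cluster
   size. For a merger reaching size m >= alpha, the missing term is m z^m <= m^2 z^m / alpha <= C /
   alpha. *)
have bnd x y : `|dV alpha (cutoff (fun m => z ^+ m)) L x y - T x y| <=
   2 * (small_ind L x * ((csize L x)%:R * z ^+ csize L x)) * (connect (adjL L) x y)%:R + C / alpha.
  have Ca : 0 <= C / alpha by rewrite divr_ge0 // ltW.
  rewrite dV_cut /T /cutoff /small_ind; case: (boolP (small _ L x)) => sx /=; last first.
    by rewrite !mul0r subr0 normr0 mulr0 mul0r add0r.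
  case: (boolP (small _ L y)) => sy /=; last first.
    rewrite mulr0 !mul0r subr0 normr0 addr_ge0 // !mulr_ge0 //.
  rewrite !mul1r; case: (boolP (connect _ x y)) => xy /=.
    rewrite mul0r sub0r normrN mulr1 -(csize_connect xy) natrD.
    set a := csize L x; have h1 : z ^+ (a + a) <= z ^+ a by rewrite exprD ler_piMr // exprn_ile1.
    have := zX (a + a)%N; have := zX a; move: (z ^+ (a + a)) (z ^+ a) h1 => s t h1 t0 s0.
    rewrite -[a%:R]/(a%:R : R); have a0' : 0 <= a%:R :> R by [].
    rewrite ler0_norm; first by nra.
    nra.
  rewrite mul1r mulr0 add0r.
  set a := csize L x; set b := csize L y; set ab := (a + b)%N.
  rewrite [X in `|X|](_ : _ = - ((ab%:R * z ^+ ab) * (1 - (ab%:R < alpha :> R)%R%:R))); last first.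
    by move: (_%:R) (z ^+ _) (z ^+ a) (z ^+ b) => *; ring.
  rewrite normrN; case: (boolP (_ < alpha)) => hab; first by rewrite subrr mulr0 normr0.
  rewrite subr0 mulr1 ger0_norm ?mulr_ge0 // ler_pdivlMr //.
  apply: le_trans (HC ab); rewrite expr2 -[leRHS]mulrA [leRHS]mulrC.
  by rewrite ler_wpM2l ?mulr_ge0 // leNgt.
apply: (@le_trans _ _ (2^-1 * N%:R^-1 ^+ 2 * \sum_x \sum_y
    (2 * (small_ind L x * ((csize L x)%:R * z ^+ csize L x)) * (connect (adjL L) x y)%:R + C / alpha))).
  rewrite ler_wpM2l ?mulr_ge0 ?exprn_ge0 ?invr_ge0 //.
  apply: le_trans (ler_norm_sum _ _ _) _; apply: ler_sum => x _.
  apply: le_trans (ler_norm_sum _ _ _) _; apply: ler_sum => y _.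
  exact: bnd.
apply: (@le_trans _ _ (2^-1 * N%:R^-1 ^+ 2 * \sum_(x < N) (2 * C + N%:R * (C / alpha)))).
  rewrite ler_wpM2l ?mulr_ge0 ?exprn_ge0 ?invr_ge0 //.
  apply: ler_sum => x _; rewrite big_split /= sumr_const card_ord -[_ *+ N]mulr_natl lerD2r.
  rewrite -mulr_sumr sum_connect -mulrA ler_pM2l // -[leRHS]mul1r -mulrA ler_pM ?small_ind_ge0
    ?small_ind_le1 ?mulr_ge0 //.
  by rewrite mulrAC -expr2.
rewrite sumr_const card_ord -[X in _ * X]mulr_natl.
rewrite [leLHS](_ : _ = C * N%:R^-1 + 2^-1 * (C / alpha)); last by field; rewrite !gt_eqF.
rewrite mulrDr lerD2l; have : 0 <= C / alpha by rewrite divr_ge0 // ltW.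
lra.
Qed.

Lemma recip_ge0 z L : 0 <= z -> z <= 1 -> 0 <= recip z L.
Proof.
move=> z0 z1; apply: avg_ge0 => x; rewrite mulr_ge0 // divr_ge0 // subr_ge0.
exact: exprn_ile1.
Qed.

Lemma recip_set0 z : z <= 1 -> recip z finset.set0 <= 1 - z.
Proof.
move=> z1; apply: avg_le => x; rewrite csize0 /cutoff divr1 expr1.
by case: (_ < _); rewrite ?mul1r // mul0r subr_ge0.
Qed.

(* Merging two clusters of sizes a and b decreases the sum defining [recip] by at
   least (1 - z ^ a) (1 - z ^ b). *)
Lemma gen_recip z L : 0 <= z -> z <= 1 -> 0 < alpha ->
  gen (recip z) L <= - 2^-1 * (mass L - gfun z L) ^+ 2 + alpha / (2 * N%:R).
Proof.
move=> z0 z1 a0; rewrite gen_Vsum.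
pose D x := small_ind L x * (1 - z ^+ csize L x).
have zX m : 0 <= z ^+ m <= 1 by rewrite exprn_ge0 //= exprn_ile1.
have nuE : mass L - gfun z L = N%:R^-1 * \sum_x D x.
  rewrite -mulrBr -sumrB; congr (_ * _); apply: eq_bigr => x _.
  by rewrite /D mulrBr.
have -> : - 2^-1 * (mass L - gfun z L) ^+ 2 + alpha / (2 * N%:R) =
  2^-1 * N%:R^-1 ^+ 2 * (- (\sum_x D x) * (\sum_x D x) + \sum_(x < N) alpha).
  by rewrite nuE sumr_const card_ord -[alpha *+ N]mulr_natl; field; rewrite gt_eqF.
rewrite ler_wpM2l ?mulr_ge0 ?exprn_ge0 ?invr_ge0 //.
rewrite -sumrN -sum_dprod -big_split /=; apply: ler_sum => x _.
(* Only connected pairs fail to contribute - D x * D y; each costs at most 1. A small x has fewer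
   than [alpha] connected partners, whence the term alpha / (2 N). *)
apply: (@le_trans _ _ (\sum_y (- D x * D y + small_ind L x * (connect (adjL L) x y)%:R))); last first.
  rewrite big_split /= lerD2l -mulr_sumr sum_connect /small_ind /small.
  by case: (boolP (_ < alpha)) => h; rewrite ?mul1r ?mul0r ltW.
apply: ler_sum => y _; rewrite dV_cut /D /cutoff /small_ind.
case: (boolP (small _ L x)) => sx /=; last by rewrite !mul0r oppr0 mul0r addr0.
case: (boolP (small _ L y)) => sy /=; last first.
  by rewrite mulr0 !mul0r mulr0 add0r mulr_ge0.
set a := csize L x; set b := csize L y.
have a1 : a%:R != 0 :> R by rewrite pnatr_eq0 -lt0n csize_gt0.
have b1 : b%:R != 0 :> R by rewrite pnatr_eq0 -lt0n csize_gt0.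
have ab1 : (a + b)%:R != 0 :> R by rewrite pnatr_eq0 -lt0n addn_gt0 csize_gt0.
have cE m : m%:R != 0 :> R -> m%:R * ((1 - z ^+ m) / m%:R) = 1 - z ^+ m by move=> m0; field.
rewrite !cE // !mul1r.
have /andP[x0 x1] := zX a; have /andP[y0 y1] := zX b.
rewrite exprD; move: (z ^+ a) (z ^+ b) x0 x1 y0 y1 => s t x0 x1 y0 y1.
have h1 : 0 <= (1 - s) * (1 - t) by rewrite mulr_ge0 // subr_ge0.
have h2 : (1 - s) * (1 - t) <= 1 - s by rewrite ler_piMr ?subr_ge0 // gerBl.
case: connect => /=; first by rewrite mul0r; lra.
by rewrite mul1r addr0; case: (_ < alpha); rewrite ?mul1r ?mul0r; lra.
Qed.

Lemma gen_sqr (F : {set pair N} -> R) v L :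
  gen (fun L => (F L - v) ^+ 2) L =
  2 * (F L - v) * gen F L + N%:R^-1 * \sum_p (F (step alpha L p) - F L) ^+ 2.
Proof.
rewrite /gen mulrCA -mulrDr; congr (_ * _).
by rewrite mulr_sumr -big_split; apply: eq_bigr => p _ /=; ring.
Qed.

Lemma card_pair_le : #|{: pair N}|%:R <= N%:R ^+ 2 :> R.
Proof.
rewrite -natrX ler_nat card_sig.
by apply: leq_trans (max_card _) _; rewrite card_prod card_ord.
Qed.

(** A merger changes N times [gfun] by at most 2 C, there are at most N^2 pairs, and each rings at
    rate 1 / N. *)
Lemma gfun_qvar z C L : 0 <= z -> z <= 1 -> (forall m : nat, m%:R ^+ 2 * z ^+ m <= C) ->
  N%:R^-1 * \sum_p (gfun z (step alpha L p) - gfun z L) ^+ 2 <= 4 * C ^+ 2 / N%:R.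
Proof.
move=> z0 z1 HC.
have zX m : 0 <= z ^+ m by exact: exprn_ge0.
have C0 : 0 <= C by have := HC 0%N; rewrite expr0n mul0r.
have HC1 m : m%:R * z ^+ m <= C.
  apply: le_trans (HC m); rewrite ler_wpM2r // -natrX ler_nat.
  by case: m => // m; rewrite leq_pmulr.
have D p : (gfun z (step alpha L p) - gfun z L) ^+ 2 <= 4 * C ^+ 2 / N%:R ^+ 2.
  rewrite -mulrBr Vsum_step exprMn mulrC exprVn ler_pM2r ?invr_gt0 ?exprn_gt0 //.
  rewrite dV_cut /cutoff; set a := csize L _; set b := csize L _.
  have h1 := HC1 a; have h2 := HC1 b; have h3 := HC1 (a + b)%N.
  have h1' : 0 <= a%:R * z ^+ a by rewrite mulr_ge0.
  have h2' : 0 <= b%:R * z ^+ b by rewrite mulr_ge0.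
  have h3' : 0 <= (a + b)%:R * z ^+ (a + b) by rewrite mulr_ge0.
  rewrite (_ : 4 * C ^+ 2 = (2 * C) ^+ 2); last by ring.
  have C2 : 0 <= 2 * C by rewrite mulr_ge0.
  rewrite -real_normK ?num_real //; apply: lerXn2r; rewrite ?nnegrE // /small_ind; case: (small _ _ _);
    case: (small _ _ _); case: (connect _ _ _) => /=;
   rewrite ?(mul0r, mulr0, normr0, mul1r, mulr1) //.
  move: h1 h2 h3 h1' h2' h3'; move: (a%:R * _) (b%:R * _) (_ * z ^+ (a + b));
    case: (_ < alpha) => s1 s2 s3; rewrite ?mul1r ?mul0r => *; rewrite ler_norml; apply/andP; split; lra.
apply: (@le_trans _ _ (N%:R^-1 * \sum_(p : pair N) (4 * C ^+ 2 / N%:R ^+ 2))).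
  by rewrite ler_wpM2l ?invr_ge0 //; apply: ler_sum => p _; exact: D.
rewrite sumr_const -[_ *+ #|_|]mulr_natl.
apply: (@le_trans _ _ (N%:R^-1 * (N%:R ^+ 2 * (4 * C ^+ 2 / N%:R ^+ 2)))).
  rewrite ler_wpM2l ?invr_ge0 // ler_wpM2r ?card_pair_le //.
  by rewrite divr_ge0 ?exprn_ge0 // mulr_ge0 ?exprn_ge0.
by rewrite le_eqVlt; apply/orP; left; apply/eqP; field; rewrite gt_eqF.
Qed.

End Generator.

(** * The lazy chain *)

Section Drift.
Variables (R : realType) (N : nat) (alpha : R).
Hypothesis N0 : (0 < N)%N.
Implicit Types (L : {set pair N}) (p : pair N) (x y : 'I_N) (z : R).

Let Np : 0 < N%:R :> R. Proof. by rewrite ltr0n. Qed.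

Lemma avg_norm_le (F : 'I_N -> R) c : (forall x, `|F x| <= c) ->
  `|N%:R^-1 * \sum_x F x| <= c.
Proof.
move=> Fc; rewrite normrM ger0_norm ?invr_ge0 //.
apply: le_trans (avg_le N0 Fc).
by rewrite ler_wpM2l ?invr_ge0 // ler_norm_sum.
Qed.

(** Taylor expansion in log z, for which [gfun_deriv] is the derivative. Sizes are bounded crudely
    by N, so that z may come arbitrarily close to 1; the resulting powers of N vanish as h tends to
    0. *)
Lemma gfun_expand L z d h : 0 <= z -> z <= 1 -> `|d| <= h -> N%:R * h <= 2^-1 ->
  [/\ `|gfun alpha (z * expR d) L - gfun alpha z L - gfun_deriv alpha z L * d| <= 2 * (N%:R * h) ^+ 2,
      `|gfun alpha (z * expR d) L - gfun alpha z L| <= 2 * (N%:R * h) &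
      `|gfun_deriv alpha (z * expR d) L - gfun_deriv alpha z L| <= N%:R * (2 * (N%:R * h))].
Proof.
move=> z0 z1 dh Nh.
have zc c : 0 <= z ^+ c <= 1 by rewrite exprn_ge0 //= exprn_ile1.
have s01 x : 0 <= small_ind alpha L x <= 1 by rewrite small_ind_ge0 small_ind_le1.
have cN x : (csize L x)%:R <= N%:R :> R by rewrite ler_nat csize_le.
have cd x : `|(csize L x)%:R * d| <= N%:R * h by rewrite normrM ger0_norm // ler_pM.
have cd2 x : `|(csize L x)%:R * d| <= 2^-1 by exact: le_trans (cd x) Nh.
have sz x (e : R) : `|small_ind alpha L x * (z ^+ csize L x * e)| <= `|e|.
  have /andP[a a'] := zc (csize L x); have /andP[b b'] := s01 x.
  rewrite mulrA normrM ger0_norm ?mulr_ge0 // ler_piMl // mulr_ile1 //.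
split.
- rewrite [X in `|X|](_ : _ = N%:R^-1 * \sum_x small_ind alpha L x * (z ^+ csize L x *
      (expR ((csize L x)%:R * d) - 1 - (csize L x)%:R * d))); last first.
    rewrite /gfun /gfun_deriv !Vsum_cutoffE -mulrA -!mulrBr mulr_suml -!sumrB; congr (_ * _).
    apply: eq_bigr => x _; rewrite exprMn -expRM_natl.
    move: (expR _) => e1.
    by move: (z ^+ csize L x) (small_ind alpha L x) (csize L x)%:R => e2 e3 e4; ring.
  apply: avg_norm_le => x; apply: le_trans (sz _ _) _.
  apply: le_trans (expR_sub1_bound (cd2 x)).1 _.
  rewrite ler_pM2l // -real_normK ?num_real //.
  by apply: lerXn2r; rewrite ?nnegrE //; apply: le_trans (cd x).
- rewrite [X in `|X|](_ : _ = N%:R^-1 * \sum_x small_ind alpha L x * (z ^+ csize L x *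
      (expR ((csize L x)%:R * d) - 1))); last first.
    rewrite /gfun !Vsum_cutoffE -!mulrBr -!sumrB; congr (_ * _).
    apply: eq_bigr => x _; rewrite exprMn -expRM_natl.
    move: (expR _) => e1.
    by move: (z ^+ csize L x) (small_ind alpha L x) => e2 e3; ring.
  apply: avg_norm_le => x; apply: le_trans (sz _ _) _.
  apply: le_trans (expR_sub1_bound (cd2 x)).2 _.
  by rewrite ler_pM2l // cd.
- rewrite [X in `|X|](_ : _ = N%:R^-1 * \sum_x (csize L x)%:R * (small_ind alpha L x * (z ^+ csize L x *
      (expR ((csize L x)%:R * d) - 1)))); last first.
    rewrite /gfun_deriv !Vsum_cutoffE -!mulrBr -!sumrB; congr (_ * _).
    apply: eq_bigr => x _; rewrite exprMn -expRM_natl.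
    move: (expR _) => e1.
    by move: (z ^+ csize L x) (small_ind alpha L x) (csize L x)%:R => e2 e3 e4; ring.
  apply: avg_norm_le => x; rewrite normrM ger0_norm // ler_pM //.
  apply: le_trans (sz _ _) _.
  apply: le_trans (expR_sub1_bound (cd2 x)).2 _.
  by rewrite ler_pM2l // cd.
Qed.

(** The mass cancels between the displacement of z and the generator, so the error u - v is
    multiplied by 1 + h w with w <= C, up to [b]. In [b], 6 (N h)^2 consists of 2 (N h)^2 from the
    Taylor remainder and 4 (N h)^2 from evaluating the generator at z' instead of z. *)
Lemma drift L z v h C (z' := z * expR (h * (mass alpha L - v))) (b :=
  h * (C * (N%:R^-1 + alpha^-1)) + 6 * (N%:R * h) ^+ 2) :
  0 < alpha -> 0 <= z -> z <= 1 -> z' <= 1 ->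
  (forall m : nat, m%:R ^+ 2 * z ^+ m <= C) -> (forall m : nat, m%:R ^+ 2 * z' ^+ m <= C) ->
  0 <= v <= 1 -> 0 <= h -> N%:R * h <= 2^-1 -> C * h <= 1 -> b <= 1 ->
  (gfun alpha z' L - v) ^+ 2 + h * gen alpha (fun L => (gfun alpha z' L - v) ^+ 2) L <=
  (1 + 3 * C * h) * (gfun alpha z L - v) ^+ 2 + 5 * b + h * (4 * C ^+ 2 / N%:R).
Proof.
move=> a0 z0 z1 z'1 HC HC' v01 h0 Nh Ch b1.
have z'0 : 0 <= z' by rewrite mulr_ge0 // expR_ge0.
rewrite gen_sqr mulrDr addrA; apply: lerD; last by rewrite ler_wpM2l // gfun_qvar.
set u' := gfun alpha z' L; set G := gen _ _ L.
set u := gfun alpha z L; set w := gfun_deriv alpha z L; set n := mass alpha L;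
  set w' := gfun_deriv alpha z' L.
have n01 : 0 <= n <= 1 by rewrite mass_ge0 ?mass_le1.
have u01 : 0 <= u <= 1 by rewrite gfun_ge0 ?gfun_le1.
have u'01 : 0 <= u' <= 1 by rewrite gfun_ge0 ?gfun_le1.
have HC1 m : m%:R * z ^+ m <= C.
  apply: le_trans (HC m); rewrite ler_wpM2r ?exprn_ge0 // -natrX ler_nat.
  by case: m => // m; rewrite leq_pmulr.
have C0 : 0 <= C by have := HC 0%N; rewrite expr0n mul0r.
have w0 : 0 <= w by apply: avg_ge0 => // x; rewrite mulr_ge0 ?small_ind_ge0 // mulr_ge0 // exprn_ge0.
have wC : w <= C.
  apply: avg_le => // x; apply: le_trans (HC1 (csize L x)).
  by rewrite /cutoff ler_piMl ?small_ind_le1 // mulr_ge0 // exprn_ge0.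
have wN : w <= N%:R.
  apply: avg_le => // x; rewrite /cutoff -[leRHS]mul1r ler_pM ?small_ind_le1 ?mulr_ge0 ?exprn_ge0 //.
  by rewrite -[leRHS]mulr1 ler_pM ?exprn_ge0 ?exprn_ile1 // ler_nat csize_le.
have dh : `|h * (n - v)| <= h.
  rewrite normrM ger0_norm // -[leRHS]mulr1 ler_wpM2l // ler_norml.
  by case/andP: n01 v01 => ? ? /andP[? ?]; apply/andP; split; lra.
have [r1 r2 r3] := gfun_expand L z0 z1 dh Nh.
have r4 := gen_gfun N0 L z'0 z'1 HC' a0.
rewrite -/z' -/u' -/u -/w -/w' -/n -/G in r1 r2 r3 r4.
set e1 := C * (N%:R^-1 + alpha^-1) in r4 b b1 *.
have e10 : 0 <= e1 by rewrite mulr_ge0 // addr_ge0 // invr_ge0 // ltW.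
set k := N%:R * h in r1 r2 r3 b b1 Nh *.
have k0 : 0 <= k by rewrite mulr_ge0.
have r5 : `|w' * (u' - n) - w * (u - n)| <= 4 * N%:R * k.
  have -> : w' * (u' - n) - w * (u - n) = (w' - w) * (u' - n) + w * (u' - u) by ring.
  apply: le_trans (ler_normD _ _) _.
  have -> : `|w * (u' - u)| = w * `|u' - u| by rewrite normrM ger0_norm.
  rewrite normrM.
  have : `|u' - n| <= 1.
    by rewrite ler_norml; case/andP: n01 u'01 => ? ? /andP[? ?]; apply/andP; split; lra.
  move=> un; have := ler_pM (normr_ge0 _) (normr_ge0 _) r3 un.
  have := ler_pM w0 (normr_ge0 _) wN r2.
  rewrite mulr1; lra.
set a := u - v; set B := u' - v + h * G - a * (1 + h * w).
have Bb : `|B| <= b.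
  have -> : B = (u' - u - w * (h * (n - v))) + h * (G - w' * (u' - n)) + h * (w' * (u' - n) - w * (u - n)).
    rewrite /B /a; ring.
  apply: le_trans (ler_normD _ _) _.
  have -> : b = 2 * k ^+ 2 + h * e1 + h * (4 * N%:R * k) by rewrite /b /k; ring.
  apply: lerD; last by rewrite normrM ger0_norm // ler_wpM2l.
  apply: le_trans (ler_normD _ _) _; apply: lerD => //.
  by rewrite normrM ger0_norm // ler_wpM2l.
have aa : `|a| <= 1.
  by rewrite ler_norml /a; case/andP: u01 v01 => ? ? /andP[? ?]; apply/andP; split; lra.
(* Adding the nonnegative (h * G) ^ 2 completes the square. *)
apply: (@le_trans _ _ ((a * (1 + h * w) + B) ^+ 2)).
  have -> : a * (1 + h * w) + B = (u' - v) + h * G by rewrite /B; ring.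
  have : 0 <= (h * G) ^+ 2 by exact: sqr_ge0.
  rewrite (_ : _ + h * _ = (u' - v + h * G) ^+ 2 - (h * G) ^+ 2); last by ring.
  by rewrite gerBl.
have hw1 : h * w <= C * h by rewrite mulrC ler_wpM2r.
have hw0 : 0 <= h * w by rewrite mulr_ge0.
have b0 : 0 <= b by exact: le_trans Bb.
(* The square of 1 + h w costs 3 C h because C h <= 1; the cross term costs 4 b and B ^ 2 costs b,
   hence 5 b. *)
rewrite sqrrD exprMn -[_ *+ 2]mulr_natr.
have t1 : a ^+ 2 * (1 + h * w) ^+ 2 <= (1 + 3 * C * h) * a ^+ 2.
  rewrite mulrC ler_wpM2r ?sqr_ge0 //.
  move: (h * w) hw0 hw1 => q q0 q1; rewrite -mulrA; move: (C * h) Ch q1 => c c1 q1.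
  have qq : q * q <= q by rewrite ler_piMl // (le_trans q1 c1).
  by rewrite sqrrD expr1n mul1r expr2 -mulr_natr; lra.
have t2 : a * (1 + h * w) * B * 2 <= 4 * b.
  apply: le_trans (ler_norm _) _; rewrite !normrM.
  have q : `|1 + h * w| <= 2 by rewrite ger0_norm; lra.
  have := ler_pM (normr_ge0 _) (normr_ge0 _) aa q.
  move=> q2; have := ler_pM (mulr_ge0 (normr_ge0 _) (normr_ge0 _)) (normr_ge0 _) q2 Bb.
  rewrite [`|2|]ger0_norm //; lra.
have t3 : B ^+ 2 <= b.
  rewrite -real_normK ?num_real // expr2.
  have := ler_pM (normr_ge0 _) (normr_ge0 _) Bb (le_trans Bb b1); rewrite mulr1; lra.
rewrite -/a; lra.
Qed.

End Drift.

(** * Expectations under the lazy chain *)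

Section Chain.
Variables (R : realType) (N : nat) (alpha h : R).
Hypothesis N0 : (0 < N)%N.
Hypothesis h0 : 0 <= h.
Hypothesis hP : h / N%:R * #|{: pair N}|%:R <= 1.
Implicit Types (w : seq (option (pair N))) (m : nat).

Let Np : 0 < N%:R :> R. Proof. by rewrite ltr0n. Qed.

(* A trajectory of the lazy chain is the list of its moves, the last one first;
   [None] is an idle step. *)
Definition stepo (L : {set pair N}) (a : option (pair N)) :=
  if a is Some p then step alpha L p else L.

Definition lazy_links w : {set pair N} := foldr (fun a L => stepo L a) finset.set0 w.

Definition lazyE1 (f : option (pair N) -> R) : R :=
  f None + h / N%:R * \sum_p (f (Some p) - f None).

(** The last move is averaged first, given the past w: this is the tower rule, and it lets one-step
    estimates be applied under [lazyE m']. *)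
Fixpoint lazyE m (f : seq (option (pair N)) -> R) : R :=
  if m is m'.+1 then lazyE m' (fun w => lazyE1 (fun a => f (a :: w))) else f [::].

Lemma lazyE1_le f g : (forall a, f a <= g a) -> lazyE1 f <= lazyE1 g.
Proof.
move=> fg.
have E k : lazyE1 k = (1 - h / N%:R * #|{: pair N}|%:R) * k None + h / N%:R * \sum_p k (Some p).
  by rewrite /lazyE1 sumrB sumr_const -[k None *+ _]mulr_natl; ring.
rewrite !E lerD // ?ler_wpM2l ?subr_ge0 //.
  by rewrite divr_ge0.
exact: ler_sum.
Qed.

Lemma lazyE1_lin a b f g : lazyE1 (fun x => a * f x + b * g x) = a * lazyE1 f + b * lazyE1 g.
Proof.
rewrite /lazyE1.
rewrite (_ : \sum_p _ = a * \sum_p (f (Some p) - f None) + b * \sum_p (g (Some p) - g None)).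
  ring.
by rewrite !mulr_sumr -big_split; apply: eq_bigr => p _ /=; ring.
Qed.

Lemma lazyE1_cst c : lazyE1 (fun=> c) = c.
Proof. by rewrite /lazyE1 subrr sumr_const mul0rn mulr0 addr0. Qed.

Lemma lazyE1_step (F : {set pair N} -> R) L : lazyE1 (fun a => F (stepo L a)) = F L + h * gen alpha F L.
Proof. by rewrite /lazyE1 /gen mulrA. Qed.

Lemma lazyE_le m f g : (forall w, size w = m -> f w <= g w) -> lazyE m f <= lazyE m g.
Proof.
elim: m f g => [|m IH] f g fg /=; first exact: fg.
by apply: IH => w sw; apply: lazyE1_le => a; apply: fg; rewrite /= sw.
Qed.

Lemma lazyE_ext m f g : (forall w, f w = g w) -> lazyE m f = lazyE m g.
Proof. by move=> fg; apply/eqP; rewrite eq_le !lazyE_le // => w _; rewrite fg. Qed.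

Lemma lazyE_lin m a b f g : lazyE m (fun w => a * f w + b * g w) = a * lazyE m f + b * lazyE m g.
Proof.
elim: m f g => [//|m IH] f g /=.
by rewrite -IH; apply: lazyE_ext => w; exact: lazyE1_lin.
Qed.

Lemma lazyE_cst m c : lazyE m (fun=> c) = c.
Proof.
elim: m c => [//|m IH] c /=.
by rewrite -[RHS](IH c); apply: lazyE_ext => w; exact: lazyE1_cst.
Qed.

Lemma lazyE_add m f g : lazyE m (fun w => f w + g w) = lazyE m f + lazyE m g.
Proof.
by rewrite -[lazyE m f]mul1r -[lazyE m g]mul1r -lazyE_lin; apply: lazyE_ext => w; rewrite !mul1r.
Qed.

Lemma lazyE_scale m a f : lazyE m (fun w => a * f w) = a * lazyE m f.
Proof.
have := lazyE_lin m a 0 f (fun=> 0); rewrite [0 * lazyE _ _]mul0r addr0 => <-.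
by apply: lazyE_ext => w; rewrite mul0r addr0.
Qed.

Lemma lazyE_sum m (I : Type) (r : seq I) (f : I -> _) :
  lazyE m (fun w => \sum_(i <- r) f i w) = \sum_(i <- r) lazyE m (f i).
Proof.
elim: r => [|i r IH].
  by rewrite big_nil -[RHS](lazyE_cst m 0); apply: lazyE_ext => w; rewrite big_nil.
by rewrite big_cons -IH -lazyE_add; apply: lazyE_ext => w; rewrite big_cons.
Qed.

Lemma lazyE_ge0 m f : (forall w, 0 <= f w) -> 0 <= lazyE m f.
Proof. by move=> f0; rewrite -[leLHS](lazyE_cst m 0); apply: lazyE_le => w _. Qed.

Lemma lazyE_markov m f c : 0 < c -> (forall w, 0 <= f w) ->
  lazyE m (fun w => (c <= f w)%R%:R) <= lazyE m f / c.
Proof.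
move=> c0 f0; rewrite ler_pdivlMr // mulrC -lazyE_scale; apply: lazyE_le => w _.
by case: (boolP (c <= f w)) => /=; rewrite ?mulr1 ?mulr0.
Qed.

Definition lazy_mass w := mass alpha (lazy_links w).

(** A Riemann sum with left endpoints. Its value after a move does not depend on that move, so the
    next position of a characteristic is known before the move is drawn. *)
Fixpoint accum (g : seq (option (pair N)) -> R) w : R :=
  if w is a :: w' then accum g w' + h * g w' else 0.

Definition lazy_Phi w := accum lazy_mass w.

Lemma lazyE_accum m g c : (forall j, (j < m)%N -> lazyE j g <= c) -> lazyE m (accum g) <= m%:R * h * c.
Proof.
elim: m => [|m IH] gc; first by rewrite /= !mul0r.
have -> : lazyE m.+1 (accum g) = lazyE m (accum g) + h * lazyE m g.
  by rewrite -lazyE_scale -lazyE_add /=; apply: lazyE_ext => w; rewrite lazyE1_cst.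
rewrite -natr1 !mulrDl mul1r lerD ?IH //; last by rewrite ler_wpM2l ?gc.
by move=> j jm; rewrite gc // ltnW.
Qed.

Lemma lazy_mass_cons a w : lazy_mass (a :: w) <= lazy_mass w.
Proof. by case: a => [p|] //=; rewrite /lazy_mass /= mass_step. Qed.

(* The characteristic z = v exp(Phi - t v) on which [gfun z] stays close to [v]. *)
Definition charac v w : R := v * expR (lazy_Phi w - (size w)%:R * h * v).

(** The bound must hold at every past time: the Gronwall iteration needs each of its steps to start
    from z <= rho, where the constants are uniform. *)
Fixpoint alive v rho w : bool :=
  (charac v w <= rho) && (if w is a :: w' then alive v rho w' else true).

Definition charac_err v rho w : R := (alive v rho w)%:R * (gfun alpha (charac v w) (lazy_links w) - v) ^+ 2.

Lemma charac_cons v a w : charac v (a :: w) = charac v w * expR (h * (lazy_mass w - v)).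
Proof. by rewrite /charac -[RHS]mulrA -expRD [size _]/= -natr1; congr (_ * expR _);
  rewrite /lazy_Phi /=; ring. Qed.

Lemma alive_charac v rho w : alive v rho w -> charac v w <= rho.
Proof. by case: w => [|a w] /= /andP[]. Qed.

Lemma charac_err_ge0 v rho w : 0 <= charac_err v rho w.
Proof. by rewrite mulr_ge0 // sqr_ge0. Qed.

Lemma gfun_set0 z : 1 < alpha -> gfun alpha z (finset.set0 : {set pair N}) = z.
Proof.
move=> a1; rewrite /gfun /Vsum.
have E u : cutoff alpha (fun m => z ^+ m) (csize (finset.set0 : {set pair N}) u) = z.
  rewrite csize0 /cutoff.
  have a1' : (1%N%:R < alpha) by [].
  by rewrite a1' mul1r.
rewrite (eq_bigr (fun=> z)) => [|u _]; last exact: E.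
by rewrite sumr_const card_ord -[z *+ N]mulr_natl mulrA mulVf ?mul1r // gt_eqF.
Qed.

(** Iteration of [drift]. One step can push a surviving characteristic above rho by a factor at most
    exp h, which is why [C] is required at rho * exp h. *)
Lemma lazyE_charac_err m v rho C (b := h * (C * (N%:R^-1 + alpha^-1)) + 6 * (N%:R * h) ^+ 2) :
  1 < alpha -> 0 <= v <= 1 -> rho * expR h <= 1 -> 0 < rho ->
  (forall k : nat, k%:R ^+ 2 * (rho * expR h) ^+ k <= C) ->
  N%:R * h <= 2^-1 -> C * h <= 1 -> b <= 1 ->
  lazyE m (charac_err v rho) <= expR (m%:R * (3 * C * h)) * (m%:R * (5 * b + h * (4 * C ^+ 2 / N%:R))).
Proof.
move=> a1 v01 r1 r0 HC Nh Ch b1.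
have a0 : 0 < alpha by lra.
have C0 : 0 <= C by have := HC 0%N; rewrite expr0n mul0r.
have b0 : 0 <= b by rewrite addr_ge0 ?mulr_ge0 ?sqr_ge0 // addr_ge0 // invr_ge0 // ltW.
set D := 5 * b + _.
have D0 : 0 <= D by rewrite addr_ge0 // ?mulr_ge0 // ?invr_ge0 // sqr_ge0.
have eh : 1 <= expR h by rewrite -expR0 ler_expR.
have rr : rho <= rho * expR h by rewrite ler_peMr // ltW.
have HCz z : 0 <= z -> z <= rho * expR h -> forall k : nat, k%:R ^+ 2 * z ^+ k <= C.
  move=> z0 zr k; apply: le_trans (HC k); rewrite ler_wpM2l ?sqr_ge0 //.
  by rewrite lerXn2r // nnegrE (le_trans z0).
have v0 : 0 <= v by case/andP: v01.
have zz0 w : 0 <= charac v w by rewrite mulr_ge0 ?expR_ge0.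
elim: m => [|m IH].
  rewrite [0 * D]mul0r mulr0 /= /charac_err /charac /lazy_Phi /= !mul0r subrr expR0 mulr1.
  by rewrite gfun_set0 // subrr expr0n mulr0.
have step1 : lazyE m.+1 (charac_err v rho) <= (1 + 3 * C * h) * lazyE m (charac_err v rho) + D.
  have -> : (1 + 3 * C * h) * lazyE m (charac_err v rho) + D =
    lazyE m (fun w => (1 + 3 * C * h) * charac_err v rho w + D).
    by rewrite lazyE_add lazyE_cst lazyE_scale.
  rewrite [lazyE m.+1 _]/=; apply: lazyE_le => w _.
  (* A killed trajectory stays killed and contributes 0 from then on. *)
  have [al|nal] := boolP (alive v rho w); last first.
    have -> : lazyE1 (fun a => charac_err v rho (a :: w)) = 0.
      rewrite -[RHS](lazyE1_cst 0); congr lazyE1; apply/funext => a.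
      by rewrite /charac_err /= (negbTE nal) andbF mul0r.
    by rewrite addr_ge0 // mulr_ge0 ?charac_err_ge0 // addr_ge0 // !mulr_ge0.
  have zr := alive_charac al.
  pose z' := charac v w * expR (h * (lazy_mass w - v)).
  have z'r : z' <= rho * expR h.
    rewrite ler_pM ?expR_ge0 // ler_expR -[leRHS]mulr1 ler_wpM2l //.
    by have := mass_le1 alpha N0 (lazy_links w); rewrite -/(lazy_mass w); lra.
  apply: (@le_trans _ _ (lazyE1 (fun a => (gfun alpha z' (stepo (lazy_links w) a) - v) ^+ 2))).
    apply: lazyE1_le => a; rewrite /charac_err charac_cons -/z' /=.
    by rewrite -[leRHS]mul1r ler_wpM2r ?sqr_ge0 //; case: (_ && _).
  rewrite (lazyE1_step (fun L => (gfun alpha z' L - v) ^+ 2)).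
  rewrite /charac_err al mul1r addrA.
  apply: drift => //; first 1 last.
  - exact: le_trans z'r r1.
  - by apply: HCz => //; exact: le_trans rr.
  - by apply: HCz => //; rewrite mulr_ge0 ?expR_ge0.
  - exact: le_trans (le_trans zr rr) r1.
apply: le_trans step1 _.
apply: (@le_trans _ _ (expR (3 * C * h) * (expR (m%:R * (3 * C * h)) * (m%:R * D)) + D)).
  rewrite lerD2r; apply: ler_pM => //.
  - by rewrite addr_ge0 // !mulr_ge0.
  - by apply: lazyE_ge0 => w; exact: charac_err_ge0.
  - exact: expR_ge1Dx.
rewrite mulrA -expRD -[m.+1%:R]natr1 [X in _ <= expR X * _]mulrDl mul1r [X in _ <= expR X * _]addrC.
rewrite [(_ + 1) * D]mulrDl mulrDr mul1r lerD2l ler_peMl //.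
by rewrite -expR0 ler_expR addr_ge0 // !mulr_ge0.
Qed.

(** Telescoping [gen_recip]: [recip] starts at most at 1 - z and never becomes negative, so the
    accumulated squared defect has only this budget to consume, plus the error term. *)
Lemma lazyE_defect m z : 0 <= z -> z <= 1 -> 0 < alpha ->
  lazyE m (accum (fun w => (lazy_mass w - gfun alpha z (lazy_links w)) ^+ 2)) <=
  2 * (1 - z) + m%:R * h * (alpha / N%:R).
Proof.
move=> z0 z1 a0.
set G := fun w => (lazy_mass w - gfun alpha z (lazy_links w)) ^+ 2.
suff H : lazyE m (fun w => recip alpha z (lazy_links w)) + 2^-1 * lazyE m (accum G) <=
  (1 - z) + m%:R * h * (alpha / (2 * N%:R)).
  have : 0 <= lazyE m (fun w => recip alpha z (lazy_links w)) by apply: lazyE_ge0 => w; exact: recip_ge0.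
  have : m%:R * h * (alpha / N%:R) = 2 * (m%:R * h * (alpha / (2 * N%:R))) by field; rewrite gt_eqF.
  lra.
elim: m => [|m IH]; first by rewrite /= mulr0 !mul0r !addr0; exact: recip_set0.
have -> : lazyE m.+1 (accum G) = lazyE m (accum G) + h * lazyE m G.
  by rewrite -lazyE_scale -lazyE_add /=; apply: lazyE_ext => w; rewrite lazyE1_cst.
have : lazyE m.+1 (fun w => recip alpha z (lazy_links w)) <= lazyE m (fun w => recip alpha z (lazy_links w))
   + (- (2^-1 * h)) * lazyE m G + h * (alpha / (2 * N%:R)).
  rewrite -lazyE_scale -lazyE_add -[X in _ + X](lazyE_cst m) -lazyE_add [lazyE m.+1 _]/=;
    apply: lazyE_le => w _.
  rewrite (lazyE1_step (recip alpha z)) -addrA lerD2l.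
  have := gen_recip N0 (lazy_links w) z0 z1 a0; rewrite -/(lazy_mass w) => H.
  by have := ler_wpM2l h0 H; rewrite /G mulrDr; lra.
move: IH; rewrite -[m.+1%:R]natr1 !mulrDl mul1r;
  move: (lazyE m.+1 _) (lazyE m _) (lazyE m (accum G)) (lazyE m G) => e1 e2 e3 e4; lra.
Qed.

End Chain.

(** * Pathwise bounds along the characteristics *)

Section Limit.
Variable R : realType.
Implicit Types (s t v x y : R).

(** The primitive of [nlim] that vanishes at 0, that is, the limit of Phi. *)
Definition nlim_int s : R := if s <= 1 then s else 1 + ln s.

Lemma nlim_gt0 t : 0 < nlim t.
Proof. by rewrite /nlim; case: (lerP t 1) => // t1; rewrite ?invr_gt0 //; lra. Qed.

Lemma nlimE t : nlim t = (Num.max 1 t)^-1.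
Proof. rewrite /nlim; by case: (lerP t 1) => h; rewrite ?invr1. Qed.

Lemma nlim_le s t : s <= t -> nlim t <= nlim s.
Proof.
move=> st; rewrite !nlimE lef_pV2 ?posrE ?lt_max ?ltr01 //.
by rewrite ge_max !le_max lexx /= st orbT.
Qed.

Lemma nlim_lip s t : s <= t -> nlim s <= nlim t + (t - s).
Proof.
move=> st; rewrite /nlim; case: (lerP t 1) => t1; case: (lerP s 1) => s1; try lra.
  have : 0 < t^-1 by rewrite invr_gt0; lra.
  have : t * t^-1 = 1 by rewrite mulfV //; apply/eqP; lra.
  nra.
have : s^-1 - t^-1 = (t - s) * (s^-1 * t^-1) by field; apply/andP; split; apply/eqP; lra.
have : s^-1 * t^-1 <= 1 by rewrite mulr_ile1 ?invr_ge0 ?invf_le1; lra.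
move=> h E.
have : (t - s) * (s^-1 * t^-1) <= (t - s) by rewrite ler_piMr // subr_ge0.
lra.
Qed.

(** Since [nlim] is nonincreasing, its value at the right end bounds its mean over the step from
    below; for the logarithm this is ln x >= 1 - 1 / x. *)
Lemma nlim_int_incr s h : 0 <= s -> 0 <= h -> h * nlim (s + h) <= nlim_int (s + h) - nlim_int s.
Proof.
have lnb x : 0 < x -> 1 - x^-1 <= ln x.
  move=> x0; have := @ln_sublinear R (x^-1); rewrite invr_gt0 x0 => /(_ isT).
  by rewrite lnV ?posrE //; have := @le_ln1Dx R (x^-1 - 1); rewrite addrCA subrr addr0 lnV ?posrE //;
    have : 0 < x^-1 by [rewrite invr_gt0]; lra.
move=> s0 h0; rewrite /nlim_int /nlim; case: (lerP (s + h) 1) => s1; case: (lerP s 1) => s2; try lra.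
  have l := lnb (s + h); have sh0 : 0 < s + h by lra.
  have := l sh0; have : (s + h) * (s + h)^-1 = 1 by rewrite mulfV // gt_eqF.
  have : 0 < (s + h)^-1 by rewrite invr_gt0.
  nra.
have sh0 : 0 < s + h by lra.
have := lnb ((s + h) / s); rewrite divr_gt0 ?ln_div ?posrE //; try lra.
move=> /(_ isT); rewrite invf_div.
have -> : 1 - s / (s + h) = h * (s + h)^-1 by field; apply/eqP; lra.
lra.
Qed.

Lemma xexp_mono x y : 0 <= x -> x <= y -> y <= 1 -> x * expR (1 - x) <= y * expR (1 - y).
Proof.
move=> x0 xy y1.
have -> : expR (1 - x) = expR (y - x) * expR (1 - y) by rewrite -expRD; congr expR; ring.
rewrite mulrA ler_wpM2r ?expR_ge0 // -ler_pdivlMr ?expR_gt0 // -expRN.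
have := expR_ge1Dx (- (y - x)); move: (expR _) => E HE; nra.
Qed.

Lemma xexp_lt1 y : 0 <= y -> y < 1 -> y * expR (1 - y) < 1.
Proof.
move=> y0 y1; rewrite -ltr_pdivlMr ?expR_gt0 // div1r -expRN.
have : y - 1 != 0 by apply/eqP; lra.
by move/expR_gt1Dx => h; have : - (1 - y) = y - 1 by [ring]; move=> ->; lra.
Qed.

(** In the limit a characteristic equals x exp (1 - x) with x = v s once s >= 1. This function
    increases to 1 on [0, 1], so the worst value is at x = v max(1, t), still below 1 when v < 1 /
    max(1, t). *)
Lemma vexp_nlim_int s t v : 0 <= s -> s <= t -> 0 <= v -> v * Num.max 1 t <= 1 ->
  v * expR (nlim_int s - s * v) <= v * Num.max 1 t * expR (1 - v * Num.max 1 t).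
Proof.
move=> s0 st v0 vt.
have m1 : 1 <= Num.max 1 t by rewrite le_max lexx.
have mt : t <= Num.max 1 t by rewrite le_max lexx orbT.
move: (Num.max 1 t) vt m1 mt => M vt m1 mt.
rewrite /nlim_int; case: (lerP s 1) => s1.
  apply: (@le_trans _ _ (v * expR (1 - v))).
    rewrite ler_wpM2l // ler_expR.
    have : v <= 1 by nra.
    nra.
  apply: xexp_mono => //; first by nra.
rewrite (_ : 1 + ln s - s * v = ln s + (1 - v * s)); last by ring.
rewrite expRD lnK ?posrE; last by lra.
rewrite mulrA; apply: xexp_mono => //; first by rewrite mulr_ge0.
by rewrite ler_wpM2l // (le_trans st).
Qed.

End Limit.

(** * Upper and lower bounds on one trajectory *)

Section Pathwise.
Variables (R : realType) (N : nat) (alpha h : R).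
Hypothesis N0 : (0 < N)%N.
Hypothesis h0 : 0 <= h.
Implicit Types (w : seq (option (pair N))) (v : R).
Local Notation lazy_mass := (lazy_mass alpha).
Local Notation lazy_Phi := (lazy_Phi alpha h).
Local Notation charac := (charac alpha h).
Local Notation alive := (alive alpha h).
Local Notation charac_err := (charac_err alpha h).
Local Notation accum := (accum h).
Local Notation U v w := (gfun alpha (charac v w) (lazy_links alpha w)).

Definition elapsed w : R := (size w)%:R * h.

Lemma elapsed_ge0 w : 0 <= elapsed w. Proof. by rewrite mulr_ge0. Qed.
Lemma elapsed_cons a w : elapsed (a :: w) = elapsed w + h.
Proof. by rewrite /elapsed /= -natr1 mulrDl mul1r. Qed.

Lemma lazy_mass_le1 w : lazy_mass w <= 1. Proof. exact: mass_le1. Qed.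

Lemma charac_ge0 v w : 0 <= v -> 0 <= charac v w.
Proof. by move=> v0; rewrite mulr_ge0 ?expR_ge0. Qed.

Lemma accum_ge0 g w : (forall w', 0 <= g w') -> 0 <= accum g w.
Proof. by move=> g0; elim: w => //= a w IH; rewrite addr_ge0 // mulr_ge0. Qed.

Lemma accum_cons_le g a w : (forall w', 0 <= g w') -> accum g w <= accum g (a :: w).
Proof. by move=> g0 /=; rewrite lerDl mulr_ge0. Qed.

Lemma lazy_Phi_le w : lazy_Phi w <= elapsed w.
Proof.
elim: w => [|a w IH]; first by rewrite /elapsed mul0r.
by rewrite elapsed_cons /lazy_Phi /= lerD // -[leRHS]mulr1 ler_wpM2l // lazy_mass_le1.
Qed.

(** The mass is nonincreasing: if it is still at least v now, it has been so since the killing, and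
    the characteristic has not decreased after exceeding rho. *)
Lemma dead_charac v rho w : 0 <= v -> ~~ alive v rho w -> v <= lazy_mass w -> rho <= charac v w.
Proof.
move=> v0; elim: w => [|a w IH] /=; first by rewrite andbT -ltNge => /ltW.
rewrite negb_and -ltNge => /orP[/ltW //|/IH{}IH] vn.
have vn' : v <= lazy_mass w by exact: le_trans vn (lazy_mass_cons _ N0 _ _).
apply: le_trans (IH vn') _; rewrite charac_cons ler_peMr ?charac_ge0 //.
by rewrite -expR0 ler_expR mulr_ge0 // subr_ge0.
Qed.

Lemma characE v w : charac v w = v * expR (lazy_Phi w - elapsed w * v).
Proof. by []. Qed.

(** For fixed s, v exp (- s v) is nonincreasing in v on v >= 1 / s; concretely, 1 + s d <= exp (s
    d). *)
Lemma charac_crossing v d w : 0 < v -> 0 <= d -> 1 <= elapsed w * v -> charac (v + d) w <= charac v w.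
Proof.
move=> v0 d0 sv; rewrite !characE.
have -> : lazy_Phi w - elapsed w * (v + d) = lazy_Phi w - elapsed w * v + - (elapsed w * d) by ring.
rewrite expRD mulrCA mulrC ler_pM2r ?expR_gt0 // expRN ler_pdivrMr ?expR_gt0 //.
have := expR_ge1Dx (elapsed w * d) => E.
apply: (@le_trans _ _ (v * (1 + elapsed w * d))); last by rewrite ler_pM2l.
have : d <= (elapsed w * v) * d by rewrite ler_peMl.
lra.
Qed.

Lemma charac_close v d w T : 0 <= v -> 0 <= d -> elapsed w <= T ->
  charac (v + d) w - d * expR T <= charac v w.
Proof.
move=> v0 d0 sT; rewrite !characE.
have E1 : expR (lazy_Phi w - elapsed w * (v + d)) <= expR (lazy_Phi w - elapsed w * v).
  by rewrite ler_expR lerD2l lerN2 ler_wpM2l ?elapsed_ge0 // lerDl.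
have E2 : expR (lazy_Phi w - elapsed w * (v + d)) <= expR T.
  rewrite ler_expR; have := lazy_Phi_le w;
    have : 0 <= elapsed w * (v + d) by rewrite mulr_ge0 ?elapsed_ge0 ?addr_ge0.
  lra.
have := ler_wpM2l v0 E1; have := ler_wpM2l d0 E2; rewrite mulrDl; lra.
Qed.

(** Below 1, it forces every surviving grid characteristic to have u within d / 3 of v. A third of
    the mesh keeps the values of u at two neighbours strictly ordered. *)
Definition grid_err (d rho : R) (K : nat) w : R := \sum_(i < K) charac_err (i%:R * d) rho w / (d / 3) ^+ 2.

Lemma grid_err_ge0 d rho K w : 0 < d -> 0 <= grid_err d rho K w.
Proof.
move=> d0; apply: sumr_ge0 => i _; rewrite divr_ge0 ?charac_err_ge0 // exprn_ge0 // divr_ge0 //.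
exact: ltW.
Qed.

Lemma grid_err_good d rho K w i : 0 < d -> grid_err d rho K w < 1 -> (i < K)%N ->
  alive (i%:R * d) rho w -> `|U (i%:R * d) w - i%:R * d| <= d / 3.
Proof.
move=> d0 B1 iK al.
have k0 : 0 < d / 3 by rewrite divr_gt0.
have : charac_err (i%:R * d) rho w / (d / 3) ^+ 2 < 1.
  apply: le_lt_trans B1; rewrite /grid_err (bigD1 (Ordinal iK)) //= lerDl.
  by apply: sumr_ge0 => j _; rewrite divr_ge0 ?charac_err_ge0 // exprn_ge0 // ltW.
rewrite ltr_pdivrMr ?exprn_gt0 // mul1r /charac_err al mul1r => H.
rewrite -ler_sqr ?nnegrE //; last exact: ltW.
by rewrite real_normK ?num_real // ltW.
Qed.

(** The three sources of error: the mesh of the grid, the defect n - u_z at a z close to 1, and the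
    failure of some characteristic. In the last case [grid_err] is at least 1 and makes the upper
    bound trivial, the mass being at most 1. *)
Definition excess (d rho T : R) (K : nat) w : R :=
  2 * d + (lazy_mass w - gfun alpha (rho - d * expR T) (lazy_links alpha w)) + grid_err d rho K w.

(** For s > 1, let j + 1 be the first grid index whose characteristic was killed. All indices up to
    j satisfy u ~ v, which by the crossing of characteristics forces j d <= 1 / s + d. The mass is
    then either below the killed value (j + 1) d, or the characteristic of j d is close to 1, and
    there u is both about j d and about the mass. *)
Lemma lazy_mass_upper d rho T K w : 0 < d -> 0 < rho -> rho < 1 -> 0 <= rho - d * expR T ->
  1 <= K%:R * d -> elapsed w <= T -> lazy_mass w <= nlim (elapsed w) + excess d rho T K w.
Proof.
move=> d0 r0 r1 z0 K1 sT.
set zs := rho - d * expR T in z0 *.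
have zs1 : zs <= 1 by have : 0 < d * expR T by [rewrite mulr_gt0 ?expR_gt0]; rewrite /zs; lra.
have G0 : 0 <= lazy_mass w - gfun alpha zs (lazy_links alpha w) by rewrite subr_ge0 gfun_mass.
have B0 := grid_err_ge0 rho K w d0.
have n1 := lazy_mass_le1 w.
rewrite /excess -/zs /nlim; case: (lerP (elapsed w) 1) => s1; first by lra.
have si0 : 0 < (elapsed w)^-1 by rewrite invr_gt0; lra.
have [B1|B1] := lerP 1 (grid_err d rho K w); first by lra.
have al0 : alive (0%:R * d) rho w.
  by elim: w {sT s1 si0 B0 B1 G0 n1} => [|a w IH] /=; rewrite ?IH characE !mul0r ltW.
(* Index K is killed at once: its characteristic starts at K d >= 1 > rho. *)
have exd : exists i, ~~ alive (i%:R * d) rho w.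
  exists K; elim: w {sT s1 si0 B0 B1 G0 n1 al0} => [|a w IH] /=; last by rewrite negb_and IH orbT.
  by rewrite andbT characE /elapsed !mul0r /lazy_Phi /= subrr expR0 mulr1 -ltNge (lt_le_trans r1).
case: (ex_minnP exd) => -[|j] dj minj; first by rewrite al0 in dj.
have alv i : (i <= j)%N -> alive (i%:R * d) rho w.
  by move=> ij; apply/negPn/negP => /minj; rewrite ltnNge ij.
have jK : (j < K)%N.
  apply: minj; elim: w {sT s1 si0 B0 B1 G0 n1 al0 exd dj alv} => [|a w IH] /=;
    last by rewrite negb_and IH orbT.
  by rewrite andbT characE /elapsed !mul0r /lazy_Phi /= subrr expR0 mulr1 -ltNge (lt_le_trans r1).
(* Otherwise the last two surviving values both exceed 1 / s. Their characteristics are then in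
   reversed order while u is nondecreasing in z, against |u - v| <= d / 3. *)
have vj : j%:R * d <= (elapsed w)^-1 + d.
  case: j {dj minj} alv jK => [|j] alv jK; first by rewrite mul0r; lra.
  rewrite -natr1 mulrDl mul1r lerD2r leNgt; apply/negP => vj.
  have vj0 : 0 < j%:R * d by lra.
  have cr : charac (j.+1%:R * d) w <= charac (j%:R * d) w.
    rewrite -natr1 mulrDl mul1r; apply: charac_crossing => //; first exact: ltW.
    by rewrite mulrC -ler_pdivrMr ?div1r ?ltW //; lra.
  have := gfun_mono alpha N0 (lazy_links alpha w) (charac_ge0 w (ltW (lt_le_trans vj0 _))) cr.
  move=> /(_ _) cr2.
  have {}cr2 : U (j.+1%:R * d) w <= U (j%:R * d) w.
    by apply: gfun_mono => //; apply: charac_ge0; rewrite mulr_ge0 // ltW.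
  have := grid_err_good d0 B1 jK (alv _ (leqnn _)).
  have := grid_err_good d0 B1 (ltnW jK) (alv _ (leqnSn _)).
  rewrite !ler_norml -[j.+1%:R]natr1 !mulrDl !mul1r in cr2 *.
  move=> /andP[_ A] /andP[B _]; lra.
(* If the mass is at least the killed value, that characteristic is still at least rho, and its
   neighbour is at least rho - d exp T, the point at which [excess] measures the defect. *)
have [nv|nv] := ltrP (lazy_mass w) (j.+1%:R * d).
  by move: nv; rewrite -natr1 mulrDl mul1r; lra.
have zr := dead_charac (mulr_ge0 (ler0n _ _) (ltW d0)) dj nv.
have := grid_err_good d0 B1 jK (alv _ (leqnn _)); rewrite ler_norml => /andP[_ A].
have zc : zs <= charac (j%:R * d) w.
  have jd : 0 <= j%:R * d by rewrite mulr_ge0 // ltW.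
  have := charac_close jd (ltW d0) sT.
  by move: zr; rewrite -natr1 mulrDl mul1r /zs; lra.
have := gfun_mono alpha N0 (lazy_links alpha w) z0 zc.
lra.
Qed.

Section Integrated.
Variables (d rho T : R) (K : nat).
Hypotheses (d0 : 0 < d) (r0 : 0 < rho) (r1 : rho < 1) (z0 : 0 <= rho - d * expR T)
  (K1 : 1 <= K%:R * d).

Local Notation g := (excess d rho T K).

Lemma excess_ge0 w : 0 <= g w.
Proof.
rewrite /g /excess addr_ge0 ?grid_err_ge0 // addr_ge0 ?mulr_ge0 ?(ltW d0) // subr_ge0 gfun_mass //.
by have := r1; have : 0 < d * expR T by [rewrite mulr_gt0 ?expR_gt0]; lra.
Qed.

(** The term h (1 - nlim) telescopes the gap between the left endpoints used by [accum] and the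
    right endpoints of [nlim_int_incr]; it vanishes at time 0 and never exceeds h. *)
Lemma lazy_Phi_upper w : elapsed w <= T -> lazy_Phi w <=
  nlim_int (elapsed w) + h * (1 - nlim (elapsed w)) + accum g w.
Proof.
elim: w => [|a w IH] sT.
  by rewrite /lazy_Phi /= /elapsed /nlim_int /nlim mul0r ler01 subrr mulr0 !addr0.
have sT' : elapsed w <= T by move: sT; rewrite elapsed_cons; have := h0; lra.
have A := IH sT'; have B := lazy_mass_upper d0 r0 r1 z0 K1 sT'.
have := nlim_int_incr (elapsed_ge0 w) h0; rewrite -(elapsed_cons a).
have := ler_wpM2l h0 B; rewrite [accum _ (_ :: _)]/=.
have -> : lazy_Phi (a :: w) = lazy_Phi w + h * lazy_mass w by [].
by move: A; rewrite !mulrDr !mulrN !mulr1; lra.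
Qed.

(** Monotonicity turns the bound in time average into one at a fixed time: the final mass is the
    least over the window, and [nlim] is largest at its start. *)
Lemma window_upper w j0 : elapsed w <= T ->
  (size w - j0)%:R * h * lazy_mass w <= (size w - j0)%:R * h * nlim (j0%:R * h) + accum g w.
Proof.
elim: w => [|a w IH] sT; first by rewrite sub0n !mul0r /= addr0.
have sT' : elapsed w <= T by move: sT; rewrite elapsed_cons; have := h0; lra.
have A := IH sT'; have B := lazy_mass_upper d0 r0 r1 z0 K1 sT'.
have Q0 := accum_ge0 (a :: w) excess_ge0.
(* Before the window starts, the truncated difference is 0 and only [accum] remains, which is
   nonnegative. *)
rewrite [size _]/=; have [j0w|j0w] := leqP j0 (size w); last first.
  by rewrite (_ : (_ - _)%N = 0%N) ?mul0r ?add0r //; apply/eqP; rewrite subn_eq0.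
rewrite subSn // -natr1.
have C : nlim (elapsed w) <= nlim (j0%:R * h).
  by apply: nlim_le; rewrite ler_wpM2r // ler_nat.
have D := lazy_mass_cons alpha N0 a w.
have E : ((size w - j0)%:R + 1) * h * lazy_mass (a :: w) <= ((size w - j0)%:R + 1) * h * lazy_mass w.
  by rewrite ler_wpM2l // mulr_ge0 // addr_ge0.
apply: le_trans E _; rewrite !mulrDl !mul1r /=.
have := ler_wpM2l h0 B; have := ler_wpM2l h0 C; rewrite -/(g w) mulrDr; lra.
Qed.

(** The upper bound on Phi keeps the characteristic within exp (h + c) of its limiting bound. The
    accumulated excess grows with time, so a final bound by c controls every earlier time as
    well. *)
Lemma alive_lower w v c rho' : elapsed w <= T -> 0 <= v -> v * Num.max 1 T <= 1 ->
  v * Num.max 1 T * expR (1 - v * Num.max 1 T) * expR (h + c) <= rho' ->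
  accum g w <= c -> alive v rho' w.
Proof.
move=> sT v0 vT Hr; elim: w sT => [|a w IH] sT Qc; (apply/andP; split => //); last first.
- by apply: IH; [move: sT; rewrite elapsed_cons; have := h0;
  lra | exact: le_trans (accum_cons_le a w excess_ge0) Qc].
all: rewrite characE; set w' := (X in elapsed X) in sT Qc *; apply: le_trans Hr;
  have A := lazy_Phi_upper sT; have B := vexp_nlim_int (elapsed_ge0 w') sT v0 vT;
  (apply: (@le_trans _ _ (v * expR (nlim_int (elapsed w') - elapsed w' * v) * expR (h + c)));
    [rewrite -mulrA -expRD ler_wpM2l // ler_expR; have := mulr_ge0 h0 (ltW (nlim_gt0 (elapsed w')));
     move: A; rewrite mulrBr mulr1; lra | by rewrite ler_wpM2r ?expR_ge0]).
Qed.

End Integrated.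
End Pathwise.

(** * The links as a run over the rung pairs *)

Lemma eq_in_sort (T : eqType) (P : pred T) (r r' : rel T) (s : seq T) :
  {in P &, r =2 r'} -> all P s -> sort r s = sort r' s.
Proof.
move=> rr /all_sigP[s' ->]; rewrite !sort_map; congr map; congr sort.
by apply/funext => -[x Px]; apply/funext => -[y Py]; exact: rr.
Qed.

Section Dynamics.
Variables (R : realType) (N : nat) (alpha : R).
Implicit Types (L : {set pair N}) (p q : pair N) (s : seq (pair N)) (e : pair N -> R) (t : R).
Local Notation step := (step alpha).
Local Notation run := (foldl step).

Definition ring_seq e t : seq (pair N) :=
  [seq p <- sort (fun p q => e p <= e q) (enum {: pair N}) | e p <= t].

Lemma run_sub L s : L \subset run L s.
Proof.
elim: s L => [|p s IH] L //=; apply: fintype.subset_trans (IH _).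
exact: sub_step.
Qed.

Lemma run_mem L s p : p \in run L s -> (p \in L) || (p \in s).
Proof.
elim: s L => [|q s IH] L /=; first by move=> ->.
move=> /IH /orP[|ps]; last by rewrite in_cons ps !orbT.
rewrite /Defs.step in_cons; case: ifP => _; rewrite ?inE => h; last by rewrite h.
by case/orP: h => ->; rewrite ?orbT.
Qed.

Lemma sort_total e : total (fun p q : pair N => e p <= e q).
Proof. by move=> p q; exact: le_total. Qed.
Lemma sort_trans e : transitive (fun p q : pair N => e p <= e q).
Proof. by move=> p q r; exact: le_trans. Qed.

Lemma sorted_split e t s : sorted (fun p q => e p <= e q) s ->
  s = [seq p <- s | e p <= t] ++ [seq p <- s | t < e p].
Proof.
elim: s => [|p s IH] //= ps.
have {}IH := IH (path_sorted ps).
case: (lerP (e p) t) => pt /=; first by rewrite -IH.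
have /allP al := order_path_min (@sort_trans e) ps.
have big q : q \in s -> t < e q by move=> /al; exact: lt_le_trans.
rewrite (_ : [seq q <- s | e q <= t] = [::]) /=.
  by congr cons; apply/esym/all_filterP/allP => q /big.
apply/eqP; rewrite -[_ == _]negbK -has_filter; apply/hasPn => q /big.
by rewrite ltNge.
Qed.

Lemma mem_ring_seq e t p : (p \in ring_seq e t) = (e p <= t).
Proof. by rewrite mem_filter mem_sort mem_enum andbT. Qed.

(** In the sorted list the clocks rung by time t form a prefix; running the rest can only add pairs
    with later clocks, which the restriction to e p <= t removes. *)
Lemma links_run e t : links alpha e t = run finset.set0 (ring_seq e t).
Proof.
apply/setP => p; rewrite inE /created.
set s := sort _ _.
have ss : sorted (fun p q => e p <= e q) s by exact/sort_sorted/sort_total.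
rewrite {1}(sorted_split t ss) foldl_cat -/(ring_seq e t).
apply/andP/idP => [[pc pt]|pr].
  have := run_mem pc; case/orP => //; rewrite mem_filter => /andP[].
  by rewrite ltNge pt.
split; first exact: (fintype.subsetP (run_sub _ _)).
by have := run_mem pr; rewrite inE mem_ring_seq.
Qed.

Lemma ring_seq_split e t t' : t <= t' ->
  ring_seq e t' = ring_seq e t ++ [seq p <- sort (fun p q => e p <= e q) (enum {: pair N}) | t < e p <= t'].
Proof.
move=> tt'; rewrite /ring_seq; set s := sort _ _.
have ss : sorted (fun p q => e p <= e q) s by exact/sort_sorted/sort_total.
rewrite {1}(sorted_split t ss) filter_cat -!filter_predI; congr (_ ++ _).
  by apply: eq_filter => p /=; case: (lerP (e p) t) => h; rewrite ?andbT ?andbF // (le_trans h).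
by apply: eq_filter => p /=; rewrite andbC.
Qed.

Lemma links_mono e t t' : t <= t' -> links alpha e t \subset links alpha e t'.
Proof. by move=> tt'; rewrite !links_run (ring_seq_split e tt') foldl_cat run_sub. Qed.

(** Clusters only grow: endpoints that are small at time t were small when p rang, so the link was
    not refused. *)
Lemma links_ringed e t p : e p <= t -> small alpha (links alpha e t) (val p).1 ->
  small alpha (links alpha e t) (val p).2 -> p \in links alpha e t.
Proof.
rewrite -mem_ring_seq links_run; set s := ring_seq e t.
case/splitPr => s1 s2; rewrite foldl_cat /=.
set L1 := run _ s1 => sx sy.
have sub : L1 \subset run (step L1 p) s2.
  by apply: fintype.subset_trans (run_sub _ _); exact: sub_step.
have sx1 := small_subL sub sx; have sy1 := small_subL sub sy.
apply: (fintype.subsetP (run_sub _ _)); rewrite step_small // !inE eqxx //.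
Qed.

Lemma ring_seq_eq e e' t : (forall p, (e p <= t) = (e' p <= t)) ->
  (forall p, e p <= t -> e p = e' p) -> ring_seq e t = ring_seq e' t.
Proof.
move=> h1 h2; rewrite /ring_seq !(filter_sort (@sort_total _) (@sort_trans _)).
rewrite (eq_filter (a2 := fun p => e p <= t)); last by move=> p; rewrite h1.
set s := [seq p <- _ | _].
apply: (@eq_in_sort _ (fun p => e p <= t)) => [p q pt qt|]; last exact: filter_all.
by rewrite (h2 p) // (h2 q).
Qed.

(** Moving a clock to t + 1 makes it irrelevant up to time t and erases its value, so the resulting
    links depend on the other clocks alone. *)
Definition silence (Q : pred (pair N)) t e : pair N -> R := fun p => if Q p then t + 1 else e p.

Lemma links_silence (Q : pred (pair N)) t e : (forall p, Q p -> t < e p) ->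
  links alpha (silence Q t e) t = links alpha e t.
Proof.
move=> Qt; rewrite !links_run; congr run; apply: ring_seq_eq => p; rewrite /silence; case: ifP => // Qp.
  by rewrite (leNgt (e p)) Qt // leNgt ltrDl ltr01.
by rewrite leNgt ltrDl ltr01.
Qed.

Definition effective L p := [&& p \notin L, small alpha L (val p).1 & small alpha L (val p).2].

(** This is what makes lack of memory applicable: a pair whose ring would still change the links has
    not rung yet. *)
Lemma effective_late e t p : effective (links alpha e t) p -> t < e p.
Proof.
by case/and3P => pL sx sy; rewrite ltNge; apply: contra pL => pt; exact: links_ringed.
Qed.

Lemma step_ineffective L p : ~~ effective L p -> step L p = L.
Proof.
rewrite /effective /Defs.step => h; case: ifP => // /andP[sx sy].
by move: h; rewrite sx sy !andbT negbK => pL; apply/finset.setUidPr; rewrite finset.sub1set.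
Qed.

End Dynamics.

(** * Separation of the configuration in solution *)

Section Separation.
Variables (R : realType) (N : nat) (alpha : R).
Implicit Types (L G : {set pair N}) (S : {set 'I_N}) (p q : pair N) (s : seq (pair N)) (e : pair N -> R).
Local Notation run := (foldl (step alpha)).

Definition inside S p := ((val p).1 \in S) && ((val p).2 \in S).

Definition uncrossed S L := [forall p in L, ((val p).1 \in S) == ((val p).2 \in S)].

Lemma uncrossed_sub S L L' : L \subset L' -> uncrossed S L' -> uncrossed S L.
Proof.
move=> /fintype.subsetP LL' /forall_inP H; apply/forall_inP => p pL; exact: H (LL' _ pL).
Qed.

Lemma uncrossedC S L : uncrossed (~: S)%SET L = uncrossed S L.
Proof. by apply: eq_forallb => p; rewrite !inE (inj_eq negb_inj). Qed.

Lemma uncrossed_connect S L x y : uncrossed S L -> connect (adjL L) x y -> x \in S ->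
  connect (adjL [set p in L | inside S p]%SET) x y && (y \in S).
Proof.
move=> /forall_inP H /connectP[c]; elim: c x => [|z c IH] x /=; first by move=> _ -> ->; rewrite connect0.
case/andP => /adjLP[p pL xz] cz yl xS.
have zS : z \in S by have := H _ pL; case: xz => -> /=; rewrite xS; [move/eqP <-|move/eqP ->].
have /andP[zy ->] := IH z cz yl zS; rewrite andbT.
apply: connect_trans zy; apply: connect1; apply/adjLP; exists p => //.
by rewrite inE pL /inside; case: xz => -> /=; rewrite xS zS.
Qed.

Lemma csize_uncrossed S L x : uncrossed S L -> x \in S -> csize L x = csize [set p in L | inside S p]%SET x.
Proof.
move=> U xS; apply: eq_card => y; rewrite !inE; apply/idP/idP.
  by move=> xy; case/andP: (uncrossed_connect U xy xS).
by apply: connect_subL; apply/fintype.subsetP => p; rewrite inE => /andP[].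
Qed.

Lemma small_uncrossed L : uncrossed [set x | small alpha L x]%SET L.
Proof.
apply/forall_inP => p pL; rewrite !inE.
by rewrite (small_connect alpha (connect1 (adjL_in pL))).
Qed.

Section Run.
Variable S : {set 'I_N}.
Let outer s := [seq p <- s | ~~ inside S p].
Let inner s : {set pair N} := [set p in s | inside S p]%SET.

Lemma inside_union L G x : uncrossed S L -> (forall p, p \in L -> ~~ inside S p) ->
  (forall p, p \in G -> inside S p) ->
  uncrossed S (L :|: G)%SET /\
  csize (L :|: G)%SET x = (if x \in S then csize G x else csize L x).
Proof.
move=> UL Lo Gi.
have U : uncrossed S (L :|: G)%SET.
  apply/forall_inP => p; rewrite inE => /orP[|/Gi/andP[-> ->] //].
  by move/forall_inP: UL; exact.
split=> //; case: ifP => xS.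
  rewrite (csize_uncrossed U xS); congr csize; apply/setP => p; rewrite !inE.
  case: (boolP (p \in G)) => [/Gi ->|]; first by rewrite orbT.
  by rewrite orbF; case: (boolP (p \in L)) => // /Lo /negbTE.
have xS' : x \in (~: S)%SET by rewrite inE xS.
rewrite -uncrossedC in U; rewrite (csize_uncrossed U xS').
rewrite -uncrossedC in UL; rewrite [RHS](csize_uncrossed UL xS').
congr csize; apply/setP => p; rewrite !inE.
case: (boolP (p \in G)) => [/Gi /andP[a b]|]; last by rewrite orbF.
by rewrite /inside !inE a b !andbF.
Qed.

(* A pair with one end in [S] and one outside sees the same outer cluster in
   both runs, and a small inner one; so it is created in both or in neither. *)
Lemma run_separation s : (forall x, x \in S -> small alpha (inner s) x) ->
  uncrossed S (run finset.set0 s) || uncrossed S (run finset.set0 (outer s)) ->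
  uncrossed S (run finset.set0 (outer s)) /\
  run finset.set0 s = (run finset.set0 (outer s) :|: inner s)%SET.
Proof.
elim/last_ind: s => [|s p IH] Hs U.
  split; first by apply/forall_inP => p; rewrite inE.
  by apply/setP => p; rewrite !inE.
have inner_sub : inner s \subset inner (rcons s p).
  apply/fintype.subsetP => q; rewrite !inE mem_rcons in_cons => /andP[-> ->]; by rewrite orbT.
have Hs' x : x \in S -> small alpha (inner s) x by move/Hs; exact: small_subL.
move: U; rewrite /outer filter_rcons -/(outer s) foldl_rcons.
rewrite (fun_if (run finset.set0)) foldl_rcons.
set D := run _ s in IH *; set D' := run _ (outer s) in IH *.
move=> U.
have U' : uncrossed S D || uncrossed S D'.
  case/orP: U => U; apply/orP; [left|right]; first exact: uncrossed_sub (sub_step _ _ _) U.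
  by move: U; case: ifP => // _; exact/uncrossed_sub/sub_step.
have {IH} [UD' DD] := IH Hs' U'.
have Do q : q \in D' -> ~~ inside S q.
  by move/run_mem; rewrite inE mem_filter /= => /andP[].
have Gi q : q \in inner s -> inside S q by rewrite inE => /andP[].
have cs x := (inside_union x UD' Do Gi).2.
have cs0 x : x \in S -> csize D' x = 1%N.
  move=> xS; rewrite (csize_uncrossed UD' xS) (_ : [set _ in _ | _]%SET = finset.set0) ?csize0 //.
  apply/setP => q; rewrite !inE; apply/negbTE/negP => /andP[/Do a b]; by rewrite b in a.
have smS x : x \in S -> small alpha D x /\ small alpha D' x.
  move=> xS; have := Hs' x xS; rewrite /small DD cs xS cs0 // => h; split => //.
  by apply: le_lt_trans h; rewrite ler_nat csize_gt0.
have smN x : x \notin S -> small alpha D x = small alpha D' x.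
  by move=> xS; rewrite /small DD cs (negbTE xS).
have [pin|pout] := boolP (inside S p).
  move: U; rewrite pin /= => U; split => //; case/andP: (pin) => p1 p2.
  rewrite step_small; try exact: (smS _ _).1.
  apply/setP => q; rewrite DD !inE mem_rcons in_cons.
  by case: eqP => [->|_]; rewrite ?pin ?orbT //= orbA.
have innerE : inner (rcons s p) = inner s.
  apply/setP => q; rewrite !inE mem_rcons in_cons; case: eqP => [->|_] //=.
  by rewrite (negbTE pout) !andbF.
move: U; rewrite pout /= innerE => U.
have same x : small alpha D x = small alpha D' x.
  by case: (boolP (x \in S)) => [/smS[-> ->] //|/smN].
have stepE : step alpha D p = (step alpha D' p :|: inner s)%SET.
  rewrite /step !same; case: ifP => _; last exact: DD.
  by rewrite DD finset.setUA.
split => //.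
(* If p is created at all, it is created in both runs, and one of them is known to be uncrossed. *)
rewrite /step; case: ifP => // sm; apply/forall_inP => q.
rewrite inE finset.in_set1 => /orP[/eqP ->|]; last by move/forall_inP: UD'; exact.
move: U; rewrite stepE /step sm => /orP[] /forall_inP /(_ p); rewrite !inE eqxx; exact.
Qed.

End Run.

Definition rung S (e : pair N -> R) t : {set pair N} := [set p | inside S p & e p <= t]%SET.

Lemma ring_seq_silence S e t :
  ring_seq (silence (inside S) t e) t = [seq p <- ring_seq e t | ~~ inside S p].
Proof.
set e' := silence _ t e.
have e't p : (e' p <= t) = (~~ inside S p) && (e p <= t).
  by rewrite /e' /silence; case: ifP => // _; rewrite leNgt ltrDl ltr01.
rewrite /ring_seq -filter_predI !(filter_sort (@sort_total _ _ _) (@sort_trans _ _ _)).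
rewrite (eq_filter (a2 := fun p => ~~ inside S p && (e p <= t))) => [|p]; last by rewrite e't.
set s := [seq p <- _ | _].
apply: (@eq_in_sort _ (fun p => ~~ inside S p)) => [p q pt qt|].
  by rewrite /e' /silence (negbTE pt) (negbTE qt).
by apply/allP => p; rewrite mem_filter => /andP[/andP[]].
Qed.

(** The right-hand side is the conjunction of an event on the clocks inside S and one on the others.
    No link joins the particles in solution to the rest, so either side makes one of the two runs
    uncrossed at S; this is why [run_separation] accepts either. *)
Theorem Ssol_separation S e t :
  (Ssol alpha e t == S) =
  [forall x in S, small alpha (rung S e t) x] && (Ssol alpha (silence (inside S) t e) t == S).
Proof.
have innerE : rung S e t = [set p in ring_seq e t | inside S p]%SET.
  by apply/setP => p; rewrite !inE mem_ring_seq andbC.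
have LE := links_run alpha e t; have LE' := links_run alpha (silence (inside S) t e) t.
rewrite ring_seq_silence in LE'.
set L := links alpha e t in LE; set L' := links alpha (silence _ _ _) t in LE'.
have Lo q : q \in L' -> ~~ inside S q.
  by rewrite LE' => /run_mem; rewrite inE mem_filter /= => /andP[].
have Gi q : q \in rung S e t -> inside S q by rewrite inE => /andP[].
have sep : (forall x, x \in S -> small alpha (rung S e t) x) -> uncrossed S L || uncrossed S L' ->
    forall x, small alpha L x = (if x \in S then small alpha (rung S e t) x else small alpha L' x).
  move=> G0 U x.
  have G0' y : y \in S -> small alpha [set p in ring_seq e t | inside S p]%SET y by rewrite -innerE;
    exact: G0.
  rewrite {1}LE {1}LE' in U.
  have [U' E] := run_separation G0' U.
  rewrite -LE' in U'; rewrite -LE -LE' -innerE in E.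
  by rewrite /small E (inside_union x U' Lo Gi).2; case: ifP.
apply/eqP/andP => [SS|[/forall_inP G0 /eqP SS]].
  have U : uncrossed S L by rewrite -SS; exact: small_uncrossed.
  have inL : rung S e t \subset L.
    apply/fintype.subsetP => p; rewrite inE => /andP[/andP[p1 p2] pt].
    by apply: links_ringed => //; [move: p1|move: p2]; rewrite -SS inE.
  have G0 x : x \in S -> small alpha (rung S e t) x.
    by move=> xS; apply: (small_subL inL); move: xS; rewrite -{1}SS inE.
  split; first exact/forall_inP.
  have sepx := sep G0 (introT orP (or_introl U)).
  have UL : uncrossed S (run finset.set0 (ring_seq e t)) || uncrossed S (run finset.set0 [seq p <-
    ring_seq e t | ~~ inside S p]).
    by rewrite -LE U.
  have [U' E] := run_separation (s := ring_seq e t) (S :=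
    S) (fun x xS => eq_ind _ (fun G => small alpha G x) (G0 x xS) _ innerE) UL.
  rewrite -LE -LE' in E.
  apply/eqP/setP => x; rewrite inE -/L'; case: (boolP (x \in S)) => xS.
    apply: (small_subL (L' := L)); first by rewrite E finset.subsetUl.
    by move: xS; rewrite -{1}SS inE.
  have := sepx x; rewrite (negbTE xS) => <-.
  by apply/negbTE; move: xS; rewrite -{1}SS inE.
have U : uncrossed S L' by rewrite -SS; exact: small_uncrossed.
have sepx := sep G0 (introT orP (or_intror U)).
apply/setP => x; rewrite inE -/L sepx; case: ifP => [/G0 //|xS].
by move: xS; rewrite -{1}SS inE.
Qed.

Lemma Cadj_rung S e t : Ssol alpha e t = S -> Cadj alpha e t =2 adjL (rung S e t).
Proof.
move=> SS i j; rewrite /Cadj /= SS; apply/and3P/adjLP => [[iS jS /existsP[p /andP[pij pt]]]|[p]].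
  exists p; last by case/orP: pij => /eqP; [left|right].
  by rewrite inE pt andbT /inside /=; case/orP: pij => /eqP -> /=; rewrite iS jS.
rewrite inE => /andP[/andP[p1 p2] pt] pij.
have [iS jS] : i \in S /\ j \in S by move: p1 p2; case: pij => -> /= -> ->.
by split => //; apply/existsP; exists p; rewrite pt andbT; case: pij => /= ->; rewrite eqxx ?orbT.
Qed.

End Separation.

(** * Transport of graphs on a subset of particles to initial integers *)

Section Relabel.
Variables (N : nat) (S : {set 'I_N}).
Local Notation k := #|S|.

Definition label (i : 'I_k) : 'I_N := enum_val i.

Lemma label_inj : injective label. Proof. exact: enum_val_inj. Qed.

Lemma label_in i : label i \in S. Proof. exact: enum_valP. Qed.

Lemma label_onto x : x \in S -> exists i, label i = x.
Proof. by move=> xS; exists (enum_rank_in xS x); rewrite /label enum_rankK_in. Qed.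

(** Pairs are encoded by increasing endpoints, so only an increasing labelling maps pairs to
    pairs. *)
Lemma label_mono (i j : 'I_k) : (label i < label j)%N = (i < j)%N.
Proof.
have ss : sorted ltn [seq val x | x <- enum S].
  rewrite sorted_map [enum S](_ : _ = [seq x <- enum 'I_N | x \in S]); last by rewrite enumT.
  apply: sorted_filter; first by move=> a b c; exact: ltn_trans.
  by rewrite -sorted_map val_enum_ord iota_ltn_sorted.
have lt (a b : 'I_k) : (a < b)%N -> (label a < label b)%N.
  move=> ab; have x0 := label a.
  rewrite /label !(enum_val_nth x0) -!(nth_map x0 0%N (val : 'I_N -> nat)) -?cardE //.
  by apply: (sorted_ltn_nth ltn_trans) => //; rewrite inE size_map -cardE.
apply/idP/idP; last exact: lt.
by apply: contraTT; rewrite -!leqNgt leq_eqVlt => /orP[/eqP/val_inj ->|/lt/ltnW].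
Qed.

Definition relabel (p : pair k) : pair N :=
  exist _ (label (val p).1, label (val p).2)
    (eq_ind_r (fun b : bool => b) (valP p) (label_mono (val p).1 (val p).2)).

Lemma relabel_inj : injective relabel.
Proof.
move=> p q /(congr1 val) [] /label_inj a /label_inj b; apply: val_inj.
by move: a b; rewrite /=; case: (sval p) (sval q) => [? ?] [? ?] /= -> ->.
Qed.

Lemma relabel_inside p : inside S (relabel p).
Proof. by rewrite /inside !label_in. Qed.

Lemma inside_relabel q : inside S q -> exists p, relabel p = q.
Proof.
move=> /andP[/label_onto[i qi] /label_onto[j qj]].
have ij : (i < j)%N by rewrite -label_mono qi qj (valP q).
exists (exist _ (i, j) ij); apply: val_inj; rewrite /= qi qj.
by rewrite /=; case: (sval q).
Qed.

Lemma adjL_relabel (G : {set pair k}) i j : adjL (relabel @: G)%SET (label i) (label j) = adjL G i j.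
Proof.
apply/adjLP/adjLP => [[_ /imsetP[p pG ->] pij]|[p pG pij]].
  exists p => //; case: pij => /= -[] /label_inj a /label_inj b; [left|right];
  by rewrite -a -b; case: (sval p).
by exists (relabel p); [exact: imset_f|case: pij => /= ->; [left|right]].
Qed.

Lemma connect_relabel (G : {set pair k}) i y :
  connect (adjL (relabel @: G)%SET) (label i) y = (y \in (label @: [set j | connect (adjL G) i j])%SET).
Proof.
apply/idP/imsetP => [/connectP[c]|[j]].
  elim: c i => [|z c IH] i /=; first by move=> _ ->; exists i; rewrite // inE connect0.
  move=> /andP[iz cz] yl.
  have [j zj] : exists j, label j = z.
    by apply: label_onto; case/adjLP: iz => _ /imsetP[p _ ->] [] /= [a b]; [rewrite -b|rewrite -a];
      exact: label_in.
  rewrite -zj in iz cz yl; have [l] := IH _ cz yl; rewrite inE => jl ->.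
  exists l => //; rewrite inE; apply: connect_trans jl; apply: connect1.
  by rewrite -adjL_relabel.
rewrite inE => /connectP[c cp ->] ->; elim: c i cp {j} => [|z c IH] i /=; first by rewrite connect0.
move=> /andP[iz cz]; apply: connect_trans (IH _ cz); apply: connect1.
by rewrite adjL_relabel.
Qed.

Lemma csize_relabel (G : {set pair k}) i : csize (relabel @: G)%SET (label i) = csize G i.
Proof.
rewrite /csize -(card_imset _ label_inj); apply: eq_card => y.
by rewrite inE connect_relabel.
Qed.

Lemma no_large_relabel (R : realType) (alpha : R) (G : {set pair k}) :
  [forall x in S, small alpha (relabel @: G)%SET x] = no_large alpha G.
Proof.
apply/forall_inP/forallP => H x.
  by have := H _ (label_in x); rewrite /small csize_relabel.
by move=> /label_onto[i <-]; rewrite /small csize_relabel.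
Qed.

Lemma card_inside : #|[set q : pair N | inside S q]%SET| = #|{: pair k}|.
Proof.
rewrite -cardsT -(card_imset _ relabel_inj); congr #|pred_of_set _|.
apply/setP => q; rewrite inE; apply/idP/imsetP => [/inside_relabel[p <-]|[p _ ->]].
  by exists p.
exact: relabel_inside.
Qed.

Lemma graph_iso_relabel (H G : {set pair k}) :
  graph_iso [set: 'I_k]%SET (adjL H) S (adjL (relabel @: G)%SET) <->
  graph_iso [set: 'I_k]%SET (adjL H) [set: 'I_k]%SET (adjL G).
Proof.
split=> -[h [hi hS ha]].
  have /choice[g gh] : forall i, exists j, label j = h i.
    by move=> i; apply: label_onto; rewrite -hS imset_f.
  have gi : injective g.
    by move=> i j /(congr1 label); rewrite !gh; apply: hi; rewrite inE.
  exists g; split.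
  - by move=> i j _ _; exact: gi.
  - by apply/eqP; rewrite eqEcard finset.subsetT card_imset //=.
  - by move=> i j iT jT; rewrite ha // -!gh adjL_relabel.
exists (label \o h); split.
- by move=> i j iT jT /label_inj; exact: hi.
- apply/setP => x; apply/imsetP/idP => [[i _ ->]|/label_onto[j <-]]; first exact: label_in.
  have : j \in (h @: [set: 'I_k])%SET by rewrite hS inE.
  by case/imsetP => i _ ->; exists i.
- by move=> i j iT jT; rewrite ha //= adjL_relabel.
Qed.

Lemma sum_relabel (R : realType) (Q : pred {set pair N}) (F : {set pair N} -> R) :
  \sum_(G : {set pair N} | (G \subset [set q | inside S q]%SET) && Q G) F G =
  \sum_(G : {set pair k} | Q (relabel @: G)%SET) F (relabel @: G)%SET.
Proof.
rewrite (reindex_onto (fun G : {set pair k} => (relabel @: G)%SET) (fun G => (relabel @^-1: G)%SET)) /=.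
  apply: eq_bigl => G.
  have -> : (relabel @^-1: (relabel @: G) == G)%SET.
    by apply/eqP/setP => p; rewrite inE (mem_imset _ _ relabel_inj).
  rewrite andbT (_ : _ \subset _ = true) //.
  by apply/fintype.subsetP => _ /imsetP[p _ ->]; rewrite inE relabel_inside.
move=> G /andP[/fintype.subsetP Gi _]; apply/setP => q; apply/imsetP/idP => [[p]|qG].
  by rewrite inE => pG ->.
have := Gi _ qG; rewrite inE => /inside_relabel[p pq]; exists p => //.
by rewrite inE pq.
Qed.

End Relabel.

Local Open Scope classical_set_scope.

(** * Independence and finite laws *)

Section Independence.
Context (d : measure_display) (R : realType) (T : measurableType d) (P : probability T R).
Variables (I : finType) (X : T -> I -> R).
Hypothesis mX : forall i, measurable_fun [set: T] (fun w => X w i).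
Hypothesis indX : mutually_independent P X.

(** A pi-system generating the events that depend only on the coordinates in Q. *)
Definition boxes (Q : pred I) : set (set T) :=
  [set A | exists C : I -> set R, [/\ forall i, measurable (C i), forall i, ~~ Q i -> C i = setT
     & A = \bigcap_(i in [set: I]) ((fun w => X w i) @^-1` C i)]].

Lemma measurable_box (C : I -> set R) : (forall i, measurable (C i)) ->
  measurable (\bigcap_(i in [set: I]) ((fun w => X w i) @^-1` C i)).
Proof.
move=> mC; apply: fin_bigcap_measurable; first exact: finite_finset.
by move=> i _; rewrite -[_ @^-1` _]setTI; exact: mX.
Qed.

Lemma boxes_setI Q : setI_closed (boxes Q).
Proof.
move=> _ _ [C [mC CT ->]] [D [mD DT ->]].
exists (fun i => C i `&` D i); split => [i|i iQ|].
- exact: measurableI.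
- by rewrite CT // DT // setTI.
- apply/seteqP; split => [w [h1 h2] i _|w h]; first by split; [exact: h1|exact: h2].
  by split => i _; [exact: (h i Logic.I).1|exact: (h i Logic.I).2].
Qed.

Lemma boxesT Q : boxes Q setT.
Proof.
by exists (fun=> setT); split => //; apply/seteqP; split => // w _ i _.
Qed.

(** Two finite measures, A |-> P (A and K) and P(K) P, agree on the pi-system of boxes, hence on the
    sigma-algebra it generates. *)
Lemma indep_group (Q : pred I) (B : I -> set R) (A : set T) :
  (forall i, measurable (B i)) -> (forall i, ~~ Q i -> B i = setT) ->
  <<s boxes (predC Q) >> A ->
  P (A `&` \bigcap_(i in [set: I]) ((fun w => X w i) @^-1` B i)) =
  (P A * P (\bigcap_(i in [set: I]) ((fun w => X w i) @^-1` B i)))%E.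
Proof.
move=> mB BT.
set K := \bigcap_(i in _) _ => sA.
have mK : measurable K by exact: measurable_box.
pose c := fine (P K).
have c0 : 0 <= c by rewrite fine_ge0.
have PK : P K = c%:E by rewrite fineK // fin_num_measure.
rewrite PK muleC.
pose m1 := mrestr P mK.
pose m2 := mscale (NngNum c0) P.
have := @g_sigma_algebra_measure_unique _ R T (boxes (predC Q)) _ (fun=> setT) _ _ m1 m2.
rewrite /m1 /m2 /mrestr /mscale /=; apply => //.
- by move=> _ [C [mC _ ->]]; exact: measurable_box.
- by move=> _; exact: boxesT.
- by rewrite bigcup_const //; exists 0%N.
- exact: boxes_setI.
- move=> _ [C [mC CT ->]].
  change (P (\bigcap_(i in [set: I]) ((fun w => X w i) @^-1` C i) `&` K) =
    (c%:E * P (\bigcap_(i in [set: I]) ((fun w => X w i) @^-1` C i)))%E).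
  rewrite -PK.
  rewrite (_ : _ `&` K = \bigcap_(i in [set: I]) ((fun w => X w i) @^-1` (C i `&` B i))); last first.
    apply/seteqP; split => [w [h1 h2] i _|w h]; first by split; [exact: h1|exact: h2].
    by split => i _; [exact: (h i Logic.I).1|exact: (h i Logic.I).2].
  rewrite indX; last by move=> i; exact: measurableI.
  rewrite !indX // -big_split /=; apply: eq_bigr => i _.
  have [Qi|Qi] := boolP (Q i).
    by rewrite CT ?negbK // setTI preimage_setT probability_setT mule1.
  by rewrite BT // setIT preimage_setT probability_setT mul1e.
- by move=> _; rewrite /mrestr setTI PK ltry.
Qed.

Lemma boxes_measurable_fun (Q : pred I) i : Q i ->
  measurable_fun [set: g_sigma_algebraType (boxes Q)] (fun w : g_sigma_algebraType (boxes Q) => X w i).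
Proof.
move=> Qi _ B mB; rewrite setTI; apply: sub_sigma_algebra.
exists (fun j => if j == i then B else setT); split.
- by move=> j; case: ifP.
- by move=> j; case: eqP => // ->; rewrite Qi.
- apply/seteqP; split => [w Bw j _|w /(_ i Logic.I)] /=; last by rewrite eqxx.
  by case: eqP => // ->.
Qed.

End Independence.

Section FiniteLaw.
Context (d : measure_display) (R : realType) (T : measurableType d) (P : probability T R).
Variables (F : finType) (xi : T -> F).
Hypothesis mxi : forall b, measurable (xi @^-1` [set b]).

Lemma finite_measurable (B : pred F) : measurable [set w | B (xi w)].
Proof.
rewrite (_ : [set w | _] = \bigcup_(b in [set b | B b]) (xi @^-1` [set b])).
  by apply: fin_bigcup_measurable => // ; exact: finite_finset.
apply/seteqP; split => [w Bw|w [b Bb wb]]; first by exists (xi w).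
by rewrite /= (wb : xi w = b).
Qed.

Definition law b : R := fine (P (xi @^-1` [set b])).

Lemma law_ge0 b : 0 <= law b. Proof. exact: fine_ge0. Qed.

Lemma finite_law_seq (r : seq F) : uniq r ->
  P [set w | xi w \in r] = (\sum_(b <- r) law b)%:E.
Proof.
elim: r => [_|b r IH /= /andP[br ur]].
  by rewrite big_nil (_ : [set _ | _] = set0) ?measure0 //; apply/seteqP; split.
rewrite (_ : [set _ | _] = xi @^-1` [set b] `|` [set w | xi w \in r]); last first.
  apply/seteqP; split => w /=; rewrite in_cons.
    by case/orP => [/eqP|]; [left|right].
  by case=> [->|->]; rewrite ?eqxx ?orbT.
rewrite measureU //; last 2 first.
- exact: (finite_measurable (fun b => b \in r)).
- by apply/seteqP; split => w //= [-> rb]; rewrite rb in br.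
rewrite big_cons EFinD; congr (_ + _)%E; last exact: IH.
by rewrite /law fineK // fin_num_measure.
Qed.

Lemma finite_law (B : pred F) : P [set w | B (xi w)] = (\sum_(b | B b) law b)%:E.
Proof.
rewrite -big_enum -finite_law_seq ?enum_uniq //; congr (P _).
by apply/seteqP; split => w /=; rewrite mem_enum.
Qed.

End FiniteLaw.

(** * Measurability of the links *)

Section MeasurableLinks.
Context (d : measure_display) (R : realType) (T : measurableType d) (N : nat) (alpha : R).
Variables (e : T -> pair N -> R).
Hypothesis me : forall p, measurable_fun [set: T] (fun w => e w p).

Lemma measurable_finfun (I : finType) (f : T -> I -> bool) (b : {ffun I -> bool}) :
  (forall i, measurable_fun [set: T] (fun w => f w i)) ->
  measurable [set w | [ffun i => f w i] = b].
Proof.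
move=> mf.
rewrite (_ : [set _ | _] = \bigcap_(i in [set: I]) ((fun w => f w i) @^-1` [set b i])); last first.
  apply/seteqP; split => [w /= <- i _|w h]; first by rewrite /= ffunE.
  by apply/ffunP => i; rewrite ffunE; exact: (h i Logic.I).
apply: fin_bigcap_measurable; first exact: finite_finset.
by move=> i _; rewrite -[_ @^-1` _]setTI; exact: mf.
Qed.

Lemma measurable_ler_cst p t : measurable_fun [set: T] (fun w => e w p <= t).
Proof. by apply: measurable_fun_ler => //; exact: measurable_cst. Qed.

(** The links depend on the clocks only through finitely many bits: the comparisons between clocks
    and those with t. *)
Lemma measurable_links t (L : {set pair N}) : measurable [set w | links alpha (e w) t = L].
Proof.
pose xi w : {ffun pair N * pair N -> bool} * {ffun pair N -> bool} :=
  ([ffun q => e w q.1 <= e w q.2], [ffun p => e w p <= t]).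
pose F (b : {ffun pair N * pair N -> bool} * {ffun pair N -> bool}) : {set pair N} :=
  [set p in foldl (step alpha) finset.set0 (sort (fun p q => b.1 (p, q)) (enum {: pair N})) | b.2 p]%SET.
have mxi b : measurable (xi @^-1` [set b]).
  rewrite (_ : _ @^-1` _ = [set w | [ffun q => e w q.1 <= e w q.2] =
    b.1] `&` [set w | [ffun p => e w p <= t] = b.2]).
    apply: measurableI; apply: measurable_finfun => i; last exact: measurable_ler_cst.
    exact: measurable_fun_ler.
  case: b => b1 b2; apply/seteqP; split => w; first by move=> [<- <-].
  by move=> [/= h1 h2]; rewrite /xi /= h1 h2.
have E w : links alpha (e w) t = F (xi w).
  have S : (fun p q => (xi w).1 (p, q)) = (fun p q => e w p <= e w q).
    by apply/funext => q; apply/funext => q'; rewrite ffunE.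
  by apply/setP => p; rewrite /F S !inE ffunE.
rewrite (_ : [set _ | _] = [set w | F (xi w) == L]).
  exact: (finite_measurable mxi (fun b => F b == L)).
by apply/seteqP; split => w /=; rewrite E => /eqP.
Qed.

End MeasurableLinks.

(** * Interval probabilities of an exponential clock *)

Section ExponentialLaw.
Context (d : measure_display) (R : realType) (T : measurableType d) (P : probability T R).
Variables (r : R) (X : T -> R).
Hypothesis r0 : 0 < r.
Hypothesis mX : measurable_fun [set: T] X.
Hypothesis lawX : forall B : set R, measurable B -> P (X @^-1` B) = exponential_prob r B.

Let mP (B : set R) : measurable B -> measurable (X @^-1` B).
Proof. by move=> mB; rewrite -[_ @^-1` _]setTI; exact: mX. Qed.

(** The interval [0, s] alone has mass 1 - exp (- r s), so at most exp (- r s) is left for the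
    negative values, for every s > 0. *)
Lemma exp_neg0 : P (X @^-1` `]-oo, (0 : R)[) = 0.
Proof.
apply/eqP; rewrite eq_le measure_ge0 andbT; apply/lee_addgt0Pr => eps e0; rewrite add0e.
pose s := Num.max 1 (- ln eps / r).
have s0 : 0 < s by rewrite lt_max ltr01.
have D : (P (X @^-1` `]-oo, (0 : R)%R[) + P (X @^-1` `[(0 : R)%R, s]) <= 1)%E.
  rewrite -measureU; [|exact: mP|exact: mP|].
    by apply: probability_le1; apply: measurableU; exact: mP.
  apply/seteqP; split => w //=; rewrite ?in_itv /= ?in_itv /= => -[a /andP[b _]].
  by move: (lt_le_trans a b); rewrite ltxx.
rewrite (lawX (B := `[(0 : R), s])) // exponential_prob_itv0c // in D.
have : expR (- r * s) <= eps.
  rewrite -[leRHS]lnK ?posrE // ler_expR mulNr lerNl -ler_pdivrMl // mulrC.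
  by rewrite /s le_max lexx orbT.
have : P (X @^-1` `]-oo, (0 : R)[) \is a fin_num by rewrite fin_num_measure //; exact: mP.
move: D; case: (P _) => // x; rewrite -EFinB -EFinD !lee_fin => D _ h; lra.
Qed.

Lemma exp_cdf (t : R) : 0 <= t -> P (X @^-1` `]-oo, t]) = (1 - expR (- (t / r^-1)))%:E.
Proof.
rewrite invrK.
have pos (s : R) : 0 < s -> P (X @^-1` `]-oo, s]) = (1 - expR (- (s * r)))%:E.
  move=> s0.
  rewrite (_ : _ @^-1` _ = X @^-1` `]-oo, (0 : R)[ `|` X @^-1` `[(0 : R), s]); last first.
    apply/seteqP; split => w /=; rewrite ?in_itv /= ?in_itv /=.
      by move=> ws; case: (ltrP (X w) 0) => x0; [left|right].
    by case=> [/ltW h|/andP[_ //]]; exact: le_trans h (ltW s0).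
  rewrite measureU; [|exact: mP|exact: mP|].
    change (P (X @^-1` `]-oo, (0 : R)%R[) + P (X @^-1` `[(0 : R)%R, s]) = (1 - expR (- (s * r)))%:E)%E.
    by rewrite exp_neg0 lawX // exponential_prob_itv0c // add0e mulNr mulrC EFinB.
  apply/seteqP; split => w //=; rewrite ?in_itv /= ?in_itv /= => -[a /andP[b _]].
  by move: (lt_le_trans a b); rewrite ltxx.
rewrite le_eqVlt => /orP[/eqP <-|]; last exact: pos.
rewrite mul0r oppr0 expR0 subrr; apply/eqP; rewrite eq_le measure_ge0 andbT.
apply/lee_addgt0Pr => eps e0; rewrite add0e.
have s0 : 0 < eps / r by rewrite divr_gt0.
apply: (@le_trans _ _ (P (X @^-1` `]-oo, eps / r]))).
  apply: le_measure; rewrite ?inE; [exact: mP|exact: mP|].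
  by move=> w /=; rewrite ?in_itv /= ?in_itv /= => h; exact: le_trans h (ltW s0).
rewrite pos // lee_fin divfK ?gt_eqF //.
by have := expR_ge1Dx (- eps); lra.
Qed.

Lemma exp_itv (s t : R) : 0 <= s -> s <= t ->
  P (X @^-1` `]s, t]) = (expR (- (s / r^-1)) - expR (- (t / r^-1)))%:E.
Proof.
move=> s0 st.
have := exp_cdf (le_trans s0 st).
rewrite (_ : _ @^-1` _ = X @^-1` `]-oo, s] `|` X @^-1` `]s, t]); last first.
  apply/seteqP; split => w /=; rewrite ?in_itv /= ?in_itv /=.
    by move=> ws; case: (lerP (X w) s) => x0; [left|right].
  by case=> [h|/andP[_ //]]; exact: le_trans h st.
rewrite measureU; [|exact: mP|exact: mP|]; last first.
  apply/seteqP; split => w //=; rewrite ?in_itv /= ?in_itv /= => -[a /andP[b _]].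
  by move: (lt_le_trans b a); rewrite ltxx.
change (P (X @^-1` `]-oo, s]) + P (X @^-1` `]s, t]) = (1 - expR (- (t / r^-1)))%:E ->
  P (X @^-1` `]s, t]) = (expR (- (s / r^-1)) - expR (- (t / r^-1)))%:E)%E.
rewrite exp_cdf //.
have : P (X @^-1` `]s, t]) \is a fin_num by rewrite fin_num_measure //; exact: mP.
case: (P _) => // x _; rewrite -EFinD => -[h]; congr EFin; lra.
Qed.

Lemma exp_tail (t : R) : 0 <= t -> P (X @^-1` `]t, +oo[) = (expR (- (t / r^-1)))%:E.
Proof.
move=> t0.
rewrite (_ : _ @^-1` _ = ~` (X @^-1` `]-oo, t])); last first.
  by apply/seteqP; split => w /=; rewrite ?in_itv /= ?in_itv /= andbT ltNge => /negP.
rewrite probability_setC; last exact: mP.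
by rewrite exp_cdf // -EFinB; congr EFin; ring.
Qed.

End ExponentialLaw.

(** * The limit of the lazy chain *)

Section Eventually.
Variable R : realType.

Lemma near_inv_le (e : R) : 0 < e -> \forall n \near \oo, n%:R^-1 <= e.
Proof.
move=> e0; near=> n; have n0 : (0 < n)%N by near: n; exact: nbhs_infty_gt.
rewrite -[leRHS]invrK lef_pV2 ?posrE ?invr_gt0 ?ltr0n //.
near: n; exact: nbhs_infty_ger.
Unshelve. all: by end_near.
Qed.

Lemma near_pinfty_inv_le (u : nat -> R) (e : R) : u @ \oo --> +oo -> 0 < e ->
  \forall n \near \oo, 1 < u n /\ (u n)^-1 <= e.
Proof.
move=> uoo e0; near=> n; have u1 : 2 + e^-1 <= u n.
  near: n; exact: (cvgryPge _).1.
have ei : 0 < e^-1 by rewrite invr_gt0.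
split; first by lra.
by rewrite -[leRHS]invrK lef_pV2 ?posrE //; lra.
Unshelve. all: by end_near.
Qed.

(** An iterated limit, not a joint one: how large m must be may depend on N, so that N^2 t / m is
    negligible. *)
Definition near2 (P : nat -> nat -> Prop) := \forall N \near \oo, \forall m \near \oo, P N m.

Lemma near2S P Q : (forall N m, P N m -> Q N m) -> near2 P -> near2 Q.
Proof. by move=> PQ; apply: filterS => N; apply: filterS => m; exact: PQ. Qed.

Lemma near2S2 P Q S : (forall N m, P N m -> Q N m -> S N m) -> near2 P -> near2 Q -> near2 S.
Proof. by move=> PQS; apply: filterS2 => N; apply: filterS2 => m; exact: PQS. Qed.

End Eventually.

Section LazyLimit.
Variables (R : realType) (alpha : nat -> R) (t : R).
Hypotheses (alpha_oo : alpha @ \oo --> +oo) (alpha_N : (fun N : nat => alpha N / N%:R) @ \oo --> 0).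
Hypothesis t0 : 0 < t.
Local Notation hh m := (t / m%:R).

Definition fine_mesh (e : R) (N m : nat) := [/\ (0 < N)%N, (0 < m)%N,
  1 < alpha N, alpha N / N%:R <= e & [/\ N%:R^-1 <= e, (alpha N)^-1 <= e, N%:R * hh m <= e, hh m <=
    e & N%:R ^+ 2 * hh m <= e]].

Lemma near2_fine_mesh (e : R) : 0 < e -> near2 (fine_mesh e).
Proof.
move=> e0; near=> N.
have N0 : (0 < N)%N by near: N; exact: nbhs_infty_gt.
near=> m.
have m0 : (0 < m)%N by near: m; exact: nbhs_infty_gt.
have [a1 ae] : 1 < alpha N /\ (alpha N)^-1 <= e by near: N; exact: near_pinfty_inv_le.
have aN : alpha N / N%:R <= e.
  by near: N; move/cvgr0_norm_le : alpha_N => /(_ e e0); apply: filterS => n; exact/le_trans/ler_norm.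
have Ni : N%:R^-1 <= e by near: N; exact: near_inv_le.
have N1 : 1 <= N%:R :> R by rewrite ler1n.
have tN : t * N%:R ^+ 2 * m%:R^-1 <= e.
  rewrite -ler_pdivlMl ?mulr_gt0 ?exprn_gt0 ?ltr0n //.
  near: m; apply: near_inv_le.
  by rewrite mulr_gt0 // invr_gt0 mulr_gt0 // exprn_gt0 ?ltr0n.
have th0 : 0 <= hh m by rewrite divr_ge0 // ltW.
have h2 : N%:R ^+ 2 * hh m <= e by rewrite mulrCA mulrC mulrAC [_ * t]mulrC.
have h1 : N%:R * hh m <= e.
  by apply: le_trans h2; rewrite ler_wpM2r // expr2 ler_peMl.
split => //; split => //.
by apply: le_trans h1; rewrite ler_peMl.
Unshelve. all: by end_near.
Qed.

Lemma near2_charac_err (v rho e : R) : 0 <= v <= 1 -> 0 < rho -> rho < 1 -> 0 < e ->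
  near2 (fun N m => forall j, (j <= m)%N ->
    lazyE (hh m) j (charac_err (alpha N) (hh m) v rho : seq (option (pair N)) -> R) <= e).
Proof.
move=> v01 r0 r1 e0.
(* The midpoint leaves room between rho and 1 for the factor exp h of one step. *)
pose r : R := (1 + rho) / 2.
have rr : rho < r by rewrite /r; lra.
have rlt1 : r < 1 by rewrite /r; lra.
have rp : 0 < r by rewrite /r; lra.
pose lam : R := - ln r.
have lam0 : 0 < lam by rewrite /lam oppr_gt0 ln_lt0 // rp.
pose C : R := 4 / lam ^+ 2.
have C0 : 0 < C by rewrite divr_gt0 // exprn_gt0.
have HC k : k%:R ^+ 2 * r ^+ k <= C.
  by have := sqr_expR_bound k lam0; rewrite /lam opprK lnK.
(* With the mesh conditions at level eta, b <= h (2 C + 6) eta, so 5 b + 4 C^2 h / N <= h M eta. *)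
pose M : R := 10 * C + 30 + 4 * C ^+ 2.
have M0 : 0 < M by rewrite /M; have := exprn_gt0 2 C0; lra.
pose E : R := expR (t * (3 * C)).
have E0 : 0 < E by exact: expR_gt0.
pose lr : R := ln (r / rho).
have lr0 : 0 < lr by rewrite ln_gt0 // ltr_pdivlMr // mul1r.
pose eta : R := Num.min (Num.min (e / (E * t * M)) lr) (Num.min ((10 * (C + 1))^-1) (2^-1)).
have eta0 : 0 < eta.
  rewrite !lt_min lr0 !invr_gt0 !mulr_gt0 ?invr_gt0 ?mulr_gt0 //=; lra.
have eta1 : E * (t * (M * eta)) <= e.
  rewrite !mulrA mulrC -ler_pdivlMr ?mulr_gt0 // /eta !ge_min lexx //.
have eta2 : eta <= lr by rewrite /eta !ge_min lexx orbT.
have eta3 : (10 * (C + 1)) * eta <= 1.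
  rewrite mulrC -ler_pdivlMr ?mul1r ?mulr_gt0 //; last by lra.
  by rewrite /eta !ge_min lexx !orbT.
have eta4 : eta <= 2^-1 by rewrite /eta !ge_min lexx !orbT.
have := near2_fine_mesh eta0; apply: near2S => N m [N0 m0 a1 aN [Ni ai Nh hm N2h]] j jm.
have h0 : 0 <= hh m by rewrite divr_ge0 // ltW.
have mp : 0 < m%:R :> R by rewrite ltr0n.
have Np : 0 < N%:R :> R by rewrite ltr0n.
have Nhalf : N%:R * hh m <= 2^-1 by exact: le_trans Nh eta4.
have hP : hh m / N%:R * #|{: pair N}|%:R <= 1.
  apply: (@le_trans _ _ (hh m / N%:R * N%:R ^+ 2)).
    by rewrite ler_wpM2l ?card_pair_le // divr_ge0.
  rewrite expr2 mulrA divfK ?gt_eqF // mulrC; lra.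
have re : rho * expR (hh m) <= r.
  have : expR (hh m) <= r / rho.
    apply: (@le_trans _ _ (expR lr)); first by rewrite ler_expR (le_trans hm).
    by rewrite /lr lnK // posrE; exact: divr_gt0 rp r0.
  by rewrite ler_pdivlMr // mulrC.
have re0 : 0 <= rho * expR (hh m) by rewrite mulr_ge0 ?expR_ge0 // ltW.
have HC' k : k%:R ^+ 2 * (rho * expR (hh m)) ^+ k <= C.
  by apply: le_trans (HC k); rewrite ler_wpM2l ?sqr_ge0 // lerXn2r // nnegrE // ltW.
have Ceta : C * eta <= 10^-1.
  by rewrite mulrDr mulrDl in eta3; lra.
have eta10 : eta <= 10^-1.
  by rewrite mulrDr mulrDl in eta3; have : 0 < C * eta by [rewrite mulr_gt0]; lra.
have Ch : C * hh m <= 1.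
  by have := ler_wpM2l (ltW C0) hm; lra.
set hm' := hh m in h0 Nh hm N2h Nhalf hP re re0 HC' Ch *.
set b := hm' * (C * (N%:R^-1 + (alpha N)^-1)) + 6 * (N%:R * hm') ^+ 2.
have s1 : C * (N%:R^-1 + (alpha N)^-1) <= 2 * C * eta.
  by have := ler_wpM2l (ltW C0) (lerD Ni ai); lra.
have bb : b <= hm' * (2 * C * eta + 6 * eta).
  rewrite /b [leRHS]mulrDr; apply: lerD; first by rewrite ler_wpM2l.
  have -> : 6 * (N%:R * hm') ^+ 2 = hm' * (6 * (N%:R ^+ 2 * hm')) by ring.
  by rewrite ler_wpM2l // ler_wpM2l.
have b1 : b <= 1.
  have : hm' * (2 * C * eta + 6 * eta) <= 10^-1 * 1.
    apply: ler_pM => //; [have : 0 < C * eta by [rewrite mulr_gt0]; lra|exact: le_trans hm _|lra].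
  lra.
apply: (le_trans (lazyE_charac_err N0 h0 hP j a1 v01 (le_trans re (ltW rlt1)) r0 HC' Nhalf Ch b1)).
apply: le_trans eta1.
have jh : j%:R * hm' <= t.
  by rewrite /hm' mulrCA -[leRHS]mulr1 ler_pM2l // ler_pdivrMr // mul1r ler_nat.
apply: ler_pM; first exact: expR_ge0.
- have b0 : 0 <= b.
    have ap : 0 <= alpha N by exact: le_trans ler01 (ltW a1).
    apply: addr_ge0; last by rewrite mulr_ge0 // sqr_ge0.
    by rewrite mulr_ge0 // mulr_ge0 ?(ltW C0) // addr_ge0 // invr_ge0.
  rewrite -/b; apply: mulr_ge0 => //; apply: addr_ge0; first by rewrite mulr_ge0.
  by rewrite mulr_ge0 // divr_ge0 // mulr_ge0 // sqr_ge0.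
- rewrite ler_expR (_ : j%:R * (3 * C * hm') = j%:R * hm' * (3 * C)); last by ring.
  by rewrite ler_wpM2r // mulr_ge0 // ltW.
apply: (@le_trans _ _ (j%:R * (hm' * (M * eta)))).
  rewrite ler_wpM2l //.
  have : hm' * (4 * C ^+ 2 / N%:R) <= hm' * (4 * C ^+ 2 * eta).
    by rewrite ler_wpM2l // ler_wpM2l // mulr_ge0 // sqr_ge0.
  rewrite -/b /M; move: {b1} b bb => b bb H; lra.
by rewrite mulrA ler_wpM2r // mulr_ge0 // ltW.
Qed.

Lemma near2_all K (P : nat -> nat -> nat -> Prop) : (forall i, (i < K)%N -> near2 (P i)) ->
  near2 (fun N m => forall i, (i < K)%N -> P i N m).
Proof.
elim: K => [|K IH] PK; first by apply: filterE => N; apply: filterE => m i.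
apply: near2S2 (IH (fun i iK => PK i (ltnW iK))) (PK K (ltnSn K)) => N m A B i.
by rewrite ltnS leq_eqVlt => /orP[/eqP-> //|]; exact: A.
Qed.

Lemma accumD N h (f g : seq (option (pair N)) -> R) w :
  accum h (fun w => f w + g w) w = accum h f w + accum h g w.
Proof. by elim: w => [|a w IH] /=; [rewrite addr0|rewrite IH; ring]. Qed.

Lemma accumZ N h c (f : seq (option (pair N)) -> R) w :
  accum h (fun w => c * f w) w = c * accum h f w.
Proof. by elim: w => [|a w IH] /=; [rewrite mulr0|rewrite IH; ring]. Qed.

Lemma accum_le N h (f g : seq (option (pair N)) -> R) w : 0 <= h -> (forall w, f w <= g w) ->
  accum h f w <= accum h g w.
Proof. by move=> h0 fg; elim: w => //= a w IH; rewrite lerD // ler_wpM2l. Qed.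

Lemma ring_probability_le1 N h : (0 < N)%N -> 0 <= h -> N%:R * h <= 2^-1 ->
  h / N%:R * #|{: pair N}|%:R <= 1 :> R.
Proof.
move=> N0 h0 Nh; apply: (@le_trans _ _ (h / N%:R * N%:R ^+ 2)).
  by rewrite ler_wpM2l ?card_pair_le // divr_ge0.
rewrite expr2 mulrA divfK ?pnatr_eq0 -?lt0n // mulrC; lra.
Qed.

Lemma near2_excess (e : R) : 0 < e -> exists d rho K, [/\ 0 < d, 0 < rho < 1, 0 <= rho - d * expR t,
  1 <= K%:R * d & near2 (fun N m => lazyE (hh m) m
    (accum (hh m) (excess (alpha N) (hh m) d rho t K) : seq (option (pair N)) -> R) <= e)].
Proof.
move=> e0.
(* The defect x is only controlled in square, and x <= x^2 / (2 th) + th / 2. The target e is split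
   into quarters: the mesh term, t th / 2, the squared defect, and the grid errors. *)
pose th : R := e / (2 * t).
have th0 : 0 < th by rewrite divr_gt0 // mulr_gt0.
pose kp : R := Num.min 2^-1 (th * e / 16).
have kp0 : 0 < kp by rewrite lt_min invr_gt0 ltr0n /= divr_gt0 // mulr_gt0.
have kp1 : kp <= 2^-1 by rewrite /kp ge_min lexx.
have kp2 : kp <= th * e / 16 by rewrite /kp ge_min lexx orbT.
pose Et : R := expR t; have Et0 : 0 < Et by exact: expR_gt0.
pose d : R := Num.min (e / (8 * t)) (kp / Et).
have d0 : 0 < d by rewrite lt_min !divr_gt0 // mulr_gt0.
have d1 : d * (8 * t) <= e by rewrite -ler_pdivlMr ?mulr_gt0 // /d ge_min lexx.
have d2 : d * Et <= kp by rewrite -ler_pdivlMr // /d ge_min lexx orbT.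
pose rho : R := 1 - kp.
(* Indices i < K give i d <= 1, as required of v, while K d >= 1 guarantees a killed index. *)
pose K := (Num.truncn d^-1).+1.
have /andP[Kd1 Kd2] : (Num.truncn d^-1)%:R <= d^-1 < (Num.truncn d^-1).+1%:R.
  by apply: truncn_itv; rewrite invr_ge0 ltW.
have z0 : 0 <= rho - d * expR t by rewrite -/Et /rho; lra.
have r01 : 0 < rho < 1 by rewrite /rho; apply/andP; split; lra.
have K1 : 1 <= K%:R * d by rewrite -ler_pdivrMr // div1r ltW.
exists d, rho, K; split => //.
have d30 : 0 < (d / 3) ^+ 2 by rewrite exprn_gt0 // divr_gt0.
pose e' := e / (4 * t) * (d / 3) ^+ 2 / K%:R.
have e'0 : 0 < e' by rewrite divr_gt0 ?ltr0n // mulr_gt0 // divr_gt0 // mulr_gt0.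
have XE : near2 (fun N m => forall i, (i < K)%N -> forall j, (j <= m)%N ->
    lazyE (hh m) j (charac_err (alpha N) (hh m) (i%:R * d) rho : seq (option (pair N)) -> R) <= e').
  apply: near2_all => i iK; case/andP: r01 => r0 r1; apply: near2_charac_err => //.
  apply/andP; split; first by rewrite mulr_ge0 // ltW.
  by rewrite -ler_pdivlMr // div1r; apply: le_trans Kd1; rewrite ler_nat -ltnS.
pose ef : R := Num.min 2^-1 (th * e / (4 * t)).
have ef0 : 0 < ef by rewrite lt_min invr_gt0 ltr0n /=;
  exact: divr_gt0 (mulr_gt0 th0 e0) (mulr_gt0 (ltr0n _ 4) t0).
have ef1 : ef <= 2^-1 by rewrite /ef ge_min lexx.
have ef2 : t * ef <= th * e / 4.
  have H : ef <= th * e / (4 * t) by rewrite /ef ge_min lexx orbT.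
  apply: le_trans (ler_wpM2l (ltW t0) H) _.
  by rewrite le_eqVlt; apply/orP; left; apply/eqP; field; rewrite gt_eqF.
apply: near2S2 XE (near2_fine_mesh ef0) => N m XE [N0 m0 a1 aN [_ _ Nh _ _]].
have h0 : 0 <= hh m by rewrite divr_ge0 // ltW.
have mp : 0 < m%:R :> R by rewrite ltr0n.
have hP := ring_probability_le1 N0 h0 (le_trans Nh ef1).
have mh : m%:R * hh m = t by rewrite mulrCA mulfV ?mulr1 // gt_eqF.
set h := hh m in h0 Nh hP mh XE *.
set zs := rho - d * expR t in z0.
have zs1 : zs <= 1 by have : 0 < d * expR t by [rewrite mulr_gt0]; case/andP: r01; rewrite /zs; lra.
pose G2 (w : seq (option (pair N))) := (lazy_mass (alpha N) w - gfun (alpha N) zs (lazy_links (alpha N)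
  w)) ^+ 2.
pose Bd : seq (option (pair N)) -> R := grid_err (alpha N) h d rho K.
apply: (@le_trans _ _ (lazyE h m (fun w => accum h (fun=> 2 * d + th / 2) w +
  (2 * th)^-1 * accum h G2 w + accum h Bd w))).
  apply: lazyE_le => // w _.
  rewrite -accumZ -!accumD; apply: accum_le => // w'.
  rewrite /excess -/zs lerD2r -addrA lerD2l /G2.
  set x := lazy_mass _ _ - _.
  have : 0 <= (2 * th)^-1 * (x - th) ^+ 2 by rewrite mulr_ge0 ?sqr_ge0 // invr_ge0 mulr_ge0 // ltW.
  have -> : (2 * th)^-1 * (x - th) ^+ 2 = (2 * th)^-1 * x ^+ 2 - x + th / 2 by field; rewrite gt_eqF.
  lra.
rewrite !lazyE_add // lazyE_scale //.
have A1 : lazyE h m (accum h (fun=> 2 * d + th / 2) : seq (option (pair N)) -> R) <= t * (2 * d + th / 2).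
  by rewrite -mh; apply: lazyE_accum => // j _; rewrite lazyE_cst.
have A2 := lazyE_defect N0 h0 hP m z0 zs1 (lt_trans ltr01 a1).
have A3 : lazyE h m (accum h Bd) <= t * (e / (4 * t)).
  rewrite -[X in _ <= X * _]mh; apply: lazyE_accum => // j jm; rewrite lazyE_sum //.
  apply: (@le_trans _ _ (\sum_(i < K) e' / (d / 3) ^+ 2)).
    apply: ler_sum => i _.
    apply: (@le_trans _ _ ((d / 3) ^- 2 * lazyE h j (@charac_err R N (alpha N) h (i%:R * d) rho))).
      by rewrite -(lazyE_scale h0 hP); apply: (lazyE_le h0 hP) => w _; rewrite mulrC.
    by rewrite mulrC ler_pM2r ?invr_gt0 // XE // ltnW.
  rewrite sumr_const card_ord -[_ *+ _]mulr_natl /e' le_eqVlt; apply/orP; left; apply/eqP.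
  by field; rewrite !gt_eqF ?ltr0n.
have tt : t * (e / (4 * t)) = e / 4 by field; rewrite gt_eqF.
rewrite tt in A3.
have B1 : t * (2 * d + th / 2) <= e / 4 + e / 4.
  have -> : t * (2 * d + th / 2) = d * (8 * t) / 4 + e / 4 by rewrite /th; field; rewrite gt_eqF.
  lra.
have B2 : (2 * th)^-1 * (2 * (1 - zs) + m%:R * h * (alpha N / N%:R)) <= e / 4.
  have th2 : 0 < 2 * th by exact: mulr_gt0 (ltr0n _ 2) th0.
  rewrite mh [leLHS]mulrC ler_pdivrMr //.
  have : t * (alpha N / N%:R) <= t * ef by rewrite ler_wpM2l // ltW.
  have : 2 * (1 - zs) <= 4 * kp by rewrite /zs /rho -/Et; lra.
  lra.
have i0 : 0 <= (2 * th)^-1 by rewrite invr_ge0 mulr_ge0 // (ltW th0).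
have := ler_wpM2l i0 A2.
rewrite -/G2; lra.
Qed.

(** Two events of probability at most e / 4 are discarded: a large accumulated excess and a large
    error on one characteristic. Off them, the upper bound comes from a short window ending at t,
    the lower one from u <= n on a characteristic with v slightly below the limit. *)
Theorem lazy_limit (e : R) : 0 < e ->
  near2 (fun N m => lazyE (hh m) m
    (fun w : seq (option (pair N)) => (e < `|lazy_mass (alpha N) w - nlim t|)%R%:R) <= e).
Proof.
wlog e2 : e / e <= 2^-1.
  move=> H e0; have m0 : 0 < Num.min e 2^-1 by rewrite lt_min e0 invr_gt0 ltr0n.
  have := H (Num.min e 2^-1); rewrite ge_min lexx orbT => /(_ isT m0) HH.
  apply: near2S2 HH (near2_fine_mesh (_ : 0 < 2^-1)); last by rewrite invr_gt0.
  move=> N m HH [N0 m0' _ _ [_ _ Nh _ _]].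
  have h0 : 0 <= hh m by rewrite divr_ge0 // ltW.
  apply: le_trans (_ : _ <= Num.min e 2^-1) _; last by rewrite ge_min lexx.
  apply: le_trans HH; apply: lazyE_le => //; first exact: ring_probability_le1.
  move=> w _; rewrite ler_nat; case: (boolP (e < _)) => // h.
  by rewrite gt_min h.
move=> e0.
have n0 := nlim_gt0 t.
pose M : R := Num.max 1 t.
have M1 : 1 <= M by rewrite /M le_max lexx.
have M0 : 0 < M by lra.
(* Slightly below nlim t: the limiting characteristic then stays at most [ph] < 1, at a cost of at
   most e / 4. *)
pose v : R := (1 - e / 4) / M.
pose y : R := 1 - e / 4.
have yE : v * M = y by rewrite /v divfK // gt_eqF.
have y0 : 0 < y by rewrite /y; lra.
have y1 : y < 1 by rewrite /y; lra.
have v0 : 0 < v by rewrite /v divr_gt0.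
have v1 : v <= 1 by rewrite /v ler_pdivrMr //; lra.
have vn : nlim t - e / 4 <= v.
  rewrite nlimE -/M /v mulrBl mul1r lerD2l lerN2 ler_piMr ?invf_le1 // divr_ge0 // ltW //.
pose ph : R := y * expR (1 - y).
have ph0 : 0 < ph by rewrite mulr_gt0 ?expR_gt0.
have ph1 : ph < 1 by exact: xexp_lt1 (ltW y0) y1.
pose rh : R := (1 + ph) / 2.
have rh1 : rh < 1 by rewrite /rh; lra.
have rh0 : 0 < rh by rewrite /rh; lra.
have prh : ph < rh by rewrite /rh; lra.
(* The step h and the accumulated excess may each use c in the exponent before [ph] is raised to
   [rh], the midpoint of [ph] and 1. *)
pose c : R := ln (rh / ph) / 2.
have c0 : 0 < c by rewrite divr_gt0 // ln_gt0 // ltr_pdivlMr // mul1r.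
have cE : ph * expR (c + c) = rh.
  rewrite (_ : c + c = ln (rh / ph)); last by rewrite /c; field.
  have rp0 : 0 < rh / ph by exact: divr_gt0 rh0 ph0.
  by rewrite lnK ?posrE // mulrC divfK // gt_eqF.
pose et : R := Num.min (e / 2) t.
have et0 : 0 < et by rewrite lt_min t0 divr_gt0.
have et1 : et <= e / 2 by rewrite /et ge_min lexx.
have et2 : et <= t by rewrite /et ge_min lexx orbT.
pose q : R := Num.min (e * et / 4) c.
have q0 : 0 < q by rewrite lt_min c0 divr_gt0 // mulr_gt0.
have q1 : q <= e * et / 4 by rewrite /q ge_min lexx.
have q2 : q <= c by rewrite /q ge_min lexx orbT.
have e40 : 0 < e / 4 by rewrite divr_gt0.
have [d [rho [K [d0 /andP[r0 r1] z0 K1 HQ]]]] := near2_excess (mulr_gt0 e40 q0).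
have v01 : 0 <= v <= 1 by rewrite ltW.
have HX := near2_charac_err v01 rh0 rh1 (mulr_gt0 e40 (exprn_gt0 2 e40)).
pose ef : R := Num.min 2^-1 (Num.min c (et / 2)).
have ef0 : 0 < ef by rewrite !lt_min invr_gt0 ltr0n c0 /= divr_gt0.
have ef1 : ef <= 2^-1 by rewrite /ef !ge_min lexx.
have ef2 : ef <= c by rewrite /ef !ge_min lexx orbT.
have ef3 : ef <= et / 2 by rewrite /ef !ge_min lexx !orbT.
apply: near2S2 (near2S2 (fun N m a b => conj a b) HQ HX) (near2_fine_mesh ef0) => N m [{}HQ {}HX].
move=> [N0 m0 a1 aN [_ _ Nh hm _]].
have h0 : 0 <= hh m by rewrite divr_ge0 // ltW.
have mp : 0 < m%:R :> R by rewrite ltr0n.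
have hp : 0 < hh m by rewrite divr_gt0.
have hP := ring_probability_le1 N0 h0 (le_trans Nh ef1).
have mh : m%:R * hh m = t by rewrite mulrCA mulfV ?mulr1 // gt_eqF.
have {}HX := HX m (leqnn m).
set h := hh m in h0 Nh hP mh HX HQ hm hp *.
set Q := accum h _ in HQ.
set Xv := charac_err _ _ _ _ in HX.
have Q0 w : 0 <= Q w by apply: accum_ge0 => // w'; exact: excess_ge0.
have X0 w : 0 <= Xv w by exact: charac_err_ge0.
apply: (@le_trans _ _ (lazyE h m (fun w => (q <= Q w)%R%:R + ((e / 4) ^+ 2 <= Xv w)%R%:R))); last first.
  rewrite lazyE_add //.
  have A := lazyE_markov h0 hP m q0 Q0.
  have B := lazyE_markov h0 hP m (exprn_gt0 2 e40) X0.
  apply: (@le_trans _ _ (e / 4 + e / 4)); last by lra.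
  apply: lerD.
    by apply: le_trans A _; rewrite ler_pdivrMr.
  by apply: le_trans B _; rewrite ler_pdivrMr // exprn_gt0 // divr_gt0.
apply: lazyE_le => // w sw.
have tw : elapsed h w = t by rewrite /elapsed sw.
case: (boolP (q <= Q w)) => Qq /=; first by rewrite -[leLHS]addr0 lerD // lern1; case: (_ < _).
rewrite -ltNge in Qq; rewrite add0r ler_nat.
case: (boolP (e < _)) => // dev.
suff -> : (e / 4) ^+ 2 <= Xv w by [].
(* The window has length between et / 2 and et <= e / 2. Over it [nlim] varies by at most e / 2, and
   a mass above nlim t + e would force an accumulated excess of at least e et / 4 >= q. *)
have up : lazy_mass (alpha N) w <= nlim t + e.
  pose i := Num.truncn (et / h).
  have /andP[i1 i2] : i%:R <= et / h < i.+1%:R by apply: truncn_itv; rewrite divr_ge0 // ltW.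
  rewrite ler_pdivlMr // in i1; rewrite ltr_pdivrMr // -natr1 mulrDl mul1r in i2.
  have im : (i <= m)%N by rewrite -(ler_nat R) -(ler_pM2r hp) mh; lra.
  have tw' : elapsed h w <= t by rewrite tw.
  have := window_upper (alpha N) N0 h0 d0 r0 r1 z0 K1 (m - i)%N tw'.
  rewrite sw subKn // -/Q => W.
  have L := @nlim_lip R ((m - i)%:R * h) t.
  rewrite natrB // mulrBl mh in L W.
  have {}L : nlim (t - i%:R * h) <= nlim t + i%:R * h.
    have ih0 : 0 <= i%:R * h by rewrite mulr_ge0.
    have tt : t - i%:R * h <= t by rewrite gerBl.
    by have := L tt; lra.
  rewrite leNgt; apply/negP => nup.
  have ih : et / 2 <= i%:R * h by lra.
  have ih' : i%:R * h <= e / 2 by lra.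
  move: (i%:R * h) ih ih' W L => z ih ih' W L.
  have z0' : 0 < z by lra.
  have : z * (nlim t + e) <= z * (nlim t + e / 2) + Q w.
    apply: (@le_trans _ _ (z * lazy_mass (alpha N) w)); first by rewrite ler_pM2l // ltW.
    apply: le_trans W _; rewrite lerD2r ler_pM2l //; lra.
  have : et / 2 * (e / 2) <= z * (e / 2) by rewrite ler_wpM2r // divr_ge0 // ltW.
  lra.
have al : alive (alpha N) h v rh w.
  apply: (@alive_lower _ _ _ _ N0 h0 d rho t K d0 r0 r1 z0 K1 w v c); rewrite ?tw ?(ltW v0) ?lexx //.
  - by rewrite -/M yE ltW.
  - rewrite -/M yE -/ph -cE ler_wpM2l ?(ltW ph0) // ler_expR lerD2r; exact: le_trans hm ef2.
  - by rewrite ltW // (lt_le_trans Qq).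
rewrite /Xv /charac_err al mul1r.
have zr := alive_charac al.
have un : gfun (alpha N) (charac (alpha N) h v w) (lazy_links (alpha N) w) <= lazy_mass (alpha N) w.
  by apply: gfun_mass => //; [apply: charac_ge0; exact: ltW | exact: le_trans zr (ltW rh1)].
(* The deviation is thus downward: u <= n < nlim t - e <= v - 3 e / 4, so the characteristic error
   is at least (e / 4)^2. *)
have lo : lazy_mass (alpha N) w < nlim t - e.
  move: dev; rewrite ltr_normr => /orP[]; lra.
rewrite -[leRHS]sqrrN; apply: lerXn2r; rewrite ?nnegrE; lra.
Qed.

End LazyLimit.

(** * From the clocks to the lazy chain *)

Lemma unit_dist (R : realType) (x y : R) : 0 <= x <= 1 -> 0 <= y <= 1 -> `|x - y| <= 1.
Proof. by move=> /andP[? ?] /andP[? ?]; rewrite ler_norml; apply/andP; split; lra. Qed.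

Lemma sum2_const (R : realType) (I : finType) (c : R) :
  \sum_(p : I) \sum_(q : I) c = c * #|I|%:R ^+ 2.
Proof. by rewrite !sumr_const -!mulrnA -[c *+ _]mulr_natr natrM expr2. Qed.

Section ClockChain.
Context (d : measure_display) (R : realType) (T : measurableType d) (P : probability T R).
Variables (N : nat) (alpha : R) (e : T -> pair N -> R).
Hypothesis N0 : (0 < N)%N.
Hypothesis cm : clock_model P e.

Let me p : measurable_fun [set: T] (fun w => e w p). Proof. by case: cm. Qed.
Let ind : mutually_independent P e. Proof. by case: cm. Qed.
Let lawe p (B : set R) : measurable B -> P ((fun w => e w p) @^-1` B) = exponential_prob (N%:R^-1) B.
Proof. by case: cm => _ _; exact. Qed.
Let r0 : 0 < N%:R^-1 :> R. Proof. by rewrite invr_gt0 ltr0n. Qed.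
Let Np : 0 < N%:R :> R. Proof. by rewrite ltr0n. Qed.

Lemma clock_cdf p (t : R) : 0 <= t -> P [set w | e w p <= t] = (1 - expR (- (t / N%:R)))%:E.
Proof.
move=> t0; have := exp_cdf r0 (me p) (@lawe p) t0; rewrite invrK => <-.
by congr (P _); apply/seteqP; split => w /=; rewrite in_itv.
Qed.

Lemma clock_itv p (s t : R) : 0 <= s -> s <= t ->
  P [set w | s < e w p <= t] = (expR (- (s / N%:R)) - expR (- (t / N%:R)))%:E.
Proof.
move=> s0 st; have := exp_itv r0 (me p) (@lawe p) s0 st; rewrite invrK => <-.
by congr (P _); apply/seteqP; split => w /=; rewrite in_itv.
Qed.

Lemma clock_tail p (t : R) : 0 <= t -> P [set w | t < e w p] = (expR (- (t / N%:R)))%:E.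
Proof.
move=> t0; have := exp_tail r0 (me p) (@lawe p) t0; rewrite invrK => <-.
by congr (P _); apply/seteqP; split => w /=; rewrite in_itv /= andbT.
Qed.

Lemma mlinks t L : measurable [set w | links alpha (e w) t = L].
Proof. exact: measurable_links. Qed.

(* The masked dynamics ignores the clocks in [Q], hence is measurable with
   respect to the other clocks. *)
Lemma masked_links_sigma (Q : pred (pair N)) (t : R) (F : pred {set pair N}) :
  <<s boxes e (predC Q) >> [set w | F (links alpha (silence Q t (e w)) t)].
Proof.
pose e' (w : g_sigma_algebraType (boxes e (predC Q))) := silence Q t (e w).
have me' p : measurable_fun [set: g_sigma_algebraType (boxes e (predC Q))] (fun w => e' w p).
  rewrite /e' /silence; case: (boolP (Q p)) => Qp; first exact: measurable_cst.
  exact: boxes_measurable_fun.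
have := @finite_measurable _ (g_sigma_algebraType (boxes e (predC Q))) _ (fun w => links alpha (e' w) t) _ F.
by apply => b; exact: (measurable_links alpha me').
Qed.

Lemma indep_masked (Q : pred (pair N)) (t : R) (F : pred {set pair N}) (B : pair N -> set R) :
  (forall p, measurable (B p)) -> (forall p, ~~ Q p -> B p = setT) ->
  P ([set w | F (links alpha (silence Q t (e w)) t)] `&` \bigcap_(p in [set: pair N]) ((fun w => e w p)
    @^-1` B p)) =
  (P [set w | F (links alpha (silence Q t (e w)) t)] * \prod_(p | Q p) P ((fun w => e w p) @^-1` B p))%E.
Proof.
move=> mB BT; rewrite (indep_group me ind mB BT (@masked_links_sigma Q t F)).
rewrite ind //; congr (_ * _)%E.
rewrite (bigID Q) /= [X in (_ * X)%E]big1 ?mule1 // => p Qp.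
by rewrite BT // preimage_setT probability_setT.
Qed.

Lemma indep_masked1 (p : pair N) (t : R) (F : pred {set pair N}) (B : set R) : measurable B ->
  P ([set w | F (links alpha (silence (pred1 p) t (e w)) t)] `&` ((fun w => e w p) @^-1` B)) =
  (P [set w | F (links alpha (silence (pred1 p) t (e w)) t)] * P ((fun w => e w p) @^-1` B))%E.
Proof.
move=> mB.
pose B' q := if q == p then B else setT.
have := @indep_masked (pred1 p) t F B'.
have BB : B' p = B by rewrite /B' eqxx.
rewrite big_pred1_eq BB => <-.
- congr (P (_ `&` _)); apply/seteqP; split => [w Bw q _|w /(_ p Logic.I)]; rewrite /B' /=;
  last by rewrite eqxx.
  by case: eqP => // ->.
- by move=> q; rewrite /B'; case: ifP.
- by move=> q /=; rewrite /B' => /negbTE ->.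
Qed.

(** Given the links L, the clock of an effective p exceeds t and all else is decided by the other
    clocks: independence and lack of memory give the factor. *)
Lemma one_ring (t h : R) p L : 0 <= t -> 0 <= h -> effective alpha L p ->
  P [set w | links alpha (e w) t = L /\ t < e w p <= t + h] =
  ((1 - expR (- (h / N%:R)))%:E * P [set w | links alpha (e w) t = L])%E.
Proof.
move=> t0 h0 ef.
pose F := pred1 L.
pose A := [set w | F (links alpha (silence (pred1 p) t (e w)) t)].
have E (B : set R) : (forall x, B x -> t < x) ->
    [set w | links alpha (e w) t = L /\ B (e w p)] = A `&` ((fun w => e w p) @^-1` B).
  move=> Bt; apply/seteqP; split => w /= [h1 h2]; split => //.
    by rewrite /A /F /= links_silence ?h1 // => q /eqP ->; exact: Bt.
  by move: h1; rewrite /A /F /= links_silence; [move/eqP | move=> q /eqP ->; exact: Bt].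
have E1 := E `]t, t + h] _.
have E2 := E `]t, +oo[ _.
have -> : [set w | links alpha (e w) t = L] = A `&` ((fun w => e w p) @^-1` `]t, +oo[).
  rewrite -E2; last by move=> x /=; rewrite in_itv /= andbT.
  apply/seteqP; split => w /=; last by case.
  by move=> wL; split => //; rewrite in_itv /= andbT; apply: (effective_late (alpha := alpha)); rewrite wL.
have -> : [set w | links alpha (e w) t = L /\ t < e w p <= t + h] =
  A `&` ((fun w => e w p) @^-1` `]t, t + h]).
  rewrite -E1; last by move=> x /=; rewrite in_itv /= => /andP[].
  by apply/seteqP; split => w /=; rewrite in_itv.
rewrite !indep_masked1 //.
rewrite (_ : _ @^-1` `]t, t + h] = [set w | t < e w p <= t + h]); last first.
  by apply/seteqP; split => w /=; rewrite in_itv.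
rewrite (_ : _ @^-1` `]t, +oo[ = [set w | t < e w p]); last first.
  by apply/seteqP; split => w /=; rewrite in_itv /= andbT.
rewrite clock_itv ?lerDl // clock_tail // muleCA -EFinM; congr (_ * _%:E)%E.
by rewrite mulrDl opprD expRD; ring.
Qed.

Lemma two_rings (t h : R) (p q : pair N) : 0 <= t -> 0 <= h -> p != q ->
  (P [set w | (t < e w p <= t + h)%R /\ (t < e w q <= t + h)%R] <= ((h / N%:R) ^+ 2)%:E)%E.
Proof.
move=> t0 h0 pq.
pose B r := if (r == p) || (r == q) then `]t, t + h] else setT : set R.
have mB r : measurable (B r) by rewrite /B; case: ifP.
have bnd r : (P ((fun w => e w r) @^-1` `]t, (t + h)%R]) <= (h / N%:R)%:E)%E.
  rewrite (_ : _ @^-1` _ = [set w | t < e w r <= t + h]); last first.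
    by apply/seteqP; split => w /=; rewrite in_itv.
  rewrite clock_itv ?lerDl // lee_fin mulrDl opprD expRD.
  have a := expR_ge1Dx (- (h / N%:R)).
  have b : expR (- (t / N%:R)) <= 1 by rewrite -expR0 ler_expR oppr_le0 divr_ge0.
  have c := expR_ge0 (- (t / N%:R)).
  have g : 0 <= h / N%:R by rewrite divr_ge0.
  have f : expR (- (h / N%:R)) <= 1 by rewrite -[leRHS]expR0 ler_expR oppr_le0.
  have c1 : expR (- (t / N%:R)) * (1 - expR (- (h / N%:R))) <= 1 - expR (- (h / N%:R)).
    by rewrite ler_piMl // subr_ge0.
  move: c1; rewrite mulrBr mulr1; lra.
rewrite (_ : [set w | _] = \bigcap_(r in [set: pair N]) ((fun w => e w r) @^-1` B r)); last first.
  apply/seteqP; split => [w [/= wp wq] r _|w H].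
    by rewrite /B /=; case: (r =P p) => [->|_] /=; [rewrite in_itv|case: (r =P q) => [->|_] //=;
      rewrite in_itv].
  have := H p Logic.I; have := H q Logic.I; rewrite /B /= !eqxx orbT /= !in_itv /= => h1 h2.
  by split.
rewrite ind // (bigD1 p) //= (bigD1 q) /=; last by rewrite eq_sym.
rewrite big1 ?mule1; last first.
  by move=> r /andP[/negbTE rp /negbTE rq]; rewrite /B rp rq /= preimage_setT probability_setT.
rewrite /B !eqxx orbT /= expr2 EFinM.
by apply: lee_pmul => //; exact: bnd.
Qed.

Definition Elinks (F : {set pair N} -> R) t : R :=
  \sum_L fine (P [set w | links alpha (e w) t = L]) * F L.

Lemma law_sum (G : finType) (xi : T -> G) (mxi : forall b, measurable (xi @^-1` [set b]))
  (H : finType) (g : G -> H) (F : H -> R) :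
  \sum_b law P xi b * F (g b) = \sum_c fine (P [set w | g (xi w) = c]) * F c.
Proof.
rewrite (partition_big g predT) //=; apply: eq_bigr => c _.
rewrite (_ : [set w | _] = [set w | g (xi w) == c]); last first.
  by apply/seteqP; split => w /= /eqP.
by rewrite (finite_law P mxi (fun b => g b == c)) /= mulr_suml; apply: eq_bigr => b /eqP ->.
Qed.

Lemma law_le (G : finType) (xi : T -> G) (F1 F2 : G -> R) :
  (forall w, F1 (xi w) <= F2 (xi w)) -> \sum_b law P xi b * F1 b <= \sum_b law P xi b * F2 b.
Proof.
move=> F12; apply: ler_sum => b _.
have [[w wb]|nb] := pselect (exists w, xi w = b).
  by rewrite ler_wpM2l ?law_ge0 // -wb.
rewrite /law (_ : _ @^-1` _ = set0) ?measure0 ?mul0r //.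
by apply/seteqP; split => // w wb; apply: nb; exists w.
Qed.

(** Joint law of the links before, the pairs rung in between and the links after; being
    finite-valued, it turns the one-step comparison into finite sums. *)
Let fx (t h : R) w : {set pair N} * {set pair N} * {set pair N} :=
  (links alpha (e w) t, [set p | t < e w p <= t + h]%SET, links alpha (e w) (t + h)).

Let mfx t h b : measurable (fx t h @^-1` [set b]).
Proof.
rewrite (_ : _ @^-1` _ = [set w | links alpha (e w) t = b.1.1] `&`
    \bigcap_(p in [set: pair N]) ((fun w => t < e w p <= t + h) @^-1` [set p \in b.1.2]) `&`
    [set w | links alpha (e w) (t + h) = b.2]); last first.
  case: b => -[b1 b2] b3; apply/seteqP; split => [w [<- <- <-]|w [[/= h1 H] h3]].
    by split => //; split => // p _ /=; rewrite inE.
  rewrite /fx /= h1 h3 (_ : [set p | _]%SET = b2) //.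
  by apply/setP => p; rewrite inE; exact: (H p Logic.I).
apply: measurableI; last exact: mlinks.
apply: measurableI; first exact: mlinks.
apply: fin_bigcap_measurable; first exact: finite_finset.
move=> p _; rewrite -[_ @^-1` _]setTI.
suff : measurable_fun [set: T] (fun w => t < e w p <= t + h) by apply.
apply: measurable_and; last exact: measurable_ler_cst.
by apply: measurable_fun_ltr => //; exact: measurable_cst.
Qed.

Let lawT t h : \sum_b law P (fx t h) b = 1.
Proof.
have := finite_law P (@mfx t h) xpredT.
rewrite (_ : [set _ | _] = setT) ?probability_setT; last by apply/seteqP; split.
by move=> [->].
Qed.

Lemma links_no_ring w (t h : R) : 0 <= h -> [set p | t < e w p <= t + h]%SET = finset.set0 ->
  links alpha (e w) (t + h) = links alpha (e w) t.
Proof.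
move=> h0 /setP A0; rewrite !links_run (@ring_seq_split _ _ _ t (t + h)) ?lerDl //.
rewrite (_ : [seq p <- sort _ _ | _] = [::]) ?cats0 //.
apply/eqP; rewrite -[_ == _]negbK -has_filter; apply/hasPn => q _.
by have := A0 q; rewrite !inE => ->.
Qed.

Lemma links_one_ring w (t h : R) p : 0 <= h -> [set p | t < e w p <= t + h]%SET = [set p]%SET ->
  links alpha (e w) (t + h) = step alpha (links alpha (e w) t) p.
Proof.
move=> h0 /setP A1; rewrite !links_run (@ring_seq_split _ _ _ t (t + h)) ?lerDl //.
rewrite foldl_cat; set s := [seq _ <- _ | _].
have : perm_eq s [:: p].
  apply: uniq_perm => //; first by rewrite filter_uniq // sort_uniq enum_uniq.
  move=> q; rewrite mem_filter mem_sort mem_enum andbT.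
  by have := A1 q; rewrite !inE => ->.
by move/perm_small_eq => ->.
Qed.

Let npair : R := #|{: pair N}|%:R.

(** Single rings are exact up to 1 - exp (- x) versus x = h / N, an error at most x^2 per pair. When
    two pairs ring, of probability at most x^2 for each ordered choice, the integrand is at most 1 +
    [npair]. *)
Lemma Elinks_step F (t h : R) : 0 <= t -> 0 <= h -> (forall L, 0 <= F L <= 1) ->
  `|Elinks F (t + h) - Elinks (fun L => F L + h * gen alpha F L) t| <=
  (h / N%:R) ^+ 2 * (npair + (1 + npair) * npair ^+ 2).
Proof.
move=> t0 h0 F01.
have hN : 0 <= h / N%:R by rewrite divr_ge0.
have E1 : Elinks F (t + h) = \sum_b law P (fx t h) b * F b.2.
  by rewrite (law_sum (@mfx t h) (fun b => b.2)).
have E2 : Elinks (fun L => F L + h * gen alpha F L) t =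
   \sum_b law P (fx t h) b * (F b.1.1 + h * gen alpha F b.1.1).
  by rewrite (law_sum (@mfx t h) (fun b => b.1.1) (fun L => F L + h * gen alpha F L)).
pose D L p := F (step alpha L p) - F L.
have D1 L p : `|D L p| <= 1.
  exact: unit_dist.
pose S (A : {set pair N}) L := \sum_p (p \in A)%:R * D L p.
(* An ineffective p leaves the links unchanged, so both sides vanish; otherwise [one_ring] applies
   for each L. *)
have key p : \sum_b law P (fx t h) b * ((p \in b.1.2)%:R * D b.1.1 p) =
   (1 - expR (- (h / N%:R))) * \sum_b law P (fx t h) b * D b.1.1 p.
  rewrite (law_sum (@mfx t h) (fun b => (b.1.1, p \in b.1.2)) (fun c => c.2%:R * D c.1 p)).
  rewrite (law_sum (@mfx t h) (fun b => b.1.1) (fun L => D L p)).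
  set G1 := (X in \sum_c X c).
  have -> : \sum_c G1 c = \sum_L \sum_(b : bool) G1 (L, b).
    by rewrite pair_bigA; apply: eq_bigr => -[].
  rewrite /G1 /=.
  rewrite mulr_sumr; apply: eq_bigr => L _; rewrite big_bool /= mul0r mulr0 addr0 mul1r.
  have [ef|nef] := boolP (effective alpha L p); last by rewrite /D step_ineffective // subrr !mulr0.
  rewrite mulrA; congr (_ * _).
  rewrite (_ : [set w | _ = (L, true)] = [set w | links alpha (e w) t = L /\ t < e w p <= t + h]); last first.
    by apply/seteqP; split => w /=; rewrite inE; [case|case=> -> ->].
  by rewrite one_ring // fineM ?fin_num_measure //; exact: mlinks.
have split1 : Elinks F (t + h) - Elinks (fun L => F L + h * gen alpha F L) t =
   \sum_b law P (fx t h) b * (F b.2 - F b.1.1 - S b.1.2 b.1.1) +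
   \sum_p (1 - expR (- (h / N%:R)) - h / N%:R) * \sum_b law P (fx t h) b * D b.1.1 p.
  have -> : \sum_p (1 - expR (- (h / N%:R)) - h / N%:R) * (\sum_b law P (fx t h) b * D b.1.1 p) =
     \sum_b law P (fx t h) b * (S b.1.2 b.1.1 - h * gen alpha F b.1.1).
    under eq_bigr do rewrite mulrBl -key.
    rewrite sumrB.
    under [in RHS]eq_bigr do rewrite mulrBr.
    rewrite sumrB; congr (_ - _).
      rewrite exchange_big; apply: eq_bigr => b _ /=.
      by rewrite /S mulr_sumr.
    rewrite -mulr_sumr exchange_big mulr_sumr; apply: eq_bigr => b _ /=.
    rewrite /gen -mulr_sumr; ring.
  rewrite E1 E2 -sumrB -big_split; apply: eq_bigr => b _ /=; ring.
rewrite split1 mulrDr; apply: le_trans (ler_normD _ _) _; rewrite addrC; apply: lerD.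
  apply: le_trans (ler_norm_sum _ _ _) _.
  rewrite [leRHS](_ : _ = \sum_(p : pair N) (h / N%:R) ^+ 2); last first.
    by rewrite sumr_const -[RHS]mulr_natr.
  apply: ler_sum => p _; rewrite normrM -[leRHS]mulr1 ler_pM //.
    have a := expR_ge1Dx (- (h / N%:R)).
    have b := expR_ge1Dx (h / N%:R).
    have c : expR (- (h / N%:R)) * expR (h / N%:R) = 1 by rewrite -expRD addNr expR0.
    have dd := expR_gt0 (- (h / N%:R)).
    rewrite ler0_norm; last by lra.
    have c1 : expR (- (h / N%:R)) * (1 + h / N%:R) <= 1 by rewrite -[leRHS]c ler_wpM2l // ltW.
    have c2 := ler_wpM2r hN a.
    move: c1 c2; rewrite mulrDr mulr1 mulrDl mul1r; lra.
  apply: le_trans (ler_norm_sum _ _ _) _.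
  rewrite -[leRHS](lawT t h); apply: ler_sum => b _.
  by rewrite normrM ger0_norm ?law_ge0 // ler_piMr // law_ge0.
pose W (b : {set pair N} * {set pair N} * {set pair N}) : R :=
  (1 + npair) * \sum_p \sum_(q | p != q) ((p \in b.1.2) && (q \in b.1.2))%:R.
have W0 b : 0 <= W b by rewrite mulr_ge0 ?addr_ge0 // sumr_ge0 // => p _; rewrite sumr_ge0.
have bnd w : `|F (fx t h w).2 - F (fx t h w).1.1 - S (fx t h w).1.2 (fx t h w).1.1| <= W (fx t h w).
  have [/eqP A0|A0] := boolP ((fx t h w).1.2 == finset.set0).
    rewrite (_ : (fx t h w).2 = (fx t h w).1.1); last exact: links_no_ring.
    by rewrite /S big1 ?subrr ?subr0 ?normr0 // => p _; rewrite A0 inE mul0r.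
  case/set0Pn: A0 => p pA.
  have [/eqP A1|A1] := boolP ((fx t h w).1.2 == [set p]%SET).
    rewrite (_ : (fx t h w).2 = step alpha (fx t h w).1.1 p); last exact: links_one_ring.
    rewrite /S A1 (bigD1 p) //= inE eqxx mul1r big1 ?addr0 ?subrr ?normr0 // => q qp.
    by rewrite inE (negbTE qp) mul0r.
  have [q qA qp] : exists2 q, q \in (fx t h w).1.2 & p != q.
    apply: contrapT => H; move: A1; apply/negP; rewrite negbK finset.eqEsubset finset.sub1set pA andbT.
    apply/fintype.subsetP => q qA; rewrite inE; apply: contrapT => qp.
    by apply: H; exists q => //; rewrite eq_sym; apply/negP.
  apply: (@le_trans _ _ (1 + npair)).
    apply: le_trans (ler_normB _ _) _; apply: lerD.
      exact: unit_dist.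
    apply: le_trans (ler_norm_sum _ _ _) _.
    rewrite [leRHS](_ : _ = \sum_(p : pair N) 1); last by rewrite sumr_const.
    apply: ler_sum => r _; rewrite normrM -[leRHS]mulr1 ler_pM //.
    by case: (_ \in _); rewrite ?normr1 ?normr0.
  rewrite /W -[leLHS]mulr1 ler_wpM2l ?addr_ge0 //.
  rewrite (bigD1 p) //= (bigD1 q) //= pA qA -addrA lerDl addr_ge0 //.
    by rewrite sumr_ge0.
  by rewrite sumr_ge0 // => r _; rewrite sumr_ge0.
apply: (@le_trans _ _ (\sum_b law P (fx t h) b * W b)).
  apply: le_trans (ler_norm_sum _ _ _) _.
  rewrite (eq_bigr (fun b => law P (fx t h) b * `|F b.2 - F b.1.1 - S b.1.2 b.1.1|)); last first.
    by move=> b _; rewrite normrM ger0_norm // law_ge0.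
  exact: law_le.
rewrite /W.
rewrite (eq_bigr (fun b => (1 + npair) * \sum_p \sum_(q | p != q) law P (fx t h) b * ((p \in b.1.2) &&
  (q \in b.1.2))%:R)); last first.
  move=> b _; rewrite mulrCA; congr (_ * _); rewrite mulr_sumr; apply: eq_bigr => p _.
  by rewrite mulr_sumr.
rewrite -mulr_sumr mulrCA ler_wpM2l ?addr_ge0 //.
rewrite exchange_big /=.
rewrite [leRHS](_ : _ = \sum_(p : pair N) \sum_(q : pair N) (h / N%:R) ^+ 2); last first.
  by rewrite sum2_const.
apply: ler_sum => p _; rewrite exchange_big /= [leLHS]big_mkcond /=.
apply: ler_sum => q _; case: ifP => pq; last by rewrite sqr_ge0.
have := two_rings t0 h0 pq.
rewrite (_ : [set w | _] = [set w | (p \in (fx t h w).1.2) && (q \in (fx t h w).1.2)]); last first.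
  by apply/seteqP; split => w /=; rewrite !inE => /andP.
rewrite (finite_law P (@mfx t h) (fun b => (p \in b.1.2) && (q \in b.1.2))) lee_fin.
apply: le_trans; rewrite [leRHS]big_mkcond /=; apply: ler_sum => b _.
by case: ifP => _; rewrite ?mulr1 ?mulr0.
Qed.

Lemma Elinks0 F : Elinks F 0 = F finset.set0.
Proof.
have nul L : L != finset.set0 -> fine (P [set w | links alpha (e w) 0 = L]) = 0.
  case/set0Pn => p pL.
  have : (P [set w | links alpha (e w) 0 = L] <= P [set w | (e w p <= 0)%R])%E.
    apply: le_measure; rewrite ?inE; first exact: mlinks.
      rewrite -[X in measurable X]setTI (_ : [set w | _] = (fun w => e w p <= 0) @^-1` [set true]) //.
      exact: (measurable_ler_cst me).
    by move=> w /= wL; move: pL; rewrite -wL links_run => /run_mem; rewrite inE mem_ring_seq.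
  rewrite clock_cdf // mul0r oppr0 expR0 subrr => H.
  by have -> : P [set w | links alpha (e w) 0 = L] = 0%E by apply/eqP; rewrite eq_le H /=.
have tot : \sum_L fine (P [set w | links alpha (e w) 0 = L]) = 1.
  have := finite_law P (xi := fun w => links alpha (e w) 0) (fun b => mlinks 0 b) xpredT.
  rewrite (_ : [set _ | _] = setT) ?probability_setT; last by apply/seteqP; split.
  by move=> [->].
rewrite /Elinks (bigD1 finset.set0) //= big1 ?addr0; last by move=> L L0; rewrite nul // mul0r.
move: tot; rewrite (bigD1 finset.set0) //= big1 ?addr0; last by move=> L L0; rewrite nul.
by move=> ->; rewrite mul1r.
Qed.

(** The last step is peeled off on both sides: the one-step average [QF] again takes values in
    [0, 1], so the induction hypothesis applies to it and the errors add up. *)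
Lemma Elinks_lazyE m (h : R) F : 0 <= h -> h / N%:R * npair <= 1 -> (forall L, 0 <= F L <= 1) ->
  `|Elinks F (m%:R * h) - lazyE h m (fun w => F (lazy_links alpha w))| <=
  m%:R * ((h / N%:R) ^+ 2 * (npair + (1 + npair) * npair ^+ 2)).
Proof.
move=> h0 hP; elim: m F => [|m IH] F F01; first by rewrite !mul0r Elinks0 /= subrr normr0.
rewrite -[m.+1%:R]natr1 [(_ + 1) * h]mulrDl mul1r [(_ + 1) * (_ * _)]mulrDl mul1r.
pose QF L := F L + h * gen alpha F L.
have QF01 L : 0 <= QF L <= 1.
  rewrite /QF -lazyE1_step; apply/andP; split.
    rewrite -[leLHS](@lazyE1_cst R N h 0); apply: (lazyE1_le h0 hP) => a;
      by case/andP: (F01 (stepo alpha L a)).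
  rewrite -[leRHS](@lazyE1_cst R N h 1); apply: (lazyE1_le h0 hP) => a; by case/andP: (F01 (stepo alpha L a)).
have A := IH QF QF01.
have B := Elinks_step (mulr_ge0 (ler0n R m) h0) h0 F01.
have C : lazyE h m.+1 (fun w => F (lazy_links alpha w)) = lazyE h m (fun w => QF (lazy_links alpha w)).
  by rewrite [LHS]/=; apply: (lazyE_ext h0 hP) => w; rewrite /QF -lazyE1_step.
rewrite C.
apply: le_trans (lerD A B); rewrite [leRHS]addrC.
have -> : Elinks F (m%:R * h + h) - lazyE h m (fun w => QF (lazy_links alpha w)) =
   (Elinks F (m%:R * h + h) - Elinks QF (m%:R * h)) +
     (Elinks QF (m%:R * h) - lazyE h m (fun w => QF (lazy_links alpha w))) by ring.
exact: ler_normD.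
Qed.

End ClockChain.

(** * Convergence in the Skorokhod space *)

Section NprocPaths.
Variables (R : realType) (N : nat) (alpha : R) (e : pair N -> R).
Hypothesis N0 : (0 < N)%N.

Lemma nprocE t : nproc alpha e t = mass alpha (links alpha e t).
Proof. by rewrite massE. Qed.

Lemma nproc_le1 t : nproc alpha e t <= 1.
Proof. by rewrite nprocE mass_le1. Qed.

Lemma nproc_mono s t : s <= t -> nproc alpha e t <= nproc alpha e s.
Proof.
move=> st; rewrite ler_pM2r ?invr_gt0 ?ltr0n // ler_nat.
apply: subset_leq_card; apply/fintype.subsetP => x; rewrite !inE.
exact/small_subL/links_mono.
Qed.

Lemma near_right_const t : \forall s \near t^'+, nproc alpha e s = nproc alpha e t.
Proof.
have H : \forall s \near t^'+, forall p : pair N, (e p <= s) = (e p <= t).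
  apply: filter_forall => p.
  case: (lerP (e p) t) => pt.
    by near=> s; rewrite (le_trans pt) // ltW.
  by near=> s; apply/negbTE; rewrite -ltNge; near: s; exact: nbhs_right_lt.
apply: filterS H => s H; rewrite /nproc /Ssol (_ : links alpha e s = links alpha e t) //.
by apply/setP => p; rewrite !inE H.
Unshelve. all: by end_near.
Qed.

Lemma near_left_const t : \forall s \near t^'-,
  nproc alpha e s = #|[set i | small alpha [set p in created alpha e | e p < t]%SET i]%SET|%:R / N%:R.
Proof.
have H : \forall s \near t^'-, forall p : pair N, (e p <= s) = (e p < t).
  apply: filter_forall => p.
  case: (ltrP (e p) t) => pt.
    by near=> s; apply: ltW; near: s; exact: nbhs_left_gt.
  by near=> s; apply/negbTE; rewrite -ltNge (lt_le_trans _ pt).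
apply: filterS H => s H; rewrite /nproc /Ssol.
rewrite (_ : links alpha e s = [set p in created alpha e | e p < t]%SET) //.
by apply/setP => p; rewrite !inE H.
Unshelve. all: by end_near.
Qed.

Lemma cadlag_nproc : cadlag (nproc alpha e).
Proof.
split=> t _; first by apply: cvg_near_cst; exact: near_right_const.
by apply/cvg_ex; eexists; apply: cvg_near_cst; exact: near_left_const.
Qed.

(** As in Dini's theorem, monotone paths close to a Lipschitz limit at grid points are close to it
    in between. *)
Lemma nproc_uniform (h T : R) : 0 < h ->
  (forall i : nat, i%:R * h <= T -> `|nproc alpha e (i.+1%:R * h) - nlim (i.+1%:R * h)| <= h) ->
  forall t, 0 <= t <= T -> `|nproc alpha e t - nlim t| <= 2 * h.
Proof.
move=> h0 H t /andP[t0 tT].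
pose i := Num.truncn (t / h).
have /andP[i1 i2] : i%:R <= t / h < i.+1%:R by apply: truncn_itv; rewrite divr_ge0 // ltW.
rewrite ler_pdivlMr // in i1; rewrite ltr_pdivrMr // in i2.
have A := H i (le_trans i1 tT).
have B := nproc_mono (ltW i2).
have C := nlim_lip (ltW i2).
have D := nlim_lip i1.
have E : i.+1%:R * h = i%:R * h + h by rewrite -natr1 mulrDl mul1r.
move: A; rewrite !ler_norml => /andP[A1 A2].
rewrite E in A1 A2 B C i2.
apply/andP; split; first by lra.
(* Time 0 is not among the controlled grid points; on the first interval the bound n <= 1 = nlim 0
   replaces it. *)
case: i i1 i2 A1 A2 B C D E => [|j] i1 i2 A1 A2 B C D E.
  have n1 := nproc_le1 t.
  by move: D; rewrite mul0r {1}/nlim ler01; rewrite mul0r in i2; lra.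
have jT : j%:R * h <= T.
  by apply: le_trans tT; apply: le_trans i1; rewrite ler_pM2r // ler_nat.
have := H j jT; rewrite ler_norml => /andP[_ F].
have G := nproc_mono i1.
lra.
Qed.

End NprocPaths.

Section Skorokhod.
Variable R : realType.

Lemma continuous_nlim (t : R) : nlim s @[s --> t] --> nlim t.
Proof.
apply/cvgrPdist_le => eps e0; near=> s.
apply: (@le_trans _ _ `|t - s|); last by near: s; exact: cvgr_dist_le.
have [st|ts] := lerP s t.
  have a := nlim_le st; have b := nlim_lip st.
  rewrite ler_norml; apply/andP; split; lra.
have a := nlim_le (ltW ts); have b := nlim_lip (ltW ts).
rewrite ler_norml; apply/andP; split; lra.
Unshelve. all: by end_near.
Qed.

Lemma cadlag_nlim : cadlag (@nlim R).
Proof.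
split=> t _; first exact/cvg_at_right_filter/continuous_nlim.
by apply/cvg_ex; exists (nlim t); exact/cvg_at_left_filter/continuous_nlim.
Qed.

Lemma time_change_id : time_change (fun t : R => t).
Proof.
split => //; last by move=> s s0; exists s.
by apply: continuous_subspaceT => x; exact: cvg_id.
Qed.

(** Locally uniform convergence is Skorokhod convergence with the identity as time change.
    Counterexamples for T = k + 1 and h = 1 / (k + 1) would form a sequence contradicting continuity
    of f at x. *)
Lemma skorokhod_continuous_uniform (f : (R -> R) -> R) (x : R -> R) (eps : R) :
  skorokhod_continuous f -> cadlag x -> 0 < eps ->
  exists T h, [/\ 0 < T, 0 < h & forall y, cadlag y ->
    (forall t, 0 <= t <= T -> `|y t - x t| <= h) -> `|f y - f x| <= eps].
Proof.
move=> cf cx e0; apply: contrapT => H.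
have {}H (k : nat) : exists y, [/\ cadlag y,
    forall t, 0 <= t <= k.+1%:R -> `|y t - x t| <= k.+1%:R^-1 & eps < `|f y - f x|].
  apply: contrapT => Hk; apply: H; exists k.+1%:R, k.+1%:R^-1; split => //.
  move=> y cy yx; rewrite leNgt; apply/negP => fy; apply: Hk.
  by exists y.
have [y Hy] := choice H.
have : f \o y @ \oo --> f x.
  apply: cf => //; first by move=> n; case: (Hy n).
  exists (fun _ t => t); split.
  - by move=> n; exact: time_change_id.
  - by move=> d d0; near=> n => t _; rewrite subrr normr0 ltW.
  - move=> T d d0; near=> n => t /andP[t0 tT]; case: (Hy n) => _ A _.
    apply: (@le_trans _ _ n.+1%:R^-1).
      apply: A; rewrite t0 /= (le_trans tT) //.
      have : T <= n%:R by near: n; exact: nbhs_infty_ger.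
      by move=> h; apply: le_trans h _; rewrite ler_nat.
    apply: (@le_trans _ _ n%:R^-1).
      have n0 : (0 < n)%N by near: n; exact: nbhs_infty_gt.
      by rewrite lef_pV2 ?posrE ?ltr0n // ler_nat.
    by near: n; exact: near_inv_le.
move/cvgrPdist_le => /(_ _ e0) [n _ /(_ n (leqnn n)) /=].
by rewrite distrC leNgt; case: (Hy n) => _ _ ->.
Unshelve. all: by end_near.
Qed.

End Skorokhod.

(** * Integral bounds for functions of unknown measurability *)

Section LowerIntegral.
Context (d : measure_display) (R : realType) (T : measurableType d) (P : probability T R).
Import HBNNSimple.

(* No measurability is needed: both parts of the integral are suprema over the
   simple functions below. *)
Lemma le_integral_nonmeas (f g : T -> \bar R) : (forall x, (f x <= g x)%E) ->
  (\int[P]_x f x <= \int[P]_x g x)%E.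
Proof.
move=> fg; rewrite /integral !patch_setT; apply: leeB.
  apply: le_ereal_sup => _ [k kf <-]; exists k => // x.
  apply: le_trans (kf x) _; rewrite !funeposE ge_max !le_max lexx orbT andbT.
  by rewrite fg.
apply: le_ereal_sup => _ [k kf <-]; exists k => // x.
apply: le_trans (kf x) _; rewrite !funenegE ge_max !le_max lexx orbT andbT.
by rewrite leeN2 fg.
Qed.

(** The function is dominated by the simple function equal to c on A and to M off A. *)
Lemma integral_upper (g : T -> R) (A : set T) (c M : R) : measurable A -> c <= M ->
  (forall w, A w -> g w <= c) -> (forall w, g w <= M) ->
  (\int[P]_w (g w)%:E <= (c + (M - c) * fine (P (~` A)))%:E)%E.
Proof.
move=> mA cM gc gM.
have mAc : measurable (~` A) by exact: measurableC.
apply: (@le_trans _ _ (\int[P]_w ((cst c%:E) w + (M - c)%:E * (\1_(~` A) w)%:E))%E).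
  apply: le_integral_nonmeas => w; rewrite -EFinM -EFinD lee_fin /= indicE.
  case: (pselect (A w)) => Aw.
    by rewrite memNset ?mulr0 ?addr0; [exact: gc|move=> /=].
  by rewrite mem_set // mulr1 addrCA subrr addr0.
rewrite integralD //; last 2 first.
- exact: finite_measure_integrable_cst.
- apply: integrableZl => //; exact: integrable_indic.
rewrite integral_cst // (_ : (c%:E * _)%E = c%:E); last first.
  by rewrite -[RHS]mule1; congr (_ * _)%E; exact: probability_setT.
rewrite integralZl //; last exact: integrable_indic.
by rewrite integral_indic // setIT [leRHS]EFinD [in leRHS]EFinM fineK // fin_num_measure.
Qed.

Lemma integral_lower (g : T -> R) (A : set T) (c M : R) : measurable A -> M <= c ->
  (forall w, A w -> c <= g w) -> (forall w, M <= g w) ->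
  ((c + (M - c) * fine (P (~` A)))%:E <= \int[P]_w (g w)%:E)%E.
Proof.
move=> mA cM gc gM.
have mAc : measurable (~` A) by exact: measurableC.
apply: (@le_trans _ _ (\int[P]_w ((cst c%:E) w + (M - c)%:E * (\1_(~` A) w)%:E))%E); last first.
  apply: le_integral_nonmeas => w; rewrite -EFinM -EFinD lee_fin /= indicE.
  case: (pselect (A w)) => Aw.
    by rewrite memNset ?mulr0 ?addr0; [exact: gc|move=> /=].
  by rewrite mem_set // mulr1 addrCA subrr addr0.
rewrite integralD //; last 2 first.
- exact: finite_measure_integrable_cst.
- apply: integrableZl => //; exact: integrable_indic.
rewrite integral_cst // (_ : (c%:E * _)%E = c%:E); last first.
  by rewrite -[RHS]mule1; congr (_ * _)%E; exact: probability_setT.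
rewrite integralZl //; last exact: integrable_indic.
by rewrite integral_indic // setIT EFinD EFinM fineK // fin_num_measure.
Qed.

Lemma probability_bigU_le (n : nat) (F : nat -> set T) (c : R) : (forall i, measurable (F i)) ->
  (forall i, (i < n)%N -> (P (F i) <= c%:E)%E) ->
  (P [set w | exists2 i, (i < n)%N & F i w] <= (n%:R * c)%:E)%E /\
  measurable [set w | exists2 i, (i < n)%N & F i w].
Proof.
move=> mF; elim: n => [|n IH] Fc.
  rewrite (_ : [set _ | _] = set0) ?measure0 ?mul0r //.
  by apply/seteqP; split => // w [].
have [A mA] := IH (fun i ni => Fc i (ltnW ni)).
set B := [set w | exists2 i, (i < n)%N & F i w] in A mA.
have -> : [set w | exists2 i, (i < n.+1)%N & F i w] = B `|` (F n `\` B).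
  apply/seteqP; split => [w [i]|w [[i ni Fi]|[Fn _]]].
  - rewrite ltnS leq_eqVlt => /orP[/eqP->|ni] Fi; last by left; exists i.
    by case: (pselect (B w)) => Bw; [left|right].
  - by exists i => //; exact: ltnW.
  - by exists n.
have mD : measurable (F n `\` B) by exact: measurableD.
split; last exact: measurableU.
rewrite measureU //; last by apply/seteqP; split => // w [Bw [_ nB]]; exact: nB.
rewrite -natr1 mulrDl mul1r EFinD; apply: leeD => //.
by apply: le_trans (Fc n _) => //; apply: le_measure; rewrite ?inE // => w [].
Qed.

End LowerIntegral.

(** * Convergence for the clocks *)

Section ClockLimit.
Context (d : measure_display) (R : realType) (Om : nat -> measurableType d).
Variables (P : forall N : nat, probability (Om N) R) (e : forall N : nat, Om N -> pair N -> R).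
Arguments e : clear implicits.
Variable alpha : nat -> R.
Hypothesis alpha_oo : alpha @ \oo --> +oo.
Hypothesis alpha_N : (fun N : nat => alpha N / N%:R) @ \oo --> 0.
Hypothesis cm : forall N, clock_model (P N) (e N).

Definition deviation N (t eps : R) : set (Om N) :=
  [set w | eps < `|nproc (alpha N) (e N w) t - nlim t|].

Arguments deviation : clear implicits.

Lemma measurable_far N t eps : measurable (deviation N t eps).
Proof.
exact: (finite_measurable (fun L => mlinks (alpha N) (cm N) t L)
  (fun L : {set pair N} => eps < `|#|[set i | small (alpha N) L i]%SET|%:R / N%:R - nlim t|)).
Qed.

Lemma clock_limit (t eps : R) : 0 < t -> 0 < eps ->
  \forall N \near \oo, (P N (deviation N t eps) <= eps%:E)%E.
Proof.
move=> t0 e0; have e20 : 0 < eps / 2 by lra.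
have H := lazy_limit alpha_oo alpha_N t0 e20.
near=> N.
have N0 : (0 < N)%N by near: N; exact: nbhs_infty_gt.
have Np : 0 < N%:R :> R by rewrite ltr0n.
set npair : R := #|{: pair N}|%:R.
have np0 : 0 <= npair by [].
pose F (L : {set pair N}) : R := (eps < `|mass (alpha N) L - nlim t|)%R%:R.
pose c : R := (t / N%:R) ^+ 2 * (npair + (1 + npair) * npair ^+ 2).
have c0 : 0 <= c by rewrite mulr_ge0 ?sqr_ge0 // addr_ge0 // mulr_ge0 ?addr_ge0 ?sqr_ge0.
have HN : \forall m \near \oo, lazyE (t / m%:R) m
    (fun w : seq (option (pair N)) => (eps / 2 < `|lazy_mass (alpha N) w - nlim t|)%R%:R) <= eps / 2.
  by near: N; exact: H.
(* [m1] makes the total ring probability of a step at most 1; [m2] makes the comparison error c / m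
   at most eps / 2. *)
have [m [m0 [m1 [m2 Hm]]]] : exists m : nat, (0 < m)%N /\
    m%:R^-1 <= (t / N%:R * npair + 1)^-1 :> R /\ m%:R^-1 <= eps / 2 / (c + 1) :> R /\
    lazyE (t / m%:R) m
    (fun w : seq (option (pair N)) => (eps / 2 < `|lazy_mass (alpha N) w - nlim t|)%R%:R) <= eps / 2.
  apply: (@filter_ex _ \oo); near=> m; split; first by near: m; exact: nbhs_infty_gt.
  split.
    near: m; apply: near_inv_le.
    by rewrite invr_gt0 ltr_wpDl // mulr_ge0 // divr_ge0 // ltW.
  split; last by near: m.
  by near: m; apply: near_inv_le; rewrite divr_gt0 // ltr_wpDl.
have mp : 0 < m%:R :> R by rewrite ltr0n.
have mh : m%:R * (t / m%:R) = t by rewrite mulrCA mulfV ?mulr1 // gt_eqF.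
have h0 : 0 <= t / m%:R by rewrite divr_ge0 // ltW.
have tN : 0 <= t / N%:R by rewrite divr_ge0 // ltW.
have A0 : 0 < t / N%:R * npair + 1 by rewrite ltr_wpDl // mulr_ge0.
have hP : t / m%:R / N%:R * npair <= 1.
  rewrite (_ : _ * npair = m%:R^-1 * (t / N%:R * npair)); last by rewrite !mulrA; ring.
  apply: (@le_trans _ _ ((t / N%:R * npair + 1)^-1 * (t / N%:R * npair + 1))).
    apply: ler_pM; rewrite ?invr_ge0 ?ler0n ?lerDl ?ler01 //; exact: mulr_ge0.
  by rewrite mulVf // gt_eqF.
have F01 L : 0 <= F L <= 1 by rewrite /F; case: (_ < _); rewrite ?lexx ler01.
have := Elinks_lazyE (alpha N) N0 (cm N) m h0 hP F01; rewrite mh -/npair.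
rewrite (_ : m%:R * _ = m%:R^-1 * c); last first.
  by rewrite /c -/npair; field; rewrite !gt_eqF.
move=> dist.
have dist2 : m%:R^-1 * c <= eps / 2.
  apply: (@le_trans _ _ (eps / 2 / (c + 1) * (c + 1))); last by rewrite divfK // gt_eqF // ltr_wpDl.
  by apply: ler_pM; rewrite ?invr_ge0 ?ler0n ?lerDl ?ler01.
have -> : P N (deviation N t eps) = (Elinks (P N) (alpha N) (e N) F t)%:E.
  rewrite (_ : deviation N t eps = [set w | eps < `|mass (alpha N) (links (alpha N) (e N w) t) - nlim
    t|]); last first.
    by apply/seteqP; split => w; rewrite /deviation /= nprocE.
  rewrite (finite_law (P N) (fun L => mlinks (alpha N) (cm N) t L)
    (fun L : {set pair N} => eps < `|mass (alpha N) L - nlim t|)).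
  rewrite big_mkcond /=; congr (_%:E); apply: eq_bigr => L _; rewrite /F.
  by case: (_ < _); rewrite ?mulr1 ?mulr0.
rewrite lee_fin.
have Hm' : lazyE (t / m%:R) m (fun w => F (lazy_links (alpha N) w)) <= eps / 2.
  apply: le_trans Hm; apply: (lazyE_le h0 hP) => w; rewrite /F /lazy_mass.
  have [a|//] := ltrP eps; by rewrite (lt_trans _ a) //; lra.
move: dist; rewrite ler_norml => /andP[_ ]; lra.
Unshelve. all: by end_near.
Qed.

Lemma near_all (K : nat) (Q : nat -> nat -> Prop) : (forall i, (i < K)%N -> \forall N \near \oo, Q N i) ->
  \forall N \near \oo, forall i, (i < K)%N -> Q N i.
Proof.
elim: K => [|K IH] H; first by near=> N.
have H1 := IH (fun i iK => H i (ltnW iK)); have H2 := H K (ltnSn K).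
near=> N; move=> i; rewrite ltnS leq_eqVlt => /orP[/eqP->|iK].
  by near: N.
by move: i iK; near: N.
Unshelve. all: by end_near.
Qed.

Lemma clock_uniform_limit (T h eps : R) : 0 < T -> 0 < h -> 0 < eps ->
  \forall N \near \oo, (0 < N)%N /\ exists A : set (Om N), [/\ measurable A, fine (P N (~` A)) <= eps &
    forall w, A w -> forall t, 0 <= t <= T -> `|nproc (alpha N) (e N w) t - nlim t| <= 2 * h].
Proof.
move=> T0 h0 e0.
have [K HK] : exists K : nat, T / h < K%:R by exists (Num.truncn (T / h)).+1; exact: truncnS_gt.
have K0 : 0 < K%:R :> R by apply: lt_trans HK; rewrite divr_gt0.
(* c is both the tolerance at a grid time and the probability of exceeding it; over K grid times the
   union bound gives K c <= eps. *)
pose c := Num.min h (eps / K%:R).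
have c0 : 0 < c by rewrite lt_min h0 divr_gt0.
have H : \forall N \near \oo, forall i, (i < K)%N -> (P N (deviation N (i.+1%:R * h) c) <= c%:E)%E.
  by apply: near_all => i _; apply: clock_limit => //; rewrite mulr_gt0.
near=> N; have N0 : (0 < N)%N by near: N; exact: nbhs_infty_gt.
have HN : forall i, (i < K)%N -> (P N (deviation N (i.+1%:R * h) c) <= c%:E)%E by near: N.
split=> //.
pose B := [set w | exists2 i, (i < K)%N & deviation N (i.+1%:R * h) c w].
have [PB mB] : (P N B <= (K%:R * c)%:E)%E /\ measurable B.
  by apply: probability_bigU_le => // i; exact: measurable_far.
exists (~` B); split; first exact: measurableC.
  rewrite setCK -lee_fin fineK ?fin_num_measure //; apply: le_trans PB _.
  rewrite lee_fin mulrC -ler_pdivlMr //.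
  by rewrite ge_min lexx orbT.
move=> w nB t tT; apply: (@nproc_uniform _ _ _ _ N0 h T) => // i iT.
rewrite leNgt; apply/negP => fw; apply: nB; exists i.
  rewrite -(ltr_nat R); apply: le_lt_trans HK.
  by rewrite ler_pdivlMr.
by rewrite /deviation /=; apply: le_lt_trans fw; rewrite ge_min lexx.
Unshelve. all: by end_near.
Qed.

Theorem clock_cvg_dist :
  cvg_dist_skorokhod P (fun N w t => nproc (alpha N) (e N w) t) (@nlim R).
Proof.
move=> f [M fM] cf.
have M0 : 0 <= M by apply: le_trans (fM (@nlim R)).
have H eps : 0 < eps -> \forall N \near \oo,
    ((f (@nlim R) - eps)%:E <= \int[P N]_w (f (nproc (alpha N) (e N w)))%:E)%E /\
    (\int[P N]_w (f (nproc (alpha N) (e N w)))%:E <= (f (@nlim R) + eps)%:E)%E.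
  move=> e0; have e20 : 0 < eps / 2 by lra.
  have [T [h [T0 h0 Hf]]] := skorokhod_continuous_uniform cf (@cadlag_nlim R) e20.
  have h20 : 0 < h / 2 by lra.
  (* Off the good event the integrand is replaced by M + eps or - M - eps, at distance at most 2 (M
     + eps) from the bound used on it; this costs at most eps / 2. Using M + eps also covers M =
     0. *)
  have c0 : 0 < eps / (4 * (M + eps)) by rewrite divr_gt0 // mulr_gt0 // ltr_wpDl.
  near=> N.
  have [N0 [A [mA PA HA]]] : (0 < N)%N /\ exists A : set (Om N), [/\ measurable A,
      fine (P N (~` A)) <= eps / (4 * (M + eps)) &
      forall w, A w -> forall t, 0 <= t <= T -> `|nproc (alpha N) (e N w) t - nlim t| <= 2 * (h / 2)].
    by near: N; exact: clock_uniform_limit.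
  have fA w : A w -> `|f (nproc (alpha N) (e N w)) - f (@nlim R)| <= eps / 2.
    move=> Aw; apply: Hf; first exact: cadlag_nproc.
    by move=> t tT; rewrite (_ : h = 2 * (h / 2)); [exact: HA | field].
  have q0 : 0 <= fine (P N (~` A)) by exact: fine_ge0.
  have qe : 2 * (M + eps) * fine (P N (~` A)) <= eps / 2.
    rewrite mulrC -ler_pdivlMr; last by rewrite mulr_gt0 // ltr_wpDl.
    apply: le_trans PA _; rewrite le_eqVlt; apply/orP; left; apply/eqP; field.
    by rewrite gt_eqF // ltr_wpDl.
  have fl := fM (@nlim R); move: fl; rewrite ler_norml => /andP[fl1 fl2].
  have Me : 0 <= M + eps by lra.
  split.
    apply: le_trans (integral_lower (P N) (A := A) (c := f (@nlim R) - eps / 2) (M := - M - eps) mA _ _ _).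
    - rewrite lee_fin.
      have := ler_wpM2r q0 (_ : - (2 * (M + eps)) <= - M - eps - (f (@nlim R) - eps / 2)).
      have X : - (2 * (M + eps)) <= - M - eps - (f (@nlim R) - eps / 2) by lra.
      move=> /(_ X); rewrite mulNr; lra.
    - lra.
    - by move=> w /fA; rewrite ler_norml => /andP[]; lra.
    - by move=> w; have := fM (nproc (alpha N) (e N w)); rewrite ler_norml => /andP[]; lra.
  apply: le_trans (integral_upper (P N) (A := A) (c := f (@nlim R) + eps / 2) (M := M + eps) mA _ _ _) _.
  - lra.
  - by move=> w /fA; rewrite ler_norml => /andP[]; lra.
  - by move=> w; have := fM (nproc (alpha N) (e N w)); rewrite ler_norml => /andP[]; lra.
  - rewrite lee_fin.
    have X : M + eps - (f (@nlim R) + eps / 2) <= 2 * (M + eps) by lra.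
    have := ler_wpM2r q0 X; lra.
apply/fine_cvgP; split.
  have := H 1 ltr01; apply: filterS => N [a b].
  by rewrite fin_numE; apply/andP; split; apply/eqP => E; rewrite E in a b.
apply/cvgrPdist_le => eps e0; have := H eps e0; apply: filterS => N [].
rewrite /comp; case: (\int[P N]_w _)%E => [r| |] //=.
by rewrite !lee_fin => a b; rewrite ler_norml; apply/andP; split; lra.
Unshelve. all: by end_near.
Qed.

End ClockLimit.

(** * The conditional law *)

Section ConditionalLaw.
Context (d : measure_display) (R : realType) (T : measurableType d) (P : probability T R).
Variables (N : nat) (alpha : R) (e : T -> pair N -> R) (t : R).
Hypothesis N0 : (0 < N)%N.
Hypothesis cm : clock_model P e.
Hypothesis t0 : 0 <= t.
Local Notation q := (expR (- (t / N%:R))).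
Local Notation e' S w := (silence (inside S) t (e w)).

Let me p : measurable_fun [set: T] (fun w => e w p). Proof. by case: cm. Qed.

Definition outer_prob (S : {set 'I_N}) : R := fine (P [set w | Ssol alpha (e' S w) t == S]).

Definition weight (S : {set 'I_N}) (G : {set pair N}) : R :=
  (1 - q) ^+ #|G| * q ^+ (#|[set p : pair N | inside S p]%SET| - #|G|).

Definition solution (w : T) : {set 'I_N} * {set pair N} :=
  (Ssol alpha (e w) t, rung (Ssol alpha (e w) t) (e w) t).

Lemma measurable_solution b : measurable (solution @^-1` [set b]).
Proof.
pose xi w : {set pair N} * {ffun pair N -> bool} := (links alpha (e w) t, [ffun p => e w p <= t]).
pose g (a : {set pair N} * {ffun pair N -> bool}) : {set 'I_N} * {set pair N} :=
  ([set i | small alpha a.1 i]%SET, [set p | inside [set i | small alpha a.1 i]%SET p & a.2 p]%SET).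
have mxi c : measurable (xi @^-1` [set c]).
  rewrite (_ : _ @^-1` _ = [set w | links alpha (e w) t = c.1] `&` [set w | [ffun p => e w p <= t] = c.2]).
    apply: measurableI; first exact: measurable_links.
    by apply: measurable_finfun => p; exact: measurable_ler_cst.
  by apply/seteqP; split => w; rewrite /xi /=; case: c => c1 c2 /= [-> ->].
rewrite (_ : _ @^-1` _ = [set w | g (xi w) == b]); first exact: (finite_measurable mxi (fun a => g a == b)).
have gxi w : g (xi w) = solution w.
  rewrite /g /solution /=; congr (_, _); apply/setP => p; rewrite !inE ffunE //.
by apply/seteqP; split => w /=; rewrite gxi => /eqP.
Qed.

Lemma prod_weight (S : {set 'I_N}) (G : {set pair N}) : G \subset [set p | inside S p]%SET ->
  \prod_(p | inside S p) (if p \in G then 1 - q else q) = weight S G.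
Proof.
move=> GS; rewrite (bigID (fun p => p \in G)) /=; congr (_ * _).
  rewrite (eq_bigr (fun=> 1 - q)) => [|p /andP[_ ->] //].
  rewrite (eq_bigl (fun p => p \in G)) ?prodr_const // => p.
  case: (boolP (p \in G)) => pG; rewrite ?andbF // andbT.
  by have := fintype.subsetP GS p pG; rewrite inE.
rewrite (eq_bigr (fun=> q)) => [|p /andP[_ /negbTE ->] //].
rewrite (eq_bigl (fun p => p \in ([set p | inside S p] :\: G)%SET)); last first.
  by move=> p; rewrite !inE andbC.
by rewrite prodr_const cardsD (finset.setIidPr GS).
Qed.

(** For an admissible G, [Ssol_separation] makes the event an intersection of one on the clocks
    outside S and independent constraints on the clocks inside; otherwise the event is empty. *)
Lemma law_solution (S : {set 'I_N}) (G : {set pair N}) :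
  law P solution (S, G) =
  if (G \subset [set p | inside S p]%SET) && [forall x in S, small alpha G x]
  then outer_prob S * weight S G else 0.
Proof.
rewrite /law; case: ifP => [/andP[GS G0]|H]; last first.
  rewrite (_ : _ @^-1` _ = set0) ?measure0 //; apply/seteqP; split => // w /= [] SS GG.
  rewrite SS in GG; have := Ssol_separation alpha S (e w) t; rewrite SS eqxx GG.
  case/esym/andP => G0 _; move: H; rewrite G0 andbT -GG.
  by move/negP; apply; apply/fintype.subsetP => p; rewrite !inE => /andP[].
pose B p : set R := if inside S p then if p \in G then `]-oo, t] else `]t, +oo[ else setT.
have mB p : measurable (B p) by rewrite /B; case: ifP => // _; case: ifP.
have BT p : ~~ inside S p -> B p = setT by rewrite /B => /negbTE ->.
have PB p : inside S p -> P ((fun w => e w p) @^-1` B p) = (if p \in G then 1 - q else q)%:E.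
  move=> pS; rewrite /B pS; case: ifP => _.
    by rewrite -(clock_cdf N0 cm p t0); congr (P _).
  rewrite -(clock_tail N0 cm p t0); congr (P _).
  by apply/seteqP; split => w /=; rewrite in_itv /= andbT.
have := indep_masked alpha cm t (fun L => [set i | small alpha L i]%SET == S) mB BT.
rewrite (eq_bigr (fun p => (if p \in G then 1 - q else q)%:E)) => [|p /PB -> //].
rewrite prodEFin prod_weight // => H.
have fo : P [set w | Ssol alpha (e' S w) t == S] = (outer_prob S)%:E.
  rewrite /outer_prob fineK // fin_num_measure //.
  have me' p : measurable_fun [set: T] (fun w => e' S w p).
    by rewrite /silence; case: (boolP (inside S p)) => _; [exact: measurable_cst|exact: me].
  exact: (finite_measurable (fun L => measurable_links alpha me' t L) (fun L => [set i | small alpha L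
    i]%SET == S)).
have -> : solution @^-1` [set (S, G)] = [set w | [set i | small alpha (links alpha (e' S w) t) i]%SET
  == S] `&`
   \bigcap_(p in [set: pair N]) ((fun w => e w p) @^-1` B p).
  apply/seteqP; split => w.
    move=> [SS GG]; rewrite SS in GG.
    have := Ssol_separation alpha S (e w) t; rewrite SS eqxx => /esym/andP[_ S']; split => // p _.
    rewrite /= /B; case: ifP => // pS; rewrite -GG inE pS /=.
    by case: (lerP (e w p) t) => pt /=; rewrite in_itv /= ?andbT.
  move=> [/= S' Bw].
  have GG : rung S (e w) t = G.
    apply/setP => p; rewrite inE; case: (boolP (inside S p)) => pS /=.
      have := Bw p Logic.I; rewrite /= /B pS; case: ifP => _ /=; rewrite in_itv /= ?andbT //.
      by move=> pt; apply/negbTE; rewrite -ltNge.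
    by apply/esym/negbTE; apply: contra pS => /(fintype.subsetP GS); rewrite inE.
  have SS : Ssol alpha (e w) t = S.
    by apply/eqP; rewrite Ssol_separation GG G0.
  by rewrite /solution SS GG.
change (fine (P ([set w | [set i | small alpha (links alpha (e' S w) t) i]%SET == S] `&`
   \bigcap_(p in [set: pair N]) ((fun w => e w p) @^-1` B p))) = outer_prob S * weight S G).
rewrite H; change (fine (P [set w | Ssol alpha (e' S w) t == S] * (weight S G)%:E)%E =
  outer_prob S * weight S G).
by rewrite fo -EFinM.
Qed.

Lemma weight_relabel (S : {set 'I_N}) (G : {set pair #|S|}) :
  weight S (relabel (S := S) @: G)%SET = er_weight (1 - q) G.
Proof.
rewrite /weight /er_weight card_inside (card_imset _ (@relabel_inj _ S)).
by congr (_ * _ ^+ _); ring.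
Qed.

(** [Qk] is [Q] read on graphs with k vertices, after transport along #|S| = k. The outer
    probabilities come out as a factor that is the same for every Q. *)
Lemma law_solution_sum (k : nat) (Q : forall S : {set 'I_N}, pred {set pair N}) (Qk : pred {set pair k}) :
  (forall (S : {set 'I_N}) (Sk : #|S| = k) (G : {set pair #|S|}),
     Q S (relabel (S := S) @: G)%SET = Qk (eq_rect #|S| (fun k => {set pair k}) G k Sk)) ->
  P [set w | (#|(solution w).1| == k) && Q (solution w).1 (solution w).2] =
  ((\sum_(S : {set 'I_N} | #|S| == k) outer_prob S) *
   \sum_(G : {set pair k} | no_large alpha G && Qk G) er_weight (1 - q) G)%:E.
Proof.
move=> QQ; rewrite (finite_law P measurable_solution (fun b => (#|b.1| == k) && Q b.1 b.2)); congr (_%:E).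
rewrite [LHS](_ : _ = \sum_(S : {set 'I_N} | #|S| == k) \sum_(G | Q S G) law P solution (S, G)); last first.
  by rewrite pair_big_dep; apply: eq_bigr => -[S G].
rewrite mulr_suml.
apply: eq_bigr => S /eqP Sk.
rewrite (eq_bigr (fun G : {set pair N} => if (G \subset [set p | inside S p]%SET) && [forall x in S,
  small alpha G x]
  then outer_prob S * weight S G else 0)) => [|G _]; last exact: law_solution.
rewrite -big_mkcondr /=.
rewrite (eq_bigl (fun G : {set pair N} => (G \subset [set p | inside S p]%SET) && ([forall x in S,
  small alpha G x] && Q S G))); last first.
  by move=> G; rewrite andbC andbA.
rewrite sum_relabel -mulr_sumr; congr (_ * _).
move: (QQ S Sk) => {}QQ; move: Qk QQ; case: _ / Sk => Qk /= QQ.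
apply: eq_big => [G|G _]; last exact: weight_relabel.
by rewrite no_large_relabel QQ.
Qed.

(** That common factor cancels between the probability of an isomorphism class and the probability
    of k particles in solution, leaving a ratio of sums of Erdos-Renyi weights. *)
Theorem conditional_law (k : nat) (H : {set pair k}) :
  (0 < P [set w | #|Ssol alpha (e w) t| = k])%E ->
  P [set w | #|Ssol alpha (e w) t| = k /\
     graph_iso [set: 'I_k]%SET (adjL H) (Ssol alpha (e w) t) (Cadj alpha (e w) t)] =
  ((er_cond_iso (1 - q) alpha H)%:E * P [set w | #|Ssol alpha (e w) t| = k])%E.
Proof.
pose a : R := \sum_(S : {set 'I_N} | #|S| == k) outer_prob S.
pose den : R := \sum_(G : {set pair k} | no_large alpha G) er_weight (1 - q) G.
have -> : P [set w | #|Ssol alpha (e w) t| = k] = (a * den)%:E.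
  have := @law_solution_sum k (fun _ => xpredT) xpredT (fun _ _ _ => erefl).
  rewrite (eq_bigl (@no_large R k alpha)) => [<-|G]; last by rewrite andbT.
  by congr (P _); apply/seteqP; split => w /=; rewrite andbT => /eqP.
rewrite lte_fin => ad0.
pose Q S : pred {set pair N} := fun G => `[< graph_iso [set: 'I_k]%SET (adjL H) S (adjL G) >].
pose Qk : pred {set pair k} := fun G => `[< graph_iso [set: 'I_k]%SET (adjL H) [set: 'I_k]%SET (adjL G) >].
have QQ (S : {set 'I_N}) (Sk : #|S| = k) (G : {set pair #|S|}) :
    Q S (relabel (S := S) @: G)%SET = Qk (eq_rect #|S| (fun k => {set pair k}) G k Sk).
  rewrite /Q /Qk; move: H {ad0 Q Qk a den}; case: _ / Sk => H /=.
  by apply: asbool_equiv_eq; exact: graph_iso_relabel.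
have := law_solution_sum QQ; rewrite -/a => E.
rewrite (_ : [set w | _] = [set w | (#|(solution w).1| == k) && Q (solution w).1 (solution w).2]); last first.
  have CE w : Cadj alpha (e w) t = [rel i j | adjL (rung (Ssol alpha (e w) t) (e w) t) i j].
    by apply/funext => i; apply/funext => j; exact: (Cadj_rung (erefl _)).
  apply/seteqP; split => w /=; rewrite /Q CE.
    by move=> [/eqP -> ?]; exact/asboolP.
  by move=> /andP[/eqP -> /asboolP].
rewrite E -EFinM; congr (_%:E); rewrite /er_cond_iso -/den.
have den0 : den != 0 by apply: contraTneq ad0 => ->; rewrite mulr0 ltxx.
by rewrite mulrC -mulrA [den^-1 * _]mulrC mulfK.
Qed.

End ConditionalLaw.

Theorem theorem1p2 (d : measure_display) (R : realType)
    (Om : nat -> measurableType d) (P : forall N : nat, probability (Om N) R)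
    (e : forall N : nat, Om N -> pair N -> R) (alpha : nat -> R)
    (halpha_oo : alpha @ \oo --> +oo)
    (halpha_N : (fun N : nat => alpha N / N%:R) @ \oo --> 0)
    (hclocks : forall N : nat, clock_model (P N) (e N)) :
  (forall (N : nat) (t : R) (k : nat), (2 <= N)%N -> 0 <= t ->
     (0 < P N [set w | #|Ssol (alpha N) (e N w) t| = k]%classic)%E ->
     forall H : {set pair k},
       P N [set w | #|Ssol (alpha N) (e N w) t| = k /\
              graph_iso [set: 'I_k] (adjL H) (Ssol (alpha N) (e N w) t)
                        (Cadj (alpha N) (e N w) t)]%classic =
       ((er_cond_iso (1 - expR (- t / N%:R)) (alpha N) H)%:E *
        P N [set w | #|Ssol (alpha N) (e N w) t| = k]%classic)%E)
  /\
  ((exists2 gamma : R, 3^-1 < gamma &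
      (fun N : nat => alpha N / (N%:R `^ (2 / 3) * (ln N%:R) `^ gamma)) @ \oo --> +oo) ->
   (fun N : nat => alpha N / N%:R) @ \oo --> 0 ->
   cvg_dist_skorokhod P (fun N w t => nproc (alpha N) (e N w) t) (@nlim R)).
Proof.
split=> [N t k N2 t0 Pk H|_ _]; last exact: clock_cvg_dist.
by rewrite mulNr; apply: conditional_law => //; exact: ltnW.
Qed.
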